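(* Let $\mathbf{x} \in X_*$. The twisting functor $\mathbf{T}$ and the untwisting functor $\mathbf{U}_{\mathbf{x}}$ have the following properties. (a) The twisting functor $\mathbf{T}$ maps the isomorphism class $\mathrm{ev}_\psi$, for $\psi \in \mathcal{E}$ with $\mathrm{Supp}\,\psi \in X_*$, to the isomorphism class $\mathrm{ev}^\Gamma_{\psi^\Gamma}$ for $\psi^\Gamma \in \mathcal{E}^\Gamma$, where $$\psi^\Gamma(x) = \sum_{\gamma \in \Gamma} \gamma \cdot \psi(\gamma^{-1} \cdot x), \qquad x \in X_{\mathrm{rat}}.$$ (b) The untwisting functor $\mathbf{U}_{\mathbf{x}}$ maps the isomorphism class $\mathrm{ev}^\Gamma_\psi$, for $\psi \in \mathcal{E}^\Gamma$ with $\mathrm{Supp}\,\psi \subseteq \Gamma\cdot\mathbf{x}$, to the isomorphism class $\mathrm{ev}_{\psi_{\mathbf{x}}}$, where $\psi_{\mathbf{x}} \in \mathcal{E}$ is given by $\psi_{\mathbf{x}}(x)=\psi(x)$ if $x\in\mathbf{x}$ and $\psi_{\mathbf{x}}(x)=0$ if $x\notin\mathbf{x}$. (c) The functors $\mathbf{T}_{\mathbf{x}} : \mathcal{F}_{\mathbf{x}} \to \mathcal{F}^\Gamma_{\mathbf{x}}$ and $\mathbf{U}_{\mathbf{x}} : \mathcal{F}^\Gamma_{\mathbf{x}} \to \mathcal{F}_{\mathbf{x}}$ are mutually inverse isomorphisms of categories.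
   Context: Setting. Let $k$ be an algebraically closed field of characteristic zero, $A$ a finitely generated unital associative commutative $k$-algebra, $X=\mathrm{Spec}\,A$, and $X_{\mathrm{rat}}$ the set of rational points of $X$ (equal to $\mathrm{maxSpec}\,A$); for $x\in X_{\mathrm{rat}}$ let $\mathfrak{m}_x\subseteq A$ be the corresponding maximal ideal. Let $\mathfrak{g}$ be a finite-dimensional semisimple Lie algebra over $k$, and let $\Gamma$ be a finite abelian group acting on $A$ by $k$-algebra automorphisms (equivalently on $X$, with $(\gamma\cdot f)(x)=f(\gamma^{-1}\cdot x)$, so $\gamma\cdot\mathfrak{m}_x=\mathfrak{m}_{\gamma\cdot x}$) and on $\mathfrak{g}$ by Lie algebra automorphisms. Assume $\Gamma$ acts freely on $X$, i.e. freely on $X_{\mathrm{rat}}$. The Lie algebra $\mathfrak{g}\otimes A$ (tensor over $k$) has bracket $[a\otimes f,b\otimes g]=[a,b]\otimes fg$; for $\alpha=\sum a_i\otimes f_i$ put $\alpha(x)=\sum f_i(x)a_i\in\mathfrak{g}$. $\Gamma$ acts diagonally on $\mathfrak{g}\otimes A$, and $(\mathfrak{g}\otimes A)^\Gamma$ is the fixed-point Lie subalgebra. $\mathbb{N}=\mathbb{Z}_{\ge0}$. $X_*$ is the set of finite subsets $\mathbf{x}\subseteq X_{\mathrm{rat}}$ such that $\Gamma\cdot x\cap\Gamma\cdot x'=\varnothing$ for distinct $x,x'\in\mathbf{x}$. Irreducibles. Fix a triangular decomposition $\mathfrak{g}=\mathfrak{n}^-\oplus\mathfrak{h}\oplus\mathfrak{n}^+$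 and simple roots; $P^+$ is the set of dominant integral weights, identified with isomorphism classes of irreducible finite-dimensional $\mathfrak{g}$-modules. $\Gamma$ acts on $P^+$: if $\rho$ is irreducible of highest weight $\lambda$, then $\gamma\cdot\lambda$ is the highest weight of $\rho\circ\gamma^{-1}$ (this is the action through diagram automorphisms). $\mathcal{E}$ is the set of finitely supported functions $\psi:X_{\mathrm{rat}}\to P^+$, with $\mathrm{Supp}\,\psi=\{x:\psi(x)\neq0\}$, and $\mathcal{E}^\Gamma\subseteq\mathcal{E}$ is the subset of $\Gamma$-equivariant functions. For $\mathbf{x}\in X_*$ and representations $\rho_x:\mathfrak{g}\to\mathrm{End}\,V_x$ ($x\in\mathbf{x}$), the evaluation representation of $(\mathfrak{g}\otimes A)^\Gamma$ is the composition of $\alpha\mapsto(\alpha(x))_{x\in\mathbf{x}}\in\bigoplus_{x\in\mathbf{x}}\mathfrak{g}$ with $\bigotimes_{x\in\mathbf{x}}\rho_x$. For $\psi\in\mathcal{E}^\Gamma$, $\mathrm{ev}^\Gamma_\psi$ is the isomorphism class of the evaluation representation with $\rho_x$ irreducible of highest weight $\psi(x)$, $x\in\mathbf{x}$, where $\mathbf{x}$ contains exactly one point of each $\Gamma$-orbit in $\mathrm{Supp}\,\psi$ (independent of the choice of $\mathbf{x}$; trivial class if $\psi=0$). For $\psi\in\mathcal{E}$, $\mathrm{ev}_\psi$ is the same construction for $\mathfrak{g}\otimes A$ (i.e. with $\Gamma$ trivial). Known: $\psi\mapsto\mathrm{ev}^\Gamma_\psi$ is a bijection from $\mathcal{E}^\Gamma$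 onto isomorphism classes of irreducible finite-dimensional $(\mathfrak{g}\otimes A)^\Gamma$-modules, and similarly for $\mathcal{E}$ and $\mathfrak{g}\otimes A$. The support of an irreducible module in class $\mathrm{ev}^\Gamma_\psi$ (resp. $\mathrm{ev}_\psi$) is $\mathrm{Supp}\,\psi$. Categories. $\mathcal{F}$ and $\mathcal{F}^\Gamma$ are the categories of finite-dimensional modules of $\mathfrak{g}\otimes A$ and $(\mathfrak{g}\otimes A)^\Gamma$. For $\mathbf{x}\in X_*$, $\mathcal{F}_{\mathbf{x}}$ (resp. $\mathcal{F}^\Gamma_{\mathbf{x}}$) is the full subcategory of modules all of whose irreducible constituents have support contained in $\mathbf{x}$ (resp. in $\Gamma\cdot\mathbf{x}$). Functors. For finitely supported $\eta:X_{\mathrm{rat}}\to\mathbb{N}$ let $I_\eta=\prod_{x\in\mathrm{Supp}\,\eta}\mathfrak{m}_x^{\eta(x)}$ and $(\mathfrak{g}\otimes I_\eta)^\Gamma:=(\mathfrak{g}\otimes I_\eta)\cap(\mathfrak{g}\otimes A)^\Gamma$. The twisting functor $\mathbf{T}:\mathcal{F}\to\mathcal{F}^\Gamma$ is restriction from $\mathfrak{g}\otimes A$ to $(\mathfrak{g}\otimes A)^\Gamma$; $\mathbf{T}_{\mathbf{x}}:\mathcal{F}_{\mathbf{x}}\to\mathcal{F}^\Gamma_{\mathbf{x}}$ is the induced functor. The untwisting functor $\mathbf{U}_{\mathbf{x}}:\mathcal{F}^\Gamma_{\mathbf{x}}\to\mathcal{F}_{\mathbf{x}}$ is defined as follows.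 Each $V\in\mathcal{F}^\Gamma_{\mathbf{x}}$ is annihilated by $(\mathfrak{g}\otimes I_\eta)^\Gamma$ for some $\eta$ with $\mathrm{Supp}\,\eta\subseteq\mathbf{x}$, and for such $\eta$ the inclusion $(\mathfrak{g}\otimes A)^\Gamma\subseteq\mathfrak{g}\otimes A$ induces an isomorphism $(\mathfrak{g}\otimes A)^\Gamma/(\mathfrak{g}\otimes I_\eta)^\Gamma\cong(\mathfrak{g}\otimes A)/(\mathfrak{g}\otimes I_\eta)$. Then $\mathbf{U}_{\mathbf{x}}(V)=V^\eta$ is the vector space $V$ with the action $\mathfrak{g}\otimes A\twoheadrightarrow(\mathfrak{g}\otimes A)/(\mathfrak{g}\otimes I_\eta)\cong(\mathfrak{g}\otimes A)^\Gamma/(\mathfrak{g}\otimes I_\eta)^\Gamma\to\mathrm{End}\,V$ (independent of $\eta$), and $\mathbf{U}_{\mathbf{x}}$ is the identity on underlying linear maps of morphisms. *)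

(* Defs.v *)
From HB Require Import structures.
From mathcomp Require Import all_boot all_order all_algebra all_fingroup.
From mathcomp Require Import boolp classical_sets functions cardinality fsbigop.

Set Implicit Arguments.
Unset Strict Implicit.
Unset Printing Implicit Defensive.

Import GRing.Theory.
Local Open Scope classical_set_scope.
Local Open Scope ring_scope.

HB.mixin Record Lmodule_isLie (k : fieldType) L of GRing.Lmodule k L := {
  lie : L -> L -> L;
  lie_linearl : forall y, linear (fun x => lie x y);
  lie_linearr : forall x, linear (lie x);
  liexx : forall x, lie x x = 0;
  lie_jacobi : forall x y z,
    lie x (lie y z) + lie y (lie z x) + lie z (lie x y) = 0
}.

#[short(type="lieAlgType")]
HB.structure Definition LieAlgebra (k : fieldType) :=
  {L of Lmodule_isLie k L & GRing.Lmodule k L}.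

#[short(type="finLieAlgType")]
HB.structure Definition FinLieAlgebra (k : fieldType) :=
  {L of LieAlgebra k L & Vector k L}.

Definition lspan (k : fieldType) (V : lmodType k) (S : set V) : set V :=
  [set v | exists s : seq (k * V),
     (forall p, p \in s -> S p.2) /\ v = \sum_(p <- s) p.1 *: p.2].

Section LieTheory.
Variables (k : fieldType) (L : lieAlgType k).
Implicit Types x y z : L.

Lemma lieDl x y z : lie (x + y) z = lie x z + lie y z.
Proof. by have := lie_linearl z 1 x y; rewrite !scale1r. Qed.

Lemma lieDr x y z : lie x (y + z) = lie x y + lie x z.
Proof. by have := lie_linearr x 1 y z; rewrite !scale1r. Qed.

Lemma lie_anti x y : lie x y = - lie y x.
Proof.
apply/eqP; rewrite -subr_eq0 opprK; apply/eqP.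
by have := liexx (x + y); rewrite lieDl !lieDr !liexx add0r addr0.
Qed.

End LieTheory.

Record lie_hom (k : fieldType) (L M : lieAlgType k) := LieHom {
  lie_hom_fun :> {linear L -> M};
  lie_homE : forall x y, lie_hom_fun (lie x y) =
                         lie (lie_hom_fun x) (lie_hom_fun y)
}.

Section Semisimple.
Variables (k : fieldType) (g : finLieAlgType k).

Definition lie_ideal (I : {vspace g}) : Prop :=
  forall x y : g, y \in I -> lie x y \in I.

Definition derived (I : {vspace g}) : {vspace g} :=
  <<[seq lie x y | x <- vbasis I, y <- vbasis I]>>%VS.

Definition lie_solvable (I : {vspace g}) : Prop :=
  exists n, iter n derived I = 0%VS.

(* The radical of g is the sum of its solvable ideals. *)
Definition semisimple : Prop :=
  forall I : {vspace g}, lie_ideal I -> lie_solvable I -> I = 0%VS.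

End Semisimple.

Record lie_rep (k : fieldType) (L : lieAlgType k) (V : vectType k) := LieRep {
  lie_rep_fun :> L -> 'End(V);
  lie_rep_linear : linear lie_rep_fun;
  lie_rep_lie : forall x y v, lie_rep_fun (lie x y) v =
    lie_rep_fun x (lie_rep_fun y v) - lie_rep_fun y (lie_rep_fun x v)
}.

Record liemod (k : fieldType) (L : lieAlgType k) := LieMod {
  carrier :> vectType k;
  action : lie_rep L carrier
}.
Arguments action {k L} _.

Section Modules.
Variables (k : fieldType) (L : lieAlgType k).
Implicit Types V W : liemod L.

Definition equivariant V W (f : 'Hom(V, W)) : Prop :=
  forall a v, f (action V a v) = action W a (f v).

Definition submodule V (U : {vspace V}) : Prop :=
  forall a u, u \in U -> action V a u \in U.

Definition irreducible V : Prop :=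
  (fullv : {vspace V}) <> 0%VS /\
  forall U : {vspace V}, submodule U -> U = 0%VS \/ U = fullv.

(* W is an irreducible subquotient of V: f induces an isomorphism from
   U / (U :&: ker f) onto W. *)
Definition constituent V W : Prop :=
  irreducible W /\
  exists (U : {vspace V}) (f : 'Hom(V, W)),
    [/\ submodule U, (f @: U)%VS = fullv
      & forall a u, u \in U -> f (action V a u) = action W a (f u)].

Fact trivial_rep_linear (V : vectType k) :
  linear (fun _ : L => 0 : 'End(V)).
Proof. by move=> a u v; rewrite scaler0 addr0. Qed.

Fact trivial_rep_lie (V : vectType k) (x y : L) (v : V) :
  let z : 'End(V) := 0 in z v = z (z v) - z (z v).
Proof. by move=> z; rewrite subrr lfunE. Qed.

Definition trivial_rep (V : vectType k) : lie_rep L V :=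
  LieRep (@trivial_rep_linear V) (@trivial_rep_lie V).

End Modules.

Section Pullback.
Variables (k : fieldType) (L M : lieAlgType k) (h : lie_hom L M).

Fact pull_linear (V : liemod M) : linear (fun a : L => action V (h a)).
Proof. by move=> c u v; rewrite linearP lie_rep_linear. Qed.

Fact pull_lie (V : liemod M) (x y : L) (v : V) :
  action V (h (lie x y)) v =
  action V (h x) (action V (h y) v) - action V (h y) (action V (h x) v).
Proof. by rewrite lie_homE lie_rep_lie. Qed.

Definition pull (V : liemod M) : liemod L :=
  LieMod (LieRep (@pull_linear V) (@pull_lie V)).

End Pullback.

(* The laws are propositions, so equality of functors is equality of the object
   and morphism maps. *)

Record category := Category {
  obj :> Type;
  hom : obj -> obj -> Type;
  idm : forall X, hom X X;
  compm : forall X Y Z, hom Y Z -> hom X Y -> hom X Z;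
  compm1 : forall X Y (f : hom X Y), compm f (idm X) = f;
  comp1m : forall X Y (f : hom X Y), compm (idm Y) f = f;
  compmA : forall X Y Z T (h : hom Z T) (k : hom Y Z) (f : hom X Y),
    compm h (compm k f) = compm (compm h k) f
}.
Arguments hom {c} _ _.
Arguments idm {c} X.
Arguments compm {c X Y Z} _ _.

Record functor (C D : category) := Functor {
  fobj :> C -> D;
  fmor : forall X Y : C, hom X Y -> hom (fobj X) (fobj Y);
  fmor1 : forall X, fmor (idm X) = idm (fobj X);
  fmorM : forall X Y Z (h : hom Y Z) (f : hom X Y),
    fmor (compm h f) = compm (fmor h) (fmor f)
}.
Arguments fmor {C D} f {X Y} _ : rename.

Definition fid (C : category) : functor C C :=
  Functor (fobj := id) (fmor := fun _ _ f => f)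
    (fun _ => erefl) (fun _ _ _ _ _ => erefl).

Section FunctorComp.
Variables (C D E : category) (G : functor D E) (F : functor C D).

Fact fcomp1 X : fmor G (fmor F (idm X)) = idm (G (F X)).
Proof. by rewrite !fmor1. Qed.

Fact fcompM X Y Z (h : hom Y Z) (f : hom X Y) :
  fmor G (fmor F (compm h f)) =
  compm (fmor G (fmor F h)) (fmor G (fmor F f)).
Proof. by rewrite !fmorM. Qed.

Definition fcomp : functor C E := Functor fcomp1 fcompM.

End FunctorComp.

Definition mutually_inverse (C D : category)
    (F : functor C D) (G : functor D C) : Prop :=
  fcomp G F = fid C /\ fcomp F G = fid D.

Section FullSub.
Variables (C : category) (P : C -> Prop).

Definition full_sub : category :=
  @Category {X : C | P X} (fun X Y => hom (projT1 X) (projT1 Y))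
    (fun X => idm (projT1 X)) (fun _ _ _ h f => compm h f)
    (fun _ _ => @compm1 C _ _) (fun _ _ => @comp1m C _ _)
    (fun _ _ _ _ => @compmA C _ _ _ _).

Definition full_incl : functor full_sub C :=
  @Functor full_sub C (fun X => projT1 X) (fun _ _ f => f)
    (fun _ => erefl) (fun _ _ _ _ _ => erefl).

End FullSub.

Section VectCategory.
Variable k : fieldType.

Definition vect_category : category :=
  @Category (vectType k) (fun V W => 'Hom(V, W)) (fun V => \1%VF)
    (fun _ _ _ h f => (h \o f)%VF)
    (fun _ _ => @comp_lfun1r _ _ _) (fun _ _ => @comp_lfun1l _ _ _)
    (fun _ _ _ _ => @comp_lfunA _ _ _ _ _).

End VectCategory.

Section ModCategory.
Variables (k : fieldType) (L : lieAlgType k).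
Implicit Types U V W : liemod L.

Definition modhom V W := {f : 'Hom(V, W) | equivariant f}.

Fact modhom_id_subproof V : @equivariant k L V V \1%VF.
Proof. by move=> a v; rewrite !lfunE. Qed.

Definition modhom_id V : modhom V V := exist _ _ (@modhom_id_subproof V).

Fact modhom_comp_subproof U V W (h : modhom V W) (f : modhom U V) :
  equivariant (sval h \o sval f)%VF.
Proof. by move=> a v; rewrite !comp_lfunE (svalP f) (svalP h). Qed.

Definition modhom_comp U V W (h : modhom V W) (f : modhom U V) : modhom U W :=
  exist _ _ (modhom_comp_subproof h f).

Fact modhom_comp1 V W (f : modhom V W) : modhom_comp f (modhom_id V) = f.
Proof. by apply: eq_sig_hprop => [?|]; [exact: Prop_irrelevance|exact: comp_lfun1r]. Qed.

Fact modhom_1comp V W (f : modhom V W) : modhom_comp (modhom_id W) f = f.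
Proof. by apply: eq_sig_hprop => [?|]; [exact: Prop_irrelevance|exact: comp_lfun1l]. Qed.

Fact modhom_compA U V W T (h : modhom W T) (j : modhom V W) (f : modhom U V) :
  modhom_comp h (modhom_comp j f) = modhom_comp (modhom_comp h j) f.
Proof. by apply: eq_sig_hprop => [?|]; [exact: Prop_irrelevance|exact: comp_lfunA]. Qed.

Definition mod_category : category :=
  Category modhom_comp1 modhom_1comp modhom_compA.

Definition forget : functor mod_category (vect_category k) :=
  @Functor mod_category (vect_category k) (fun V => carrier V)
    (fun _ _ f => sval f) (fun _ => erefl) (fun _ _ _ _ _ => erefl).

End ModCategory.

Section PullFunctor.
Variables (k : fieldType) (L M : lieAlgType k) (h : lie_hom L M).

Fact pull_equivariant (V W : liemod M) (f : 'Hom(V, W)) :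
  equivariant f -> @equivariant k L (pull h V) (pull h W) f.
Proof. by move=> fE a v; exact: fE. Qed.

Definition pull_mor (V W : liemod M) (f : modhom V W) :
    modhom (pull h V) (pull h W) :=
  exist _ (sval f) (pull_equivariant (svalP f)).

Fact pull_mor1 (V : liemod M) : pull_mor (modhom_id V) = modhom_id (pull h V).
Proof. by apply: eq_sig_hprop => // ?; exact: Prop_irrelevance. Qed.

Fact pull_morM (U V W : liemod M) (j : modhom V W) (f : modhom U V) :
  pull_mor (modhom_comp j f) = modhom_comp (pull_mor j) (pull_mor f).
Proof. by apply: eq_sig_hprop => // ?; exact: Prop_irrelevance. Qed.

Definition pull_functor : functor (mod_category M) (mod_category L) :=
  @Functor (mod_category M) (mod_category L) (pull h) pull_mor
    pull_mor1 pull_morM.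

End PullFunctor.

(* [is_tensor mu] says that V, with mu, is a tensor product of the family T.
   For n = 0 it says that V is a line generated by the value of mu. *)

Section MultiTensor.
Variables (k : fieldType) (n : nat) (T : 'I_n -> lmodType k).

Definition multilinear (W : lmodType k) (mu : (forall i, T i) -> W) : Prop :=
  forall (v : forall i, T i) i, linear (fun u : T i => mu (dfwith v u)).

Definition is_tensor (V : lmodType k) (mu : (forall i, T i) -> V) : Prop :=
  multilinear mu /\
  forall (W : lmodType k) (phi : (forall i, T i) -> W), multilinear phi ->
    exists f : {linear V -> W}, (forall v, f (mu v) = phi v) /\
      forall f' : {linear V -> W}, (forall v, f' (mu v) = phi v) -> f' =1 f.

End MultiTensor.

(* V is the tensor product of the representations rho i, composed with
   a |-> (e i a)_i : L -> g^n, up to isomorphism. *)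
Definition is_evaluation (k : fieldType) (g L : lieAlgType k) (n : nat)
    (e : 'I_n -> L -> g) (rho : 'I_n -> liemod g) (V : liemod L) : Prop :=
  exists mu : (forall i, rho i) -> V,
    @is_tensor k n (fun i => carrier (rho i)) V mu /\
    forall a v, action V a (mu v) =
      \sum_(i < n) mu (dfwith v (action (rho i) (e i a) (v i))).

Section Roots.
Variables (k : fieldType) (g : finLieAlgType k) (h : {vspace g}).
Local Notation wt := 'Hom(subvs_of h, k^o).

Definition root_space (a : wt) : set g :=
  [set x | forall H : subvs_of h, lie (vsval H) x = (a H : k) *: x].

Definition is_root (a : wt) : Prop :=
  a <> 0 /\ exists2 x, root_space a x & x <> 0.

Definition ncomb (s : seq wt) (a : wt) : Prop :=
  exists c : wt -> nat, a = \sum_(b <- s) b *+ c b.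

End Roots.

Record triangular_decomposition (k : fieldType) (g : finLieAlgType k) :=
  TriangularDecomposition {
  cartan : {vspace g};
  npos : {vspace g};
  nneg : {vspace g};
  simple_roots : seq 'Hom(subvs_of cartan, k^o);
  cartan_abelian : forall x y, x \in cartan -> y \in cartan -> lie x y = 0;
  simple_roots_root : forall a, a \in simple_roots -> is_root a;
  simple_roots_free : free simple_roots;
  root_sign : forall a : 'Hom(subvs_of cartan, k^o), is_root a ->
    ncomb simple_roots a \/ ncomb simple_roots (- a);
  nposP : forall x, x \in npos <->
    lspan [set y | exists a, [/\ is_root a, ncomb simple_roots a
                               & root_space a y]] x;
  nnegP : forall x, x \in nneg <->
    lspan [set y | exists a, [/\ is_root a, ncomb simple_roots (- a)
                               & root_space a y]] x;
  triangular_sum : (nneg + cartan + npos)%VS = fullv;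
  triangular_direct : directv (nneg + cartan + npos)
}.

Section Weights.
Variables (k : fieldType) (g : finLieAlgType k).
Variable td : triangular_decomposition g.

Definition weight := 'Hom(subvs_of (cartan td), k^o).

(* The coroot of a is the only element H of [g_a, g_(-a)] with a(H) = 2. *)
Definition coroot (a : weight) (H : subvs_of (cartan td)) : Prop :=
  lspan [set lie x y | x in root_space a & y in root_space (- a)] (vsval H)
  /\ a H = 2%:R.

Definition dominant_integral (l : weight) : Prop :=
  forall a H, a \in simple_roots td -> coroot a H ->
    exists n : nat, l H = n%:R.

Definition has_highest_weight (V : liemod g) (l : weight) : Prop :=
  exists v : V, [/\ v <> 0,
    forall x, x \in npos td -> action V x v = 0
  & forall H : subvs_of (cartan td),
      action V (vsval H) v = (l H : k) *: v].

Definition irreducible_of_weight (V : liemod g) (l : weight) : Prop :=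
  irreducible V /\ has_highest_weight V l.

End Weights.

(* The tensor product over k of g and A: an element is stored as its
   A-coordinates along the basis [vbasis fullv] of g;
   [tlift_tens] and [tlift_uniq] below are the universal property of the
   bilinear map [tens]. *)

Section TensorType.
Variables (k : fieldType) (g : finLieAlgType k) (A : comAlgType k).
Definition gtensor : Type := {ffun 'I_(\dim {:g}) -> A}.
HB.instance Definition _ := GRing.Lmodule.on gtensor.
End TensorType.
Arguments gtensor {k} g A.

Section Tensor.
Variables (k : fieldType) (g : finLieAlgType k) (A : comAlgType k).
Local Notation gA := (gtensor g A).
Local Notation e i := ((vbasis {:g})`_(i : 'I_(\dim {:g}))).

Lemma gtensorP (t u : gA) : (forall i, t i = u i) -> t = u.
Proof. by move=> tu; apply/(@ffunP _ (fun=> A)). Qed.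

Definition tens (a : g) (f : A) : gA :=
  [ffun i => coord (vbasis {:g}) i a *: f].

Definition tlift (W : lmodType k) (phi : g -> A -> W) (t : gA) : W :=
  \sum_i phi (e i) (t i).

Definition bilinear_map (W : lmodType k) (phi : g -> A -> W) : Prop :=
  (forall a, linear (phi a)) /\ (forall f, linear (phi^~ f)).

Lemma tens_bilinear : bilinear_map tens.
Proof.
split=> [a|f] c u v /=; apply/gtensorP => i; rewrite /tens /= !ffunE.
  by rewrite scalerDr !scalerA mulrC.
by rewrite linearP scalerDl scalerA.
Qed.

Lemma tensDl a b f : tens (a + b) f = tens a f + tens b f.
Proof. by have := tens_bilinear.2 f 1 a b; rewrite !scale1r. Qed.

Lemma tensE (t : gA) : t = \sum_i tens (e i) (t i).
Proof.
apply: gtensorP => i; rewrite sum_ffunE (bigD1 i) //= ffunE.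
rewrite coord_free ?(basis_free (vbasisP _)) // eqxx scale1r big1 ?addr0 //.
move=> j ji; rewrite ffunE coord_free ?(basis_free (vbasisP _)) //.
by rewrite (negbTE ji) scale0r.
Qed.

Lemma tlift_linear (W : lmodType k) (phi : g -> A -> W) :
  (forall a, linear (phi a)) -> linear (tlift phi).
Proof.
move=> phil c t u; rewrite /tlift scaler_sumr -big_split; apply: eq_bigr => i _.
by rewrite !ffunE phil.
Qed.

Lemma tlift_tens (W : lmodType k) (phi : g -> A -> W) a f :
  bilinear_map phi -> tlift phi (tens a f) = phi a f.
Proof.
move=> [phir phil]; pose pf : {linear g -> W} :=
  HB.pack (phi^~ f) (GRing.isLinear.Build _ _ _ _ (phi^~ f) (phil f)).
have aE : a = \sum_i coord (vbasis {:g}) i a *: e i.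
  exact: (coord_vbasis (memvf a)).
rewrite -[RHS]/(pf a) [in RHS]aE linear_sum; apply: eq_bigr => i _.
pose pe : {linear A -> W} :=
  HB.pack (phi (e i)) (GRing.isLinear.Build _ _ _ _ (phi (e i)) (phir (e i))).
by rewrite ffunE linearZ -[LHS]/(pe _) linearZ.
Qed.

Lemma tlift_uniq (W : lmodType k) (phi : g -> A -> W) (F : {linear gA -> W}) :
  (forall a f, F (tens a f) = phi a f) -> F =1 tlift phi.
Proof.
by move=> FE t; rewrite [in LHS](tensE t) linear_sum; apply: eq_bigr => i _.
Qed.

Definition tens_lie (s t : gA) : gA :=
  tlift (fun a f => tlift (fun b f' => tens (lie a b) (f * f')) t) s.

Lemma tens_lieE a f b f' :
  tens_lie (tens a f) (tens b f') = tens (lie a b) (f * f').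
Proof.
have [tr tl] := tens_bilinear.
rewrite /tens_lie tlift_tens; last split.
- rewrite tlift_tens //; split=> [{}b|{}f'] c u v /=.
    by rewrite mulrDr -scalerAr tr.
  by rewrite lie_linearr tl.
- move=> {}a c u v; rewrite /tlift scaler_sumr -big_split /=.
  by apply: eq_bigr => i _; rewrite mulrDl -scalerAl tr.
- move=> {}f c u v; rewrite /tlift scaler_sumr -big_split /=.
  by apply: eq_bigr => i _; rewrite lie_linearl tl.
Qed.

Lemma tens_lie_linearl t : linear (fun s => tens_lie s t).
Proof.
have [tr _] := tens_bilinear.
apply: tlift_linear => a c u v; rewrite /tlift scaler_sumr -big_split /=.
by apply: eq_bigr => i _; rewrite mulrDl -scalerAl tr.
Qed.

Lemma tens_lie_linearr s : linear (tens_lie s).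
Proof.
have [tr _] := tens_bilinear.
move=> c u v; rewrite /tens_lie {1 2 3}/tlift scaler_sumr -big_split /=.
apply: eq_bigr => i _; apply: tlift_linear => b d x y.
by rewrite mulrDr -scalerAr tr.
Qed.

Lemma tens0l f : tens 0 f = 0.
Proof. by apply: gtensorP => i; rewrite !ffunE linear0 scale0r. Qed.

Let lDl s s' t : tens_lie (s + s') t = tens_lie s t + tens_lie s' t.
Proof. by have := tens_lie_linearl t 1 s s'; rewrite !scale1r. Qed.

Let lDr s t t' : tens_lie s (t + t') = tens_lie s t + tens_lie s t'.
Proof. by have := tens_lie_linearr s 1 t t'; rewrite !scale1r. Qed.

Let l0l t : tens_lie 0 t = 0.
Proof. by apply: (addrI (tens_lie 0 t)); rewrite -lDl !addr0. Qed.

Let l0r s : tens_lie s 0 = 0.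
Proof. by apply: (addrI (tens_lie s 0)); rewrite -lDr !addr0. Qed.

Lemma gtensor_ind (P : gA -> Prop) :
  P 0 -> (forall s t, P s -> P t -> P (s + t)) ->
  (forall a f, P (tens a f)) -> forall t, P t.
Proof. by move=> P0 PD Pt t; rewrite [t]tensE; elim/big_ind: _. Qed.

Let lanti s t : tens_lie s t + tens_lie t s = 0.
Proof.
elim/gtensor_ind: s => [|s s' IH IH'|a f]; first by rewrite l0l l0r addr0.
  by rewrite lDl lDr addrACA IH IH' addr0.
elim/gtensor_ind: t => [|t t' IH IH'|b f']; first by rewrite l0l l0r addr0.
  by rewrite lDl lDr addrACA IH IH' addr0.
rewrite !tens_lieE [f' * f]mulrC -tensDl lie_anti addNr.
exact: tens0l.
Qed.

Lemma tens_liexx s : tens_lie s s = 0.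
Proof.
elim/gtensor_ind: s => [|s t IHs IHt|a f]; first by rewrite l0l.
  by rewrite lDl !lDr IHs IHt addr0 add0r lanti.
by rewrite tens_lieE liexx tens0l.
Qed.

Let jac s t u := tens_lie s (tens_lie t u) + tens_lie t (tens_lie u s)
  + tens_lie u (tens_lie s t).

Let jac_rot s t u : jac s t u = jac t u s.
Proof. by rewrite /jac -addrA addrC. Qed.

Let jac0 t u : jac 0 t u = 0.
Proof. by rewrite /jac !(l0l, l0r) !addr0. Qed.

Let jacD s s' t u : jac (s + s') t u = jac s t u + jac s' t u.
Proof. by rewrite /jac !(lDl, lDr) [RHS]addrACA; congr (_ + _); rewrite addrACA. Qed.

Lemma tens_jacobi s t u :
  tens_lie s (tens_lie t u) + tens_lie t (tens_lie u s)
  + tens_lie u (tens_lie s t) = 0.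
Proof.
rewrite -/(jac s t u).
elim/gtensor_ind: s => [|s s' IH IH'|a f]; first exact: jac0.
  by rewrite jacD IH IH' addr0.
rewrite jac_rot; elim/gtensor_ind: t => [|s s' IH IH'|b f']; first exact: jac0.
  by rewrite jacD IH IH' addr0.
rewrite jac_rot; elim/gtensor_ind: u => [|s s' IH IH'|c f'']; first exact: jac0.
  by rewrite jacD IH IH' addr0.
rewrite /jac !tens_lieE.
have -> : f' * (f'' * f) = f * (f' * f'') by rewrite mulrA mulrC.
have -> : f'' * (f * f') = f * (f' * f'') by rewrite mulrC mulrA.
by rewrite -!tensDl lie_jacobi tens0l.
Qed.

HB.instance Definition _ := Lmodule_isLie.Build k gA
  tens_lie_linearl tens_lie_linearr tens_liexx tens_jacobi.

End Tensor.

Definition finitely_generated (k : fieldType) (A : comAlgType k) : Prop :=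
  exists s : seq A, forall S : {pred A},
    GRing.subalg_closed S -> {subset s <= S} -> forall a, a \in S.

Definition ratpt (k : fieldType) (A : comAlgType k) : Type :=
  {lrmorphism A -> k^o}.
HB.instance Definition _ k A := gen_eqMixin (@ratpt k A).
HB.instance Definition _ k A := gen_choiceMixin (@ratpt k A).

Record alg_action (gT : finGroupType) (k : fieldType) (A : comAlgType k) :=
  AlgAction {
  alg_act :> gT -> {lrmorphism A -> A};
  alg_act1 : forall f, alg_act 1%g f = f;
  alg_actM : forall c d f, alg_act (c * d)%g f = alg_act c (alg_act d f)
}.

Record lie_action (gT : finGroupType) (k : fieldType) (g : lieAlgType k) :=
  LieAction {
  lie_act :> gT -> lie_hom g g;
  lie_act1 : forall a, lie_act 1%g a = a;
  lie_actM : forall c d a, lie_act (c * d)%g a = lie_act c (lie_act d a)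
}.

Section Points.
Variables (gT : finGroupType) (k : fieldType) (A : comAlgType k).
Variable aA : alg_action gT A.
Local Notation X := (ratpt A).

(* (c . f)(x) = f(c^-1 . x) *)
Definition pt_act (c : gT) (x : X) : X :=
  ((x : {lrmorphism A -> k^o}) \o aA c^-1%g : {lrmorphism A -> k^o}).

Definition acts_freely : Prop := forall c x, pt_act c x = x -> c = 1%g.

Definition pt_orbit (x : X) : set X := [set pt_act c x | c in [set: gT]].

Definition orbits (S : set X) : set X := \bigcup_(x in S) pt_orbit x.

Definition in_Xstar (S : set X) : Prop :=
  finite_set S /\
  forall x y, S x -> S y -> x <> y -> pt_orbit x `&` pt_orbit y = set0.

End Points.

Section Ideals.
Variables (k : fieldType) (A : comAlgType k).

Definition max_ideal (x : ratpt A) : set A := [set f | x f = 0].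

Definition ideal_mul (I J : set A) : set A :=
  lspan [set f * f' | f in I & f' in J].

Definition ideal_pow (I : set A) (n : nat) : set A :=
  iter n (ideal_mul I) setT.

Definition nat_supp (eta : ratpt A -> nat) : set (ratpt A) :=
  [set x | eta x <> 0%N].

Definition ideal_of (eta : ratpt A -> nat) : set A :=
  \big[ideal_mul/setT]_(x \in nat_supp eta) ideal_pow (max_ideal x) (eta x).

Definition tens_ideal (g : finLieAlgType k) (I : set A) : set (gtensor g A) :=
  lspan [set tens a f | a in [set: g] & f in I].

Definition ev_at (g : finLieAlgType k) (x : ratpt A) (t : gtensor g A) : g :=
  tlift (fun a f => (x f : k) *: a) t.

End Ideals.

Section Fixed.
Variables (gT : finGroupType) (k : fieldType).
Variables (g : finLieAlgType k) (A : comAlgType k).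
Variables (aA : alg_action gT A) (ag : lie_action gT g).
Local Notation gA := (gtensor g A).

Definition tens_act (c : gT) (t : gA) : gA :=
  tlift (fun a f => tens (ag c a) (aA c f)) t.

Lemma tens_act_bilinear c :
  bilinear_map (fun a f => tens (ag c a) (aA c f) : gA).
Proof.
have [tr tl] := @tens_bilinear k g A.
by split=> [a|f] d u v /=; rewrite linearP ?tr ?tl.
Qed.

Lemma tens_actE c a f : tens_act c (tens a f) = tens (ag c a) (aA c f).
Proof. exact: tlift_tens (tens_act_bilinear c). Qed.

Lemma tens_act_linear c : linear (tens_act c).
Proof. exact: tlift_linear (tens_act_bilinear c).1. Qed.

Lemma tens_actD c s t : tens_act c (s + t) = tens_act c s + tens_act c t.
Proof. by have := tens_act_linear c 1 s t; rewrite !scale1r. Qed.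

Lemma tens_act0 c : tens_act c 0 = 0.
Proof. by apply: (addrI (tens_act c 0)); rewrite -tens_actD !addr0. Qed.

Lemma tens_act_lie c (s t : gA) :
  tens_act c (lie s t) = lie (tens_act c s) (tens_act c t).
Proof.
have l0l (u : gA) : lie 0 u = 0.
  by apply: (addrI (lie 0 u)); rewrite -lieDl !addr0.
have l0r (u : gA) : lie u 0 = 0.
  by apply: (addrI (lie u 0)); rewrite -lieDr !addr0.
elim/gtensor_ind: s => [|s s' IH IH'|a f].
- by rewrite !(l0l, tens_act0).
- by rewrite !(lieDl, tens_actD) IH IH'.
elim/gtensor_ind: t => [|t t' IH IH'|b f'].
- by rewrite !(l0r, tens_act0).
- by rewrite !(lieDr, tens_actD) IH IH'.
rewrite !tens_actE [lie _ _]tens_lieE [RHS]tens_lieE tens_actE.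
by rewrite lie_homE rmorphM.
Qed.

Definition fixed : {pred gA} := [pred t | [forall c, tens_act c t == t]].

Lemma fixedP t : reflect (forall c, tens_act c t = t) (t \in fixed).
Proof. exact: 'forall_eqP. Qed.

Fact fixed_submod : GRing.subsemimod_closed fixed.
Proof.
split; first split.
- by apply/fixedP => c; exact: tens_act0.
- by move=> s t /fixedP fs /fixedP ft; apply/fixedP=> c; rewrite tens_actD fs ft.
move=> d t /fixedP ft; apply/fixedP => c.
by have := tens_act_linear c d t 0; rewrite tens_act0 !addr0 ft.
Qed.
HB.instance Definition _ := GRing.isSubmodClosed.Build k gA fixed fixed_submod.

Record fixed_alg : Type := FixedAlg {
  fixed_val : gA;
  fixed_valP : fixed_val \in fixed
}.
HB.instance Definition _ := [isSub for fixed_val].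
HB.instance Definition _ := [Choice of fixed_alg by <:].
HB.instance Definition _ := [SubChoice_isSubLmodule of fixed_alg by <:].

Fact fixed_lieP (s t : fixed_alg) :
  lie (fixed_val s) (fixed_val t) \in fixed.
Proof.
by apply/fixedP => c; rewrite tens_act_lie !(fixedP _ (fixed_valP _)).
Qed.

Definition fixed_lie (s t : fixed_alg) : fixed_alg := FixedAlg (fixed_lieP s t).

Fact fixed_lie_linearl t : linear (fun s => fixed_lie s t).
Proof. by move=> c u v; apply: val_inj; exact: lie_linearl. Qed.

Fact fixed_lie_linearr s : linear (fixed_lie s).
Proof. by move=> c u v; apply: val_inj; exact: lie_linearr. Qed.

Fact fixed_liexx s : fixed_lie s s = 0.
Proof. by apply: val_inj; exact: liexx. Qed.

Fact fixed_jacobi s t u :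
  fixed_lie s (fixed_lie t u) + fixed_lie t (fixed_lie u s)
  + fixed_lie u (fixed_lie s t) = 0.
Proof. by apply: val_inj; exact: lie_jacobi. Qed.

HB.instance Definition _ := Lmodule_isLie.Build k fixed_alg
  fixed_lie_linearl fixed_lie_linearr fixed_liexx fixed_jacobi.

Definition fixed_incl : lie_hom fixed_alg gA :=
  LieHom (lie_hom_fun := (val : {linear fixed_alg -> gA})) (fun _ _ => erefl).

End Fixed.

Section Classes.
Variables (gT : finGroupType) (k : fieldType).
Variables (g : finLieAlgType k) (A : comAlgType k).
Variables (aA : alg_action gT A) (ag : lie_action gT g).
Variable td : triangular_decomposition g.
Local Notation X := (ratpt A).
Local Notation P := (weight td).
Local Notation gA := (gtensor g A).
Local Notation gAG := (fixed_alg aA ag).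

(* The highest weight of rho \o c^-1 for rho irreducible of highest weight l.
   The default value l is never used when l is dominant integral. *)
Definition weight_act (c : gT) (l : P) : P :=
  xget l [set m | exists2 V : liemod g, irreducible_of_weight V l &
                    has_highest_weight (pull (ag c^-1%g) V) m].

Definition wt_supp (psi : X -> P) : set X := [set x | psi x <> 0].

Definition in_E (psi : X -> P) : Prop :=
  (forall x, dominant_integral (psi x)) /\ finite_set (wt_supp psi).

Definition in_EGamma (psi : X -> P) : Prop :=
  in_E psi /\ forall c x, psi (pt_act aA c x) = weight_act c (psi x).

(* The class of evaluation modules attached to psi, for a Lie algebra L with
   evaluation maps e x : L -> g: the evaluation points p 0, ..., p (n-1) are
   representatives of the orbits, for the equivalence relation orb, that lie
   in the support of psi. *)
Definition ev_class (L : lieAlgType k) (e : X -> L -> g) (orb : X -> set X)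
    (psi : X -> P) (V : liemod L) : Prop :=
  exists (n : nat) (p : 'I_n -> X) (rho : 'I_n -> liemod g),
    [/\ forall i, wt_supp psi (p i),
        forall y, wt_supp psi y -> exists! i, orb (p i) y,
        forall i, irreducible_of_weight (rho i) (psi (p i))
      & is_evaluation (fun i => e (p i)) rho V].

Definition ev : (X -> P) -> liemod gA -> Prop :=
  ev_class (@ev_at k A g) (fun x => [set x]).

Definition evGamma : (X -> P) -> liemod gAG -> Prop :=
  ev_class (fun x t => ev_at x (fixed_val t)) (pt_orbit aA).

Definition psi_Gamma (psi : X -> P) : X -> P :=
  fun x => \sum_(c : gT) weight_act c (psi (pt_act aA c^-1%g x)).

Definition psi_restr (S : set X) (psi : X -> P) : X -> P :=
  fun x => if `[< S x >] then psi x else 0.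

(* The support of a module in the class ev psi is wt_supp psi, and every
   irreducible module is in exactly one such class. *)
Definition in_F (S : set X) (V : liemod gA) : Prop :=
  forall W, constituent V W ->
    exists psi, [/\ in_E psi, ev psi W & wt_supp psi `<=` S].

Definition in_FGamma (S : set X) (V : liemod gAG) : Prop :=
  forall W, constituent V W ->
    exists psi, [/\ in_EGamma psi, evGamma psi W
                  & wt_supp psi `<=` orbits aA S].

Definition F_cat (S : set X) : category :=
  @full_sub (mod_category gA) (in_F S).

Definition FGamma_cat (S : set X) : category :=
  @full_sub (mod_category gAG) (in_FGamma S).

Definition twist : functor (mod_category gA) (mod_category gAG) :=
  pull_functor (fixed_incl aA ag).

Definition annihilated (V : liemod gAG) (I : set A) : Prop :=
  forall t : gAG, tens_ideal I (fixed_val t) -> action V t = 0.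

(* r is the action of g (x) A on V^eta, for some eta supported in S. *)
Definition is_untwisting (S : set X) (V : liemod gAG) (r : lie_rep gA V) :
    Prop :=
  exists eta : X -> nat,
    [/\ finite_set (nat_supp eta), nat_supp eta `<=` S,
        annihilated V (ideal_of eta)
      & forall (s : gA) (t : gAG),
          tens_ideal (ideal_of eta) (s - fixed_val t) -> r s = action V t].

(* On modules outside of F^Gamma_S the value may be junk. *)
Definition untwist (S : set X) (V : liemod gAG) : liemod gA :=
  LieMod (if pselect (exists r, @is_untwisting S V r) is left h
          then projT1 (cid h) else trivial_rep gA V).

End Classes.

(* Main.v *)
Require Import Defs.
From HB Require Import structures.
From mathcomp Require Import all_boot all_order all_algebra all_fingroup.
From mathcomp Require Import ring.
From mathcomp Require Import boolp classical_sets functions cardinality fsbigop.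

(* Twisting is restriction along a map which becomes an isomorphism modulo
   g (x) I for every ideal I with finite support in x: if f is 1 modulo I and
   its nontrivial translates lie in I, which is possible as the points c.y with
   c in Gamma and y in x are distinct, then s and the trace of f s are congruent
   modulo g (x) I. So everything reduces to two facts.
   First, a module in F_x or F^Gamma_x is killed by such an ideal. The functions
   vanishing on x give a subalgebra K acting nilpotently, because K kills the
   constituents; so a term of the lower central series of K acts by zero, and it
   contains (g (x) I^n)^Gamma for large n because g is perfect and, by freeness
   and the Nullstellensatz, A has a Galois coordinate system over A^Gamma.
   Second, Gamma acts on highest weights compatibly with twisting of modules,
   which rests on the uniqueness of the irreducible module of a given highest
   weight. For psi supported in X_* at most one term of the sum psi^Gamma(x)
   is nonzero. *)

Set Implicit Arguments.
Unset Strict Implicit.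
Unset Printing Implicit Defensive.

Import GRing.Theory.
Local Open Scope classical_set_scope.
Local Open Scope ring_scope.

(* all_fingroup and all_algebra shadow these names of Defs. *)
Local Notation action := Defs.action.
Local Notation hom := Defs.hom.

(** * Points of finitely generated algebras *)

(** Semisimplicity means here the absence of nonzero solvable ideals, and the triangular
    decomposition carries no nondegeneracy. Perfectness is extracted from the Killing form, whose
    radical is shown to vanish by weights: traces of ad H along root strings make all weights
    rational multiples of a on [g_a, g_-a], where the form becomes a sum of squares, and an Engel
    argument removes the rest. The field may be countable, so points of A are found by adjoining one
    variable at a time. The bracket of two traces mixes one factor with all translates of the other;
    Galois coordinates are there to cancel these terms. That a constituent of a twisted or untwisted
    module lies in an evaluation class is seen by moving it to the other side, where it is a
    constituent of the given module, and carrying its class back; (c) thus uses (a) and (b).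
    Functors are compared strictly: both round trips keep the underlying space and return the same
    action, so what remains is to transport morphisms along equalities of objects. *)

Section PrimeIdeals.
Variable R : comNzRingType.

Definition ideal (I : set R) : Prop :=
  [/\ I 0, forall a b, I a -> I b -> I (a + b) & forall a b, I b -> I (a * b)].

Definition prime_ideal (I : set R) : Prop :=
  [/\ ideal I, ~ I 1 & forall a b, I (a * b) -> I a \/ I b].

Lemma idealN (I : set R) a : ideal I -> I a -> I (- a).
Proof. by case=> _ _ IM Ia; rewrite -mulN1r; apply: IM. Qed.

Lemma idealB (I : set R) a b : ideal I -> I a -> I b -> I (a - b).
Proof. by move=> II Ia Ib; case: (II) => _ ID _; apply: ID => //; apply: idealN. Qed.

Lemma ideal_sum (I : set R) (J : Type) (s : seq J) (P : pred J) (F : J -> R) :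
  ideal I -> (forall j, P j -> I (F j)) -> I (\sum_(j <- s | P j) F j).
Proof. by case=> I0 ID _ IF; apply: (big_ind I). Qed.

Lemma ideal_mulr (I : set R) a b : ideal I -> I a -> I (a * b).
Proof. by case=> _ _ IM Ia; rewrite mulrC; apply: IM. Qed.

Lemma prime_idealX (I : set R) a n : prime_ideal I -> I (a ^+ n) -> I a.
Proof.
case=> _ I1 IP; elim: n => [|n IH]; first by rewrite expr0.
by rewrite exprS => /IP[|/IH].
Qed.

(** An ideal maximal among those that contain J and avoid 1 is prime: if a and b lie outside it,
    then 1 = (r a + m)(s b + n) expands into the ideal as soon as a b lies in it. *)
Lemma exists_prime_ideal (J : set R) :
  ideal J -> ~ J 1 -> exists2 P, prime_ideal P & J `<=` P.
Proof.
move=> JI J1.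
(* The union of an empty chain is empty, so a good set has to contain J only when it is
   inhabited. *)
pose good (I : set R) := [/\ ~ I 1, forall a b, I a -> I b -> I (a + b),
  forall a b, I b -> I (a * b) & forall a, I a -> J `<=` I].
have [F Fgood totF|M [[M1 MD MM MJ] Mmax]] := @Zorn_bigcup R good.
  split.
  - by case=> I /Fgood[I1 _ _ _].
  - move=> a b [I FI Ia] [I' FI' I'b].
    have [_ ID _ _] := Fgood _ FI; have [_ I'D _ _] := Fgood _ FI'.
    by case: (totF _ _ FI FI') => sub; [exists I' => //; apply: I'D => //; apply: sub
      | exists I => //; apply: ID => //; apply: sub].
  - by move=> a b [I FI Ib]; exists I => //; have [_ _ IM _] := Fgood _ FI; apply: IM.
  - move=> a [I FI Ia] j Jj; exists I => //; have [_ _ _ IJ] := Fgood _ FI.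
    exact: IJ Ia _ Jj.
have [J0 JD JM] := JI.
have JsubM : J `<=` M.
  have [[a /MJ//]|Mempty] := pselect (exists a, M a).
  have : ~ good J.
    apply: Mmax; split; first by move=> a Ma; case: Mempty; exists a.
    by move=> sub; apply: Mempty; exists 0; apply: sub.
  by case; split=> // a _ b.
have M0 := JsubM _ J0.
have MI : ideal M by split.
have big a : ~ M a -> exists r m, M m /\ 1 = r * a + m.
  move=> Ma; pose I := [set b | exists r m, M m /\ b = r * a + m].
  have [r1|I1] := pselect (I 1); first by have [r [m]] := r1; exists r, m.
  have : ~ good I.
    apply: Mmax; split; first by move=> b Mb; exists 0, b; rewrite mul0r add0r.
    by move=> sub; apply: Ma; apply: sub; exists 1, 0; rewrite mul1r addr0.
  case; split=> //.
  - move=> _ _ [r [m [Mm ->]]] [r' [m' [Mm' ->]]].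
    exists (r + r'), (m + m'); split; first exact: MD.
    by rewrite mulrDl addrACA.
  - move=> b _ [r [m [Mm ->]]]; exists (b * r), (b * m); split; first exact: MM.
    by rewrite mulrDr mulrA.
  - by move=> b _ j /JsubM Mj; exists 0, j; rewrite mul0r add0r.
exists M => //; split=> // a b Mab; apply: contrapT => /not_orP[Ma Mb]; apply: M1.
have [r [m [Mm e]]] := big _ Ma; have [s [n [Mn f]]] := big _ Mb.
have -> : 1 = r * s * (a * b) + (r * a * n + (s * b * m + m * n)).
  by rewrite -[LHS]mulr1 [X in X * _]e [X in _ * X]f mulrDl !mulrDr mulrACA
    -!addrA [m * (s * b)]mulrC.
by apply: (MD); [apply: MM|apply: (MD); [exact: MM|apply: (MD); exact: MM]].
Qed.

End PrimeIdeals.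

Lemma ideal_preim (R S : comNzRingType) (f : {rmorphism R -> S}) (I : set S) :
  ideal I -> ideal (f @^-1` I).
Proof.
by case=> I0 ID IM; split=> [|a b|a b] /=; rewrite ?rmorph0 ?rmorphD ?rmorphM //;
  [exact: ID|exact: IM].
Qed.

Lemma prime_ideal_preim (R S : comNzRingType) (f : {rmorphism R -> S}) (I : set S) :
  prime_ideal I -> prime_ideal (f @^-1` I).
Proof.
case=> II I1 IP; split; first exact: ideal_preim.
  by rewrite /= rmorph1.
by move=> a b /=; rewrite rmorphM => /IP.
Qed.

(* Strengthened form of the Nullstellensatz for R over k, suited to adjoining
   one variable at a time: points exist on every closed irreducible set,
   outside of any given hypersurface. *)
Definition has_points (k : closedFieldType) (R : idomainType)
    (iota : {rmorphism k -> R}) : Prop :=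
  forall (P : set R) u, prime_ideal P -> ~ P u ->
    exists phi : {rmorphism R -> k},
      [/\ forall c, phi (iota c) = c, forall r, P r -> phi r = 0 & phi u <> 0].

Lemma has_points_field (k : closedFieldType) :
  has_points (idfun : {rmorphism k -> k}).
Proof.
move=> P u [[P0 _ PM] P1 _] Pu; exists idfun; split=> // [r Pr|u0].
  by apply: contrapT => /eqP r0; apply: P1; rewrite -(mulVf r0); apply: PM.
by apply: Pu; rewrite -[u]/(idfun u) u0.
Qed.

Definition coefs_in (R : comNzRingType) (P0 : set R) : set {poly R} :=
  [set p | forall i, P0 p`_i].

Lemma coefs_in_ideal (R : comNzRingType) (P0 : set R) :
  ideal P0 -> ideal (coefs_in P0).
Proof.
move=> P0I; have [P00 P0D P0M] := P0I.
split=> [i|p q Pp Pq i|p q Pq i]; first by rewrite coef0.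
  by rewrite coefD; apply: P0D.
by rewrite coefM; apply: ideal_sum => // j _; apply: P0M.
Qed.

Lemma coefs_in_of_lead (R : comNzRingType) (P0 : set R) (I : set {poly R}) n :
  ideal P0 -> ideal I -> coefs_in P0 `<=` I ->
  (forall p, I p -> (size p < n)%N -> P0 (lead_coef p)) ->
  forall p, I p -> (size p < n)%N -> coefs_in P0 p.
Proof.
move=> P0I II sub leadP p; have [P00 _ _] := P0I.
elim: {p}(size p) {-2}p (leqnn (size p)) => [|j IH] p sp Ip srp.
  by move: sp; rewrite leqn0 size_poly_eq0 => /eqP -> i; rewrite coef0.
pose p1 := (lead_coef p)%:P * 'X^((size p).-1).
have p1X : coefs_in P0 p1.
  move=> i; rewrite coefCM coefXn; case: eqP => _; rewrite ?mulr1 ?mulr0 //.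
  exact: leadP.
have [|p0] := posnP (size p).
  by move/eqP; rewrite size_poly_eq0 => /eqP -> i; rewrite coef0.
have sp1 : (size (p - p1)%R < size p)%N.
  rewrite -[size p in X in (_ < X)%N]prednK // ltnS; apply/leq_sizeP => i.
  rewrite leq_eqVlt; case/predU1P => [<-|ip].
    by rewrite coefB coefCM coefXn eqxx mulr1 subrr.
  rewrite coefB coefCM coefXn gtn_eqF // mulr0 subr0 nth_default //.
  by rewrite -[size p]prednK.
have qX : coefs_in P0 (p - p1).
  apply: IH; last exact: ltn_trans srp.
    by rewrite -ltnS (leq_trans sp1).
  by apply: idealB => //; exact: sub.
by rewrite -(subrK p1 p); have [_ XD _] := coefs_in_ideal P0I; apply: XD.
Qed.

(** Let P0 be the contraction of P. If every element of P has its leading coefficient in P0, then P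
    = P0[X], and a point of P0 at which some coefficient of u survives lifts to a non-root of the
    specialised u. Otherwise P is controlled by an element q of least degree with leading
    coefficient outside P0, and the point lifts to a root of the specialised q; a constant b in the
    ideal generated by P0[X], u and q keeps u nonzero there. *)
Lemma has_points_poly (k : closedFieldType) (R : idomainType)
    (iota : {rmorphism k -> R}) :
  has_points iota -> has_points (polyC \o iota : {rmorphism k -> {poly R}}).
Proof.
move=> Rpts P u PP Pu; have [PI P1 Pprime] := PP.
pose P0 : set R := polyC @^-1` P.
have P0P : prime_ideal P0.
  exact: (@prime_ideal_preim _ _ (@polyC R : {rmorphism R -> {poly R}}) _ PP).
have [P0I P01 P0prime] := P0P.
have [_ P0D P0M] := P0I; have [P00 PD PM] := PI.
pose P0X : set {poly R} := coefs_in P0.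
have P0X_P p : P0X p -> P p.
  move=> pP; rewrite -[p]coefK poly_def; apply: ideal_sum => // i _.
  by rewrite -mul_polyC; apply: ideal_mulr => //; apply: pP.
have P0X_I : ideal P0X by exact: coefs_in_ideal.
have P0X_lead p : P0X p -> P0 (lead_coef p) by move=> h; exact: h.
have evalm (phi : {rmorphism R -> k}) (x : k) :
    (forall c, phi (iota c) = c) -> forall c,
    (horner_eval x \o map_poly phi : {rmorphism _ -> _}) ((polyC \o iota) c) = c.
  by move=> phii c /=; rewrite /horner_eval map_polyC hornerC /= phii.
have kill0 (phi : {rmorphism R -> k}) :
    (forall r, P0 r -> phi r = 0) -> forall p, P0X p -> map_poly phi p = 0.
  by move=> phi0 p pP; apply/polyP => i; rewrite coef_map coef0 /= phi0.
pose isq n := `[< exists q, [/\ P q, ~ P0 (lead_coef q) & size q = n] >].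
have [exq|noq] := pselect (exists n, isq n); last first.
  have PX p : P p -> P0X p.
    move=> Pp; apply: (coefs_in_of_lead P0I PI P0X_P _ Pp (ltnSn _)) => r Pr _.
    apply: contrapT => l; apply: noq; exists (size r); apply/asboolP.
    by exists r; split.
  have [i Pui] : exists i, ~ P0 u`_i.
    by apply: contrapT => h; apply/Pu/P0X_P => i; apply: contrapT => ?; apply: h; exists i.
  have [phi [phii phi0 phiu]] := Rpts _ _ P0P Pui.
  have /closed_nonrootP[x xroot] : map_poly phi u != 0.
    apply/eqP => /(congr1 (fun p : {poly k} => p`_i)).
    by rewrite coef_map coef0.
  exists (horner_eval x \o map_poly phi : {rmorphism _ -> _}); split.
  - exact: evalm.
  - by move=> p /PX /(kill0 _ phi0) /= ->; rewrite /horner_eval horner0.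
  - by apply/eqP.
have [n /asboolP[q [Pq lq sq]] qmin] := ex_minnP exq.
have small p : P p -> (size p < size q)%N -> P0X p.
  move=> Pp; apply: (coefs_in_of_lead P0I PI P0X_P _ Pp) => {Pp}p Pp sp.
  apply: contrapT => l; move: sp; rewrite ltnNge => /negP; apply.
  by rewrite sq; apply: qmin; apply/asboolP; exists p.
(* Over the fraction field of R/P0, q is irreducible and does not divide u, so together they
   generate 1. The element r of [I] of least degree with leading coefficient outside [P0] plays the
   role of their gcd and will be constant. *)
pose I := [set r : {poly R} | exists s t, P0X (r - (s * u + t * q))].
have I_I : ideal I.
  have [X0 XD XM] := P0X_I; split.
  - by exists 0, 0; rewrite !mul0r addr0 subr0.
  - move=> r r' [s [t h]] [s' [t' h']]; exists (s + s'), (t + t').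
    have -> : r + r' - ((s + s') * u + (t + t') * q) =
       (r - (s * u + t * q)) + (r' - (s' * u + t' * q)).
      by rewrite !mulrDl [X in _ - X]addrACA opprD addrACA.
    exact: XD.
  - move=> p r [s [t h]]; exists (p * s), (p * t).
    by rewrite -!mulrA -mulrDr -mulrBr; apply: XM.
have [X0 XD XM] := P0X_I.
have Iu : I u by exists 1, 0; rewrite mul1r mul0r addr0 subrr.
have Iq : I q by exists 0, 1; rewrite mul1r mul0r add0r subrr.
have exr : exists n, `[< exists r, [/\ I r, ~ P0 (lead_coef r) & size r = n] >].
  by exists (size q); apply/asboolP; exists q.
have [m /asboolP[r [Ir lr sr]] rmin] := ex_minnP exr.
have subI : P0X `<=` I by move=> p pX; exists 0, 0; rewrite !mul0r addr0 subr0.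
have smallI p : I p -> (size p < size r)%N -> P0X p.
  move=> Ip; apply: (coefs_in_of_lead P0I I_I subI _ Ip) => {Ip}p Ip sp.
  apply: contrapT => l; move: sp; rewrite ltnNge => /negP; apply.
  by rewrite sr; apply: rmin; apply/asboolP; exists p.
have lrX i : ~ P0 (lead_coef r ^+ i) by move/(prime_idealX P0P).
have div p : I p -> exists i s t, lead_coef r ^+ i *: p = s * r + t /\
    [/\ P0X t & (size t < size r)%N].
  move=> Ip; exists (scalp p r), (p %/ r), (p %% r).
  rewrite Pdiv.Idomain.divp_eq; split=> //.
  have r0 : r != 0 by apply/eqP => r0; apply: lr; rewrite r0 lead_coef0.
  have szr : (size (p %% r)%R < size r)%N by rewrite Pdiv.Idomain.ltn_modp.
  split=> //; apply: smallI => //.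
  have -> : p %% r = lead_coef r ^+ scalp p r *: p - p %/ r * r.
    by rewrite Pdiv.Idomain.divp_eq addrC addKr.
  apply: idealB => //; first by rewrite -mul_polyC; case: I_I => _ _; apply.
  by case: I_I => _ _; apply.
(* Up to powers of the leading coefficient of r, both q = s r and u = s' r hold modulo P0[X]. As u
   is outside P, so is r, hence s lies in P. A nonconstant r makes s shorter than q, so s is in
   P0[X], and then so is a multiple of q by a scalar outside P0, which is absurd. *)
have [b rb] : exists b, r = b%:P.
  have [i [s [t [eq_q [tX st]]]]] := div q Iq.
  have [j [s' [t' [eq_u [tX' _]]]]] := div u Iu.
  have rP : ~ P r.
    move=> Pr; have : P (lead_coef r ^+ j *: u).
      by rewrite eq_u; apply: PD; [apply: PM|apply: P0X_P].
    by rewrite -mul_polyC => /Pprime[/lrX|].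
  have Ps : P s.
    have : P (s * r).
      have -> : s * r = lead_coef r ^+ i *: q - t by rewrite eq_q addrK.
      by apply: idealB => //; [rewrite -mul_polyC; apply: PM|apply: P0X_P].
    by case/Pprime.
  have ri0 : lead_coef r ^+ i != 0 by apply/eqP => r0; apply: (lrX i); rewrite r0.
  have r0 : r != 0 by apply/eqP => r0; apply: lr; rewrite r0 lead_coef0.
  case: (ltngtP (size r) 1) => [|r2|/eqP/size_poly1P[b _ ->]]; last by exists b.
    by rewrite ltnS leqn0 size_poly_eq0 (negbTE r0).
  exfalso; apply: (lrX i).
  have srq : (size r <= size q)%N by rewrite sr; apply: rmin; apply/asboolP; exists q.
  have sX : P0X s.
    apply: small => //.
    have [->|s0] := eqVneq s 0.
      by rewrite size_poly0; apply: leq_trans srq; apply: ltn_trans r2.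
    have : (size (s * r)%R <= size q)%N.
      have -> : s * r = lead_coef r ^+ i *: q - t by rewrite eq_q addrK.
      apply: leq_trans (size_polyD _ _) _; rewrite geq_max size_scale // leqnn.
      by rewrite size_polyN (leq_trans (ltnW st)).
    rewrite size_mul // -subn1 leq_subLR add1n => h.
    by rewrite -ltnS; apply: leq_trans h; rewrite -[X in (X < _)%N]addn1 ltn_add2l.
  have : P0X (lead_coef r ^+ i *: q).
    by rewrite eq_q; apply: XD => //; exact: (ideal_mulr _ P0X_I sX).
  by move/P0X_lead; rewrite lead_coefZ => /P0prime[|//].
have b0 : ~ P0 b by move: lr; rewrite rb lead_coefC.
(* The point must avoid the zeros of both factors: the first lets pseudo-division by q be undone
   after specialisation, the second forces u to be nonzero at the roots of q. *)
have lqb : ~ P0 (lead_coef q * b) by move/P0prime => [].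
have [phi [phii phi0 phib]] := Rpts _ _ P0P lqb.
have phiq : phi (lead_coef q) != 0.
  by apply/eqP => h; apply: phib; rewrite rmorphM h mul0r.
have : size (map_poly phi q) != 1.
  rewrite size_map_poly_id0 //; apply/eqP => /eqP/size_poly1P[c c0 qc].
  by apply: lq; rewrite qc lead_coefC /P0 /= -qc.
case/closed_rootP => x /rootP qx.
exists (horner_eval x \o map_poly phi : {rmorphism _ -> _}); split.
- exact: evalm.
- move=> p Pp /=; rewrite /horner_eval.
  have e := Pdiv.Idomain.divp_eq p q.
  have q0 : q != 0 by apply/eqP => q0; apply: lq; rewrite q0 lead_coef0.
  have X : P0X (p %% q).
    apply: small; last by rewrite Pdiv.Idomain.ltn_modp.
    have -> : p %% q = lead_coef q ^+ scalp p q *: p - p %/ q * q.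
      by rewrite e addrC addKr.
    by apply: idealB => //; [rewrite -mul_polyC|]; apply: PM.
  move/(congr1 (fun p => (map_poly phi p).[x])): e.
  rewrite rmorphD rmorphM /= (kill0 _ phi0 _ X) addr0 hornerM qx mulr0.
  rewrite -mul_polyC rmorphM /= map_polyC hornerM hornerC /= rmorphXn => /eqP.
  by rewrite mulf_eq0 expf_eq0 (negbTE phiq) andbF /= => /eqP.
- move=> /= h; apply: phib.
  have [s [t]] := Ir; rewrite rb => /(kill0 _ phi0).
  rewrite rmorphB rmorphD !rmorphM /= map_polyC.
  move/(congr1 (fun p : {poly k} => p.[x])).
  rewrite hornerD hornerC hornerN hornerD !hornerM qx mulr0 addr0 horner0.
  by move: h; rewrite /horner_eval => ->; rewrite mulr0 subr0 => ->; rewrite mulr0.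
Qed.

Lemma presentation (k : closedFieldType) (A : comAlgType k) (s : seq A) :
  exists (R : idomainType) (iota : {rmorphism k -> R}) (pi : {rmorphism R -> A}),
    [/\ has_points iota, forall c, pi (iota c) = c%:A
      & forall a, a \in s -> exists r, pi r = a].
Proof.
elim: s => [|a s [R [iota [pi [Rpts pii pis]]]]].
  by exists k, idfun, (in_alg A); split=> //; exact: has_points_field.
exists {poly R}, (polyC \o iota : {rmorphism _ -> _}),
  (horner_eval a \o map_poly pi : {rmorphism _ -> _}); split.
- exact: has_points_poly.
- by move=> c /=; rewrite /horner_eval map_polyC hornerC /= pii.
- move=> b; rewrite inE => /predU1P[->|/pis[r <-]].
    by exists 'X; rewrite /= /horner_eval map_polyX hornerX.
  by exists r%:P; rewrite /= /horner_eval map_polyC hornerC.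
Qed.

Lemma ratptP (k : fieldType) (A : comAlgType k) (x y : ratpt A) :
  (forall f, x f = y f) -> x = y.
Proof.
case: x => x [[xa] [xm] [xl]]; case: y => y [[ya] [ym] [yl]] /= xy.
have xy' : x = y by apply: funext.
move: xa xm xl ya ym yl; rewrite xy' => xa xm xl ya ym yl.
by congr (GRing.LRMorphism.Pack (GRing.LRMorphism.Class _ _ _));
  congr (_ _); exact: Prop_irrelevance.
Qed.

Lemma ratpt_scale (k : fieldType) (A : comAlgType k) (x : ratpt A) c f :
  x (c *: f) = c * x f.
Proof. by rewrite linearZ. Qed.

(** A prime over J pulls back along the presentation; a point found on the pullback kills the kernel
    of [pi], so composing it with any section of [pi] gives a point of A. *)
Lemma nullstellensatz (k : closedFieldType) (A : comAlgType k) (J : set A) :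
  finitely_generated A -> ideal J -> ~ J 1 ->
  exists x : ratpt A, forall f, J f -> x f = 0.
Proof.
case=> s gens JI J1; have [P PP JP] := exists_prime_ideal JI J1.
have [R [iota [pi [Rpts pii pis]]]] := presentation s.
have surj a : exists r, pi r = a.
  have /(gens [pred a | `[< exists r, pi r = a >]]) h : GRing.subalg_closed
      [pred a | `[< exists r, pi r = a >]].
    split.
    - by apply/asboolP; exists 1; rewrite rmorph1.
    - move=> c _ _ /asboolP[r <-] /asboolP[r' <-]; apply/asboolP.
      by exists (iota c * r + r'); rewrite rmorphD rmorphM pii mulr_algl.
    - move=> _ _ /asboolP[r <-] /asboolP[r' <-]; apply/asboolP; exists (r * r').
      by rewrite rmorphM.
  have : {subset s <= [pred a | `[< exists r, pi r = a >]]}.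
    by move=> b /pis h'; apply/asboolP.
  by move/h/(_ a) => /asboolP.
have [sec secK] := choice surj.
have PP' := @prime_ideal_preim _ _ pi _ PP; have [_ P1' _] := PP'.
have [phi [phii phiP _]] := Rpts _ 1 PP' P1'.
have [[P0 _ _] _ _] := PP.
have phi_eq r r' : pi r = pi r' -> phi r = phi r'.
  move=> e; apply/eqP; rewrite -subr_eq0 -rmorphB; apply/eqP/phiP.
  by rewrite /= rmorphB e subrr.
pose x : A -> k^o := fun a => phi (sec a).
have xl : linear x.
  move=> c a b; transitivity (phi (iota c * sec a + sec b)).
    by apply: phi_eq; rewrite rmorphD rmorphM !secK pii mulr_algl.
  by rewrite rmorphD rmorphM phii.
have xm : GRing.monoid_morphism x.
  split; first by rewrite -[RHS](rmorph1 phi); apply: phi_eq; rewrite secK rmorph1.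
  move=> a b; transitivity (phi (sec a * sec b)); last exact: rmorphM.
  by apply: phi_eq; rewrite rmorphM !secK.
pose x' : {lrmorphism A -> k^o} :=
  HB.pack x (GRing.isLinear.Build k A k^o _ x xl) (GRing.isMonoidMorphism.Build _ _ x xm).
by exists x' => f Jf; apply: phiP; rewrite /= secK; apply: JP.
Qed.

(** * Lie algebra modules *)

Section Span.
Variables (k : fieldType) (V : lmodType k).
Implicit Types (S P : set V).

Definition lin_closed P : Prop :=
  P 0 /\ forall c u v, P u -> P v -> P (c *: u + v).

Lemma lin_closedD P u v : lin_closed P -> P u -> P v -> P (u + v).
Proof. by move=> [_ PP] Pu Pv; rewrite -[u]scale1r; apply: PP. Qed.

Lemma lin_closedZ P c u : lin_closed P -> P u -> P (c *: u).
Proof. by move=> [P0 PP] Pu; rewrite -[_ *: _]addr0; apply: PP. Qed.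

Lemma lin_closedN P u : lin_closed P -> P u -> P (- u).
Proof. by move=> PP Pu; rewrite -scaleN1r; apply: lin_closedZ. Qed.

Lemma lin_closedB P u v : lin_closed P -> P u -> P v -> P (u - v).
Proof. by move=> [_ PP] Pu Pv; rewrite addrC -scaleN1r; apply: PP. Qed.

Lemma lin_closed_sum P (J : Type) (s : seq J) (p : pred J) (F : J -> V) :
  lin_closed P -> (forall j, p j -> P (F j)) -> P (\sum_(j <- s | p j) F j).
Proof.
move=> PP PF; apply: (big_ind P) => //; first by case: PP.
by move=> u v; apply: lin_closedD.
Qed.

Lemma lspan_lin S : lin_closed (lspan S).
Proof.
split; first by exists [::]; rewrite big_nil.
move=> c _ _ [s [sS ->]] [t [tS ->]].
exists ([seq (c * p.1, p.2) | p <- s] ++ t); split.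
  by move=> p; rewrite mem_cat => /orP[/mapP[q qs ->]|/tS//]; exact: (sS _ qs).
rewrite big_cat big_map scaler_sumr /=; congr (_ + _).
by apply: eq_bigr => p _; rewrite scalerA.
Qed.

Lemma lspan_sub S v : S v -> lspan S v.
Proof.
move=> Sv; exists [:: (1, v)]; rewrite big_seq1 scale1r; split=> // p.
by rewrite inE => /eqP ->.
Qed.

Lemma lspan_least S P : lin_closed P -> S `<=` P -> lspan S `<=` P.
Proof.
move=> PP SP _ [s [sS ->]]; rewrite big_seq; apply: lin_closed_sum => // p ps.
by apply: lin_closedZ => //; apply/SP/sS.
Qed.

End Span.

Lemma lin_closed_comp (k : fieldType) (V W : lmodType k) (f : V -> W) (P : set W) :
  linear f -> lin_closed P -> lin_closed (fun v => P (f v)).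
Proof.
move=> fl [P0 PP]; split=> [|c u v Pu Pv]; last by rewrite fl; apply: PP.
by have := fl (-1) 0 0; rewrite !scaleN1r !addNr => ->.
Qed.

Lemma vspace_of_set (k : fieldType) (V : vectType k) (P : set V) :
  lin_closed P -> exists U : {vspace V}, forall v, v \in U <-> P v.
Proof.
move=> PP; pose good n := `[< exists2 U : {vspace V},
   \dim U = n & forall v, v \in U -> P v >].
have ex : exists n, good n.
  exists 0%N; apply/asboolP; exists 0%VS; first by rewrite dimv0.
  by move=> v; rewrite memv0 => /eqP ->; case: PP.
have ub n : good n -> (n <= \dim {:V})%N.
  by move=> /asboolP[U <- _]; apply/dimvS/subvf.
have [n /asboolP[U dU UP] nmax] := ex_maxnP ex ub.
exists U => v; split=> [/UP//|Pv]; apply: contrapT => /negP vU.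
have : good (\dim (U + <[v]>)%VS).
  apply/asboolP; exists (U + <[v]>)%VS => // u /memv_addP[u1 /UP Pu1].
  by move=> [_ /vlineP[c ->] ->]; rewrite addrC; case: PP => _; apply.
move/nmax; apply/negP; rewrite -ltnNge -dU.
have := dimv_leqif_sup (addvSl U <[v]>%VS); case=> le e.
rewrite ltn_neqAle le e andbT subv_add subvv /= -memvE; exact: vU.
Qed.

Section ModuleTheory.
Variables (k : fieldType) (L : lieAlgType k).
Implicit Types V W : liemod L.

Lemma action0 V (v : V) : action V 0 v = 0.
Proof.
by have := lie_rep_linear (action V) 1 0 0; rewrite !scale1r !addr0 => /esym/eqP;
  rewrite -subr_eq0 addrK => /eqP ->; rewrite lfunE.
Qed.

Lemma actionD V x y (v : V) : action V (x + y) v = action V x v + action V y v.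
Proof. by have := lie_rep_linear (action V) 1 x y; rewrite !scale1r => ->; rewrite lfunE. Qed.

Lemma actionZ V c x (v : V) : action V (c *: x) v = c *: action V x v.
Proof.
have := lie_rep_linear (action V) c x 0; rewrite addr0 => ->.
by rewrite lfunE /= action0 addr0 lfunE.
Qed.

Lemma actionB V x y (v : V) : action V (x - y) v = action V x v - action V y v.
Proof. by rewrite -scaleN1r actionD actionZ scaleN1r. Qed.

Lemma action_lin V (v : V) P : lin_closed P -> lin_closed (fun x => P (action V x v)).
Proof.
move=> [P0 PP]; split; first by rewrite action0.
by move=> c x y Px Py; rewrite actionD actionZ; apply: PP.
Qed.

Lemma action_comm V x y (v : V) :
  action V x (action V y v) = action V (lie x y) v + action V y (action V x v).
Proof. by rewrite lie_rep_lie subrK. Qed.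

Lemma lie_rep_ext (U : vectType k) (r r' : lie_rep L U) :
  (forall a v, r a v = r' a v) -> r = r'.
Proof.
case: r r' => r rl rm [r' rl' rm'] /= e.
have e' : r = r' by apply: funext => a; apply/lfunP => v; exact: e.
move: rl rm {e}; rewrite e' => rl rm.
by congr LieRep; exact: Prop_irrelevance.
Qed.

Lemma liemod_ext V (r : lie_rep L V) : r = action V -> LieMod r = V.
Proof. by case: V r => V a r ->. Qed.

Lemma irreducible_full V (P : set V) : irreducible V -> lin_closed P ->
  (forall a u, P u -> P (action V a u)) ->
  (exists2 u, u <> 0 & P u) -> forall u, P u.
Proof.
move=> [_ irr] PP Pa [u u0 Pu]; have [U UP] := vspace_of_set PP.
have [|U0|Uf] := irr U; first by move=> a v /UP/Pa/UP.
  by case: u0; apply/eqP; rewrite -memv0 -U0; apply/UP.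
by move=> v; apply/UP; rewrite Uf memvf.
Qed.

Lemma irreducible_neq0 V : irreducible V -> exists v : V, v <> 0.
Proof.
move=> [V0 _]; apply: contrapT => h; apply: V0; apply/eqP; rewrite -subv0.
apply/subvP => v _; rewrite memv0; apply/eqP; apply: contrapT => v0.
by apply: h; exists v.
Qed.

Section DirectSum.
Variables V W : liemod L.
Let act (a : L) (p : V * W) : V * W := (action V a p.1, action W a p.2).

Fact dsum_act_linear a : linear (act a).
Proof. by move=> c u v; rewrite /act /= !linearP. Qed.

Let actl a : 'End((V * W)%type) := linfun (HB.pack_for {linear (V * W)%type -> (V * W)%type} (act a)
  (GRing.isLinear.Build _ _ _ _ (act a) (dsum_act_linear a))).

Let actlE a p : actl a p = act a p. Proof. by rewrite lfunE. Qed.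

Fact dsum_linear : linear actl.
Proof.
move=> c a b; apply/lfunP => p; rewrite add_lfunE scale_lfunE !actlE /act /=.
by rewrite !actionD !actionZ.
Qed.

Fact dsum_lie x y v : actl (lie x y) v = actl x (actl y v) - actl y (actl x v).
Proof. by rewrite !actlE /act /= !lie_rep_lie. Qed.

Definition dsum : liemod L := LieMod (LieRep dsum_linear dsum_lie).

Lemma dsumE a p : action dsum a p = (action V a p.1, action W a p.2).
Proof. exact: actlE. Qed.

End DirectSum.

End ModuleTheory.

Section Adjoint.
Variables (k : fieldType) (g : finLieAlgType k).

Let adf (x : g) : {linear g -> g} := HB.pack (lie x)
  (GRing.isLinear.Build _ _ _ _ (lie x) (lie_linearr x)).

Fact ad_linear : linear (fun x : g => linfun (adf x)).
Proof.
move=> c x y; apply/lfunP => v; rewrite add_lfunE scale_lfunE !lfunE /=.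
exact: lie_linearl.
Qed.

Lemma lieNr (x y : g) : lie x (- y) = - lie x y.
Proof. by have := linearN (adf x) y. Qed.

Lemma jacobi_comm (x y z : g) : lie (lie x y) z = lie x (lie y z) - lie y (lie x z).
Proof.
rewrite [LHS]lie_anti [lie x z]lie_anti lieNr opprK.
by apply/eqP; rewrite eq_sym -subr_eq0 opprK; apply/eqP/lie_jacobi.
Qed.

Fact ad_lie (x y z : g) : linfun (adf (lie x y)) z =
  linfun (adf x) (linfun (adf y) z) - linfun (adf y) (linfun (adf x) z).
Proof. by rewrite !lfunE /= jacobi_comm. Qed.

Definition adjoint : liemod g := LieMod (LieRep ad_linear ad_lie).

Lemma adjointE (x y : g) : action adjoint x y = lie x y.
Proof. by rewrite lfunE. Qed.

End Adjoint.

(** * Weights *)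

Section WeightVectors.
Variables (k : fieldType) (g : finLieAlgType k) (td : triangular_decomposition g).
Local Notation h := (cartan td).
Local Notation wt := (weight td).
Local Notation S := (simple_roots td).
Implicit Types V W : liemod g.

Lemma wt_ext (a b : wt) : (forall H, a H = b H :> k) -> a = b.
Proof. by move=> ab; apply/lfunP. Qed.

Lemma wt_neq (a b : wt) : a <> b -> exists H, a H != b H :> k.
Proof.
move=> ab; apply: contrapT => e; apply/ab/wt_ext => H; apply/eqP.
by apply: contrapT => /negP n; apply: e; exists H.
Qed.

Definition wvec V (a : wt) (v : V) : Prop :=
  forall H : subvs_of h, action V (vsval H) v = (a H : k) *: v.

Lemma wvec_lin V a : lin_closed (@wvec V a).
Proof.
split=> [H|c u v ua va H]; first by rewrite linear0 scaler0.
by rewrite linearP /= (ua H) (va H) scalerDr !scalerA mulrC.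
Qed.

Lemma wvec_root_space a x : root_space a x <-> wvec (V := adjoint g) a x.
Proof. by split=> xa H; have := xa H; rewrite adjointE. Qed.

Lemma wvec_act V a b x v :
  root_space a x -> wvec (V := V) b v -> wvec (V := V) (a + b) (action V x v).
Proof.
move=> xa vb H; rewrite action_comm (xa H) (vb H) actionZ linearZ /= -scalerDl.
by rewrite lfunE.
Qed.

(** Applying H - b(H) to the sum removes the term of b and rescales that of a by a(H) - b(H), which
    is nonzero for a suitable H; induction then kills the term of a. *)
Lemma wvec_indep V (s : seq wt) (u : wt -> V) : uniq s ->
  (forall a, a \in s -> wvec a (u a)) -> \sum_(a <- s) u a = 0 ->
  forall a, a \in s -> u a = 0.
Proof.
elim: s u => [|b s IH] u //= /andP[bs us] uw; rewrite big_cons => sum0.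
have sub a : a \in s -> wvec a (u a) by move=> As; apply: uw; rewrite inE As orbT.
have s0 a : a \in s -> u a = 0.
  move=> As; have ab : a <> b by move=> e; move: bs; rewrite -e As.
  have [H abH] := wt_neq ab.
  suff /eqP : ((a H : k) - (b H : k)) *: u a = 0.
    by rewrite scaler_eq0 subr_eq0 (negbTE abH) => /eqP.
  apply: (IH (fun c => ((c H : k) - (b H : k)) *: u c)) => //.
    by move=> c cs /=; apply: (lin_closedZ (P := @wvec V c)); [exact: wvec_lin|exact: sub].
  transitivity (action V (vsval H) (\sum_(c <- s) u c)
                 - (b H : k) *: \sum_(c <- s) u c).
    rewrite linear_sum /= scaler_sumr -sumrB !big_seq; apply: eq_bigr => c cs.
    by rewrite (sub _ cs H) scalerBl.
  have -> : \sum_(c <- s) u c = - u b by apply/eqP; rewrite -addr_eq0 addrC sum0.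
  by rewrite linearN /= (uw b _ H) ?inE ?eqxx // scalerN subrr.
move=> a; rewrite inE => /predU1P[->|/s0//]; move: sum0.
by rewrite big_seq big1 ?addr0.
Qed.

Lemma wvec_comp V (ps : seq (wt * V)) (a : wt) :
  (forall p, p \in ps -> wvec p.1 p.2) -> \sum_(p <- ps) p.2 = 0 ->
  \sum_(p <- ps | p.1 == a) p.2 = 0.
Proof.
move=> psw sum0; pose s := undup (a :: map fst ps).
apply: (wvec_indep (s := s) (u := fun a => \sum_(p <- ps | p.1 == a) p.2)).
- exact: undup_uniq.
- move=> b _; rewrite big_seq_cond; apply: lin_closed_sum; first exact: wvec_lin.
  by move=> p /andP[/psw pw /eqP <-].
- rewrite -[RHS]sum0 (exchange_big_dep xpredT) //=; apply: eq_big_seq => p pps.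
  rewrite big_mkcond (bigD1_seq p.1) ?undup_uniq ?mem_undup ?inE ?(map_f fst pps) ?orbT //=.
  by rewrite eqxx big1 ?addr0 // => b; rewrite eq_sym => /negbTE ->.
- by rewrite mem_undup mem_head.
Qed.

Lemma wvec_bound V (s : seq wt) : uniq s ->
  (forall a, a \in s -> exists2 v : V, v <> 0 & wvec a v) ->
  (size s <= \dim {:V})%N.
Proof.
move=> us sw; have [u uP] : {u : wt -> V & forall a, a \in s -> u a <> 0 /\ wvec a (u a)}.
  apply: (choice (P := fun a v => a \in s -> v <> 0 /\ wvec a v)) => a.
  by case: (boolP (a \in s)) => [/sw[v]|]; [exists v|exists 0].
have fr : free [seq u a | a <- s].
  rewrite -[[seq u a | a <- s]]/(tval (map_tuple u (in_tuple s))).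
  apply/freeP => c sum0 i.
  have si : s`_i \in s by rewrite mem_nth.
  have [ui0 _] := uP _ si.
  have idx (j : 'I_(size s)) : (map_tuple u (in_tuple s))`_j = u s`_j.
    by rewrite (nth_map 0).
  pose c' a := if insub (index a s) is Some j then c j else 0.
  have c'E (j : 'I_(size s)) : c' s`_j = c j.
    by rewrite /c' index_uniq // valK.
  have := @wvec_indep V s (fun a => c' a *: u a) us _ _ _ si.
  rewrite c'E => e; apply/eqP; apply: contrapT => /negP ci; apply: ui0.
  suff /eqP : c i *: u s`_i = 0 by rewrite scaler_eq0 (negbTE ci) => /eqP.
  apply: e.
    by move=> a As; apply: (lin_closedZ (P := @wvec V a)); [exact: wvec_lin|case: (uP _ As)].
  rewrite -[RHS]sum0 (big_nth 0) big_mkord; apply: eq_bigr => j _.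
  by rewrite c'E idx.
have := dimvS (subvf <<[seq u a | a <- s]>>).
by move: fr; rewrite /free => /eqP ->; rewrite size_map.
Qed.

Hypothesis char0 : [pchar k] =i pred0.

Lemma natr_eq0 n : (n%:R == 0 :> k) = (n == 0)%N.
Proof. by move/pcharf0P: char0 => ->. Qed.

Lemma wt_mulrn (a : wt) n H : (a *+ n) H = (a H : k) *+ n.
Proof. by elim: n => [|n IH]; rewrite ?mulr0n ?zero_lfunE // !mulrS add_lfunE IH. Qed.

Lemma wt_natmul_inj (a : wt) m n : a <> 0 -> a *+ m = a *+ n -> m = n.
Proof.
move=> a0; have [H aH] := wt_neq a0.
wlog mn : m n / (m <= n)%N => [th|].
  by case/orP: (leq_total m n) => mn; [exact: th|move/esym/th => /(_ mn)].
move=> e; have : a *+ (n - m) = 0 by rewrite mulrnBr // e subrr.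
move/(congr1 (fun b : wt => b H : k)); rewrite wt_mulrn zero_lfunE.
rewrite zero_lfunE in aH; rewrite -mulr_natr => /eqP.
rewrite mulf_eq0 (negbTE aH) natr_eq0 subn_eq0 => nm.
by apply/eqP; rewrite eqn_leq mn.
Qed.

(** In characteristic zero the weights b + i a are pairwise distinct, and V has room for at most
    [\dim {:V}] of them. Root vectors are nilpotent for this reason. *)
Lemma string_nil V (a b : wt) (u : nat -> V) : a <> 0 ->
  (forall i, wvec (b + a *+ i) (u i)) -> exists i, u i = 0.
Proof.
move=> a0 uw; apply: contrapT => no.
pose s := [seq b + a *+ i | i <- iota 0 (\dim {:V}).+1].
have us : uniq s.
  rewrite map_inj_uniq ?iota_uniq // => i j /addrI; exact: wt_natmul_inj.
have := @wvec_bound V s us; rewrite size_map size_iota ltnn => h.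
suff : false by []; apply: h => c /mapP[i _ ->]; exists (u i) => // ui.
by apply: no; exists i.
Qed.

End WeightVectors.

(** * Highest weight vectors and the submodules they generate *)

Section HighestWeight.
Variables (k : fieldType) (g : finLieAlgType k) (td : triangular_decomposition g).
Hypothesis char0 : [pchar k] =i pred0.
Local Notation h := (cartan td).
Local Notation wt := (weight td).
Local Notation S := (simple_roots td).
Implicit Types V W : liemod g.

(** A linear functional with value 1 on every simple root, extended by [coord] to all weights. Its
    values lie in k; weights are compared through differences that are natural numbers, which
    characteristic zero keeps distinct. *)
Definition height (a : wt) : k := \sum_i coord (in_tuple S) i a.

Lemma heightD a b : height (a + b) = height a + height b.
Proof. by rewrite /height -big_split; apply: eq_bigr => i _; rewrite linearD. Qed.

Lemma heightN a : height (- a) = - height a.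
Proof. by rewrite /height -sumrN; apply: eq_bigr => i _; rewrite linearN. Qed.

Lemma height0 : height 0 = 0.
Proof. by rewrite -(subrr 0) heightD heightN subrr. Qed.

Lemma height_sum (J : Type) (s : seq J) (F : J -> wt) :
  height (\sum_(j <- s) F j) = \sum_(j <- s) height (F j).
Proof. exact: (big_morph height heightD height0). Qed.

Lemma height_mulrn a n : height (a *+ n) = height a *+ n.
Proof. by elim: n => [|n IH]; rewrite ?mulr0n ?height0 // !mulrS heightD IH. Qed.

Lemma height_simple a : a \in S -> height a = 1.
Proof.
move=> aS; have fS : free (in_tuple S) by exact: simple_roots_free.
move: (aS) => /(nthP 0)[j jS <-].
have e i : coord (in_tuple S) i S`_j = (i == Ordinal jS)%:R.
  by rewrite eq_sym; exact: (coord_free (Ordinal jS) i fS).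
rewrite /height (bigD1 (Ordinal jS)) //= e eqxx big1 ?addr0 // => i ij.
by rewrite e (negbTE ij).
Qed.

Lemma height_ncomb a : ncomb S a -> exists n, height a = n%:R /\ (n = 0%N -> a = 0).
Proof.
case=> c ->; exists (\sum_(b <- S) c b)%N; split.
  rewrite height_sum natr_sum; apply: eq_big_seq => b bS.
  by rewrite height_mulrn height_simple.
move=> /eqP; rewrite sum_nat_seq_eq0 => /allP c0; rewrite big_seq big1 // => b /c0 /=.
by move=> /eqP ->; rewrite mulr0n.
Qed.

Lemma height_root a : is_root a -> ncomb S a -> exists2 n, (0 < n)%N & height a = n%:R.
Proof.
move=> [a0 _] /height_ncomb[[|n] [hn n0]]; last by exists n.+1.
by case: a0; apply: n0.
Qed.

Definition pos_vector (a : wt) (x : g) := [/\ is_root a, ncomb S a & root_space a x].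
Definition neg_vector (a : wt) (x : g) := [/\ is_root a, ncomb S (- a) & root_space a x].

Lemma triangularE (z : g) : exists x y H : g,
  [/\ x \in nneg td, y \in h, H \in npos td & z = x + y + H].
Proof.
have : z \in (nneg td + h + npos td)%VS by rewrite Defs.triangular_sum memvf.
case/memv_addP=> u /memv_addP[x xn [y yh ->]] [p pn ->].
by exists x, y, p.
Qed.

Lemma triangular_ind (P : set g) : lin_closed P ->
  (forall a x, neg_vector a x -> P x) -> (forall x, x \in h -> P x) ->
  (forall a x, pos_vector a x -> P x) -> forall z, P z.
Proof.
move=> PP Pn Ph Pp z; have [x [y [p [xn yh pn ->]]]] := triangularE z.
apply: (lin_closedD PP); first apply: (lin_closedD PP).
- by move/nnegP: xn; apply: lspan_least => // u [a au]; apply: Pn au.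
- exact: Ph.
- by move/nposP: pn; apply: lspan_least => // u [a au]; apply: Pp au.
Qed.

(** Words in negative root vectors applied to v, indexed by their weight. For a highest weight
    vector v they span the submodule U(n^-) v. *)
Inductive lowered V (l : wt) (v : V) : wt -> V -> Prop :=
| lowered_refl : lowered l v l v
| lowered_step b u a y :
    neg_vector a y -> lowered l v b u -> lowered l v (a + b) (action V y u).

Lemma lowered_wvec V l v b u : wvec l v -> @lowered V l v b u -> wvec b u.
Proof.
move=> lv; elim=> // {b u} b u a y [_ _ ya] _ ub; exact: wvec_act.
Qed.

Lemma lowered_height V l v b u : @lowered V l v b u ->
  (b = l /\ u = v) \/ exists2 n, (0 < n)%N & height b + n%:R = height l.
Proof.
elim=> [|{b u} b u a y [ra na _] _ IH]; [by left|right].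
have [n n0 hn] : exists2 n, (0 < n)%N & height (- a) = n%:R.
  have [[|n] [hn a0]] := height_ncomb na; last by exists n.+1.
  by case: ra => a0' _; case: a0'; rewrite -[a]opprK a0 // oppr0.
have hD m : height (a + b) + (n + m)%N%:R = height b + m%:R.
  by rewrite natrD -hn heightN heightD addrACA subrr add0r addrC.
case: IH => [[bl _]|[m m0 hm]].
  by exists n => //; have := hD 0%N; rewrite addn0 addr0 bl.
by exists (n + m)%N; rewrite ?addn_gt0 ?n0 // hD.
Qed.

(** Moving z past the outermost operator y of a word leaves [z, y] acting on a shorter word, so the
    induction runs over all z at once; on v itself z is split along the triangular decomposition. *)
Lemma lowered_stable V l (v : V) : wvec l v ->
  (forall x, x \in npos td -> action V x v = 0) ->
  forall z u, lspan [set u | exists b, lowered l v b u] u ->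
  lspan [set u | exists b, lowered l v b u] (action V z u).
Proof.
move=> lv nv z; set M := lspan _.
have ML : lin_closed M := lspan_lin _.
have neg a y u : neg_vector a y -> M u -> M (action V y u).
  move=> ay; apply: (lspan_least (P := fun u => M (action V y u))).
    exact: (lin_closed_comp (linearP _) ML).
  by move=> u' [b bu]; apply: lspan_sub; exists (a + b); constructor.
suff main b u : lowered l v b u -> forall z, M (action V z u).
  move=> u; apply: (lspan_least (P := fun u => M (action V z u))).
    exact: (lin_closed_comp (linearP _) ML).
  by move=> u' [b bu]; apply: main bu _.
have Mv : M v by apply: lspan_sub; exists l; constructor.
elim=> [|{b u} b u a y ay bu IH] x.
  move: x; apply: (triangular_ind (P := fun x => M (action V x v))) => [|a x ax|x xh|a x ax].
  - exact: action_lin.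
  - exact: neg ax Mv.
  - have -> : action V x v = (l (Sub x xh) : k) *: v by exact: lv (Sub x xh).
    exact: lin_closedZ.
  - rewrite nv; first by case: ML.
    by apply/nposP; apply: lspan_sub; exists a.
by rewrite action_comm; apply: lin_closedD => //; apply: neg ay _.
Qed.

(** Any nonempty word lowers the height, so the part of weight b in an expansion of u consists
    either of multiples of v alone or of vectors of height below that of l. *)
Lemma highest_weight_comp V l (v u : V) b : wvec l v -> wvec b u ->
  lspan [set u | exists b, lowered l v b u] u ->
  [\/ b = l /\ exists c, u = c *: v, u = 0
    | exists2 n, (0 < n)%N & height b + n%:R = height l].
Proof.
move=> lv bu [s [sM uE]].
have [lab labP] : {lab : V -> wt & forall u, (exists b, lowered l v b u) -> lowered l v (lab u) u}.
  apply: (choice (P := fun u b => (exists b, lowered l v b u) -> lowered l v b u)) => w.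
  by have [[c cw]|no] := pselect (exists b, lowered l v b w); [exists c|exists 0].
pose ps := (b, - u) :: [seq (lab p.2, p.1 *: p.2) | p <- s].
have psw p : p \in ps -> wvec p.1 p.2.
  rewrite inE => /predU1P[->|/mapP[q qs ->]] /=.
    by rewrite -scaleN1r; apply: (lin_closedZ (P := @wvec _ _ td V b)) => //; exact: wvec_lin.
  apply: (lin_closedZ (P := @wvec _ _ td V (lab q.2))); first exact: wvec_lin.
  by apply: lowered_wvec lv _; apply/labP/sM.
have /(wvec_comp b psw) : \sum_(p <- ps) p.2 = 0.
  by rewrite big_cons big_map /= -uE addNr.
rewrite big_cons /= eqxx big_map /= => /eqP; rewrite addrC subr_eq0 => /eqP uE'.
have [/hasP[p ps' /eqP pb]|/hasPn no] := boolP (has (fun p => lab p.2 == b) s); last first.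
  by apply: Or32; rewrite -uE' big_seq_cond big1 // => p /andP[/no /negbTE ->].
have [[bl _]|[n n0 hn]] := lowered_height (labP _ (sM _ ps')); last first.
  by apply: Or33; exists n; rewrite -?pb.
apply: Or31; rewrite -pb bl; split=> //; exists (\sum_(q <- s | lab q.2 == b) q.1).
rewrite -uE' scaler_suml big_seq_cond [RHS]big_seq_cond; apply: eq_bigr => q.
case/andP=> qs /eqP qb.
have [[_ -> //]|[n n0 hn]] := lowered_height (labP _ (sM _ qs)).
move/eqP: hn; rewrite qb -pb bl -subr_eq0 addrAC subrr add0r natr_eq0 //.
by rewrite eqn0Ngt n0.
Qed.

(** Each highest weight vector generates the module, so of two highest weights each equals the other
    or has strictly smaller height; the second cannot hold both ways. *)
Lemma highest_weight_uniq V (l m : wt) : irreducible V ->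
  has_highest_weight V l -> has_highest_weight V m -> l = m.
Proof.
have key a b : irreducible V -> has_highest_weight V a -> has_highest_weight V b ->
    b = a \/ exists2 n, (0 < n)%N & height b + n%:R = height a.
  move=> irr [v [v0 nv av]] [w [w0 nw bw]].
  have Mw : lspan [set u | exists b, lowered a v b u] w.
    apply: (irreducible_full irr (lspan_lin _)).
      by move=> x u; apply: lowered_stable.
    by exists v => //; apply: lspan_sub; exists a; constructor.
  by case: (highest_weight_comp av bw Mw) => [[->]|//|]; [left|right].
move=> irr hl hm.
case: (key _ _ irr hl hm) => [->//|[n n0 en]]; case: (key _ _ irr hm hl) => [//|[p p0]].
rewrite -en -addrA -natrD => /eqP; rewrite addrC -subr_eq0 addrK natr_eq0 //.
by rewrite addn_eq0 !eqn0Ngt n0.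
Qed.

(* The submodule of V + W generated by the pair of highest weight vectors is the
   graph of an isomorphism from V onto W. *)
Lemma highest_weight_pull V W (l m : wt) (f : lie_hom g g) :
  irreducible_of_weight V l -> irreducible_of_weight W l ->
  has_highest_weight (pull f V) m -> has_highest_weight (pull f W) m.
Proof.
move=> [irrV [v [v0 nv lv]]] [irrW [w [w0 nw lw]]] [u [u0 nu mu]].
pose M := lspan [set p | exists b, lowered (V := dsum V W) l (v, w) b p].
have lvw : wvec (V := dsum V W) l (v, w) by move=> H; rewrite dsumE lv lw.
have stab z p : M p -> M (action (dsum V W) z p).
  apply: lowered_stable => // x xn; by rewrite dsumE nv // nw.
have ML : lin_closed M := lspan_lin _.
have Mvw : M (v, w) by apply: lspan_sub; exists l; constructor.
(* Otherwise M contains {0} x W and so (0, w), which has the weight l of the generator (v, w)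
   without being a multiple of it. *)
have M01 w' : M (0, w') -> w' = 0.
  move=> Mw'; apply: contrapT => w'0.
  have : M (0, w).
    apply: (irreducible_full irrW (P := fun w' => M (0, w'))); last by exists w'.
      split=> [|c y z My Mz]; first by case: ML.
      by have := ML.2 c _ _ My Mz; rewrite /= -[_ + _]/(_, _) /= scaler0 addr0.
    by move=> a y /(stab a); rewrite dsumE linear0.
  have w0l : wvec (V := dsum V W) l (0, w).
    by move=> H; rewrite dsumE linear0 lw; congr (_, _); rewrite scaler0.
  case/(highest_weight_comp lvw w0l) => [[_ [c [cv cw]]]|[/w0]|[n n0 /eqP]] //.
    move/esym/eqP: cv; rewrite scaler_eq0 => /orP[/eqP c0|/eqP//].
    by apply: w0; rewrite cw c0 scale0r.
  by rewrite addrC -subr_eq0 addrK natr_eq0 // eqn0Ngt n0.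
have M10 v' : M (v', 0) -> v' = 0.
  move=> Mv'; apply: contrapT => v'0.
  have : M (v, 0).
    apply: (irreducible_full irrV (P := fun v' => M (v', 0))); last by exists v'.
      split=> [|c y z My Mz]; first by case: ML.
      by have := ML.2 c _ _ My Mz; rewrite /= -[_ + _]/(_, _) /= scaler0 addr0.
    by move=> a y /(stab a); rewrite dsumE linear0.
  have v0l : wvec (V := dsum V W) l (v, 0).
    by move=> H; rewrite dsumE linear0 lv; congr (_, _); rewrite scaler0.
  case/(highest_weight_comp lvw v0l) => [[_ [c [cv cw]]]|[/v0]|[n n0 /eqP]] //.
    move/esym/eqP: cw; rewrite scaler_eq0 => /orP[/eqP c0|/eqP//].
    by apply: v0; rewrite cv c0 scale0r.
  by rewrite addrC -subr_eq0 addrK natr_eq0 // eqn0Ngt n0.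
have [u' Muu'] : exists u', M (u, u').
  apply: (irreducible_full irrV (P := fun u => exists u', M (u, u'))).
  - split; first by exists 0; case: ML.
    by move=> c y z [y' My] [z' Mz]; exists (c *: y' + z'); exact: (ML.2 c _ _ My Mz).
  - by move=> a y [y' /(stab a)]; rewrite dsumE; exists (action W a y').
  - by exists v => //; exists w.
exists u'; split.
- by move=> u'0; apply: u0; apply: M10; rewrite -u'0.
- move=> x xn; apply: M01; have := stab (f x) _ Muu'; rewrite dsumE /=.
  by have -> : action V (f x) u = 0 by exact: nu.
- move=> H; have := stab (f (vsval H)) _ Muu'; rewrite dsumE /=.
  have -> : action V (f (vsval H)) u = (m H : k) *: u by exact: mu.
  move/(lin_closedB ML)/(_ (lin_closedZ (m H : k) ML Muu')).
  rewrite -[_ - _]/(_, _) /= subrr => /M01/eqP.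
  by rewrite subr_eq0 => /eqP.
Qed.

End HighestWeight.

(** * Common eigenvectors and existence of highest weights *)

Section CommonEigenvector.
Variables (k : closedFieldType) (V : vectType k).

Lemma eigenvector_in (U : {vspace V}) (f : 'End(V)) : U <> 0%VS ->
  (forall u, u \in U -> f u \in U) ->
  exists c u, [/\ u \in U, u <> 0 & f u = c *: u].
Proof.
move=> U0 fU; have d0 : (0 < \dim U)%N.
  by rewrite lt0n dimv_eq0; apply/eqP.
pose M := \matrix_(i, j < \dim U) coord (vbasis U) j (f (vbasis U)`_i).
have /closed_rootP[c] : size (char_poly M) != 1%N.
  by rewrite size_char_poly; apply/eqP => -[e]; rewrite e in d0.
rewrite -eigenvalue_root_char => /eigenvalueP[r rM r0].
have bU i : (i < \dim U)%N -> (vbasis U)`_i \in U.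
  by move=> iU; apply: vbasis_mem; rewrite mem_nth ?size_tuple.
exists c, (\sum_i r 0 i *: (vbasis U)`_i); split.
- by apply: memv_suml => i _; apply/memvZ/bU.
- have /freeP fr := basis_free (vbasisP U).
  move=> /fr h; move/eqP: r0; apply; apply/rowP => i; rewrite h mxE //.
- rewrite linear_sum scaler_sumr /=.
  transitivity (\sum_i \sum_j (r 0 i * M i j) *: (vbasis U)`_j).
    apply: eq_bigr => i _; rewrite linearZ /= [f _](coord_vbasis (fU _ (bU i _))) //.
    by rewrite scaler_sumr; apply: eq_bigr => j _; rewrite scalerA mxE.
  rewrite exchange_big; apply: eq_bigr => j _ /=; rewrite -scaler_suml scalerA.
  by congr (_ *: _); move/rowP/(_ j): rM; rewrite !mxE.
Qed.

Lemma common_eigenvector_in (fs : seq 'End(V)) (U : {vspace V}) : U <> 0%VS ->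
  (forall f u, f \in fs -> u \in U -> f u \in U) ->
  (forall f f' u, f \in fs -> f' \in fs -> f (f' u) = f' (f u)) ->
  exists2 u, u \in U /\ u <> 0 & forall f, f \in fs -> exists c, f u = c *: u.
Proof.
elim: fs U => [|f fs IH] U U0 fU fC.
  have : vpick U != 0 by rewrite vpick0; apply/eqP.
  by move/eqP => v0; exists (vpick U); first by split=> //; exact: memv_pick.
have [c [u [uU u0 fu]]] := eigenvector_in U0 (fun u => fU f u (mem_head _ _)).
pose P v := v \in U /\ f v = c *: v.
have PP : lin_closed P.
  split=> [|d v w [vU fv] [wU fw]]; first by split; rewrite ?mem0v ?linear0 ?scaler0.
  split; first by rewrite memvD // memvZ.
  by rewrite linearP /= fv fw scalerDr !scalerA mulrC.
have [U' U'P] := vspace_of_set PP.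
have [|f' v f's /U'P[vU fv]||w [wU' w0] ev] := IH U'.
- by move=> U'0; apply: u0; apply/eqP; rewrite -memv0 -U'0; apply/U'P.
- have fs' : f' \in f :: fs by rewrite inE f's orbT.
  apply/U'P; split; first exact: fU.
  by rewrite (fC _ _ _ (mem_head _ _) fs') fv linearZ.
- by move=> f1 f2 v f1s f2s; apply: fC; rewrite inE ?f1s ?f2s orbT.
- have /U'P[wU fw] := wU'.
  by exists w => // f'; rewrite inE => /predU1P[->|/ev//]; exists c.
Qed.

End CommonEigenvector.

Section HighestWeightExistence.
Variables (k : closedFieldType) (g : finLieAlgType k).
Variable td : triangular_decomposition g.
Hypothesis char0 : [pchar k] =i pred0.
Local Notation h := (cartan td).
Local Notation wt := (weight td).
Implicit Types V W : liemod g.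

Lemma exists_wvec V : (exists v : V, v <> 0) ->
  exists (a : wt) (v : V), v <> 0 /\ wvec a v.
Proof.
move=> [v0 v00].
pose b (i : 'I_(\dim h)) : g := (vbasis h)`_i.
have bh i : b i \in h by apply: vbasis_mem; rewrite mem_nth ?size_tuple.
have fC f f' u : f \in [seq action V (b i) | i <- enum 'I_(\dim h)] ->
    f' \in [seq action V (b i) | i <- enum 'I_(\dim h)] -> f (f' u) = f' (f u).
  move=> /mapP[i _ ->] /mapP[j _ ->]; rewrite action_comm.
  by rewrite (cartan_abelian (bh i) (bh j)) action0 add0r.
have [||v [_ vn0] ev] := @common_eigenvector_in _ _ _ fullv _ _ fC.
- by move=> V0; apply: v00; apply/eqP; rewrite -memv0 -V0 memvf.
- by move=> *; exact: memvf.
have [c cP] : {c : 'I_(\dim h) -> k & forall i, action V (b i) v = c i *: v}.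
  apply: (choice (P := fun i d => action V (b i) v = d *: v)) => i.
  by apply: ev; apply/mapP; exists i; rewrite ?mem_enum.
pose a0 (H : subvs_of h) : k^o := \sum_i coord (vbasis h) i (vsval H) * c i.
have a0l : linear a0.
  move=> d H H'; rewrite /a0 /GRing.scale /= mulr_sumr -big_split /=.
  by apply: eq_bigr => i _; rewrite linearP /= mulrDl mulrA.
exists (linfun (HB.pack_for {linear subvs_of h -> k^o} a0
  (GRing.isLinear.Build _ _ _ _ a0 a0l))), v; split=> // H.
rewrite lfunE /= /a0 scaler_suml.
rewrite [in LHS](coord_vbasis (subvsP H)).
have lin : linear (fun x => action V x v).
  by move=> d x y; rewrite actionD actionZ.
pose F : {linear g -> V} := HB.pack (fun x => action V x v)
  (GRing.isLinear.Build _ _ _ _ (fun x => action V x v) lin).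
rewrite -[LHS]/(F _) linear_sum; apply: eq_bigr => i _ /=.
by rewrite actionZ cP scalerA.
Qed.

(** Otherwise positive root vectors could be applied to a weight vector forever without reaching
    zero. The height grows at each step, so this would produce more distinct weights than
    [\dim {:V}]. *)
Lemma exists_highest_weight V : (exists v : V, v <> 0) ->
  exists l : wt, has_highest_weight V l.
Proof.
move=> Vn0; apply: contrapT => no.
have step (p : wt * V) : exists q : wt * V, p.2 <> 0 -> wvec p.1 p.2 ->
    [/\ q.2 <> 0, wvec q.1 q.2 & exists2 n, (0 < n)%N &
        height q.1 = height p.1 + n%:R].
  case: p => a v /=.
  have [v0|v0] := eqVneq v 0; first by exists (0, 0) => /(_ v0).
  have [av|av] := pselect (wvec a v); last by exists (0, 0).
  have [x [xn xv]] : exists x, x \in npos td /\ action V x v <> 0.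
    apply: contrapT => nx; apply: no; exists a; exists v; split=> //.
      exact/eqP.
    by move=> x xn; apply: contrapT => xv; apply: nx; exists x.
  have [b [y [yb yv]]] : exists (b : wt) y, pos_vector b y /\ action V y v <> 0.
    apply: contrapT => ny; apply: xv; move/nposP: xn.
    apply: (lspan_least (P := fun x => action V x v = 0)).
      split; first exact: action0.
      by move=> c y z ey ez; rewrite actionD actionZ ey ez scaler0 addr0.
    by move=> y [b yb]; apply: contrapT => yv; apply: ny; exists b, y.
  exists (b + a, action V y v) => /= _ _; have [rb nb by'] := yb; split=> //.
    exact: wvec_act.
  have [n n0 hn] := height_root rb nb.
  by exists n => //; rewrite heightD hn addrC.
have [next nextP] := choice step.
have [a [v [v0 av]]] := exists_wvec Vn0.
pose p i := iter i next (a, v).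
have pP i : (p i).2 <> 0 /\ wvec (p i).1 (p i).2.
  by elim: i => [//|i [IH1 IH2]]; have [h1 h2 _] := nextP _ IH1 IH2.
have hp i j : (i < j)%N -> exists2 n, (0 < n)%N &
    height (p j).1 = height (p i).1 + n%:R.
  elim: j => // j IH; rewrite ltnS leq_eqVlt => /predU1P[->|/IH[n n0 hn]].
    by have [h1 h2] := pP j; have [_ _] := nextP _ h1 h2.
  have [h1 h2] := pP j; have [_ _ [m m0 hm]] := nextP _ h1 h2.
  by exists (n + m)%N; rewrite ?addn_gt0 ?n0 // hm hn natrD addrA.
pose s := [seq (p i).1 | i <- iota 0 (\dim {:V}).+1].
have us : uniq s.
  rewrite map_inj_uniq ?iota_uniq // => i j e; apply: contrapT => /eqP.
  rewrite neq_ltn => /orP[] /hp[n n0]; rewrite e => /eqP;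
  by rewrite eq_sym -subr_eq0 addrAC subrr add0r natr_eq0 // eqn0Ngt n0.
have := @wvec_bound _ _ _ V s us; rewrite size_map size_iota ltnn => bound.
by suff : false by []; apply: bound => c /mapP[i _ ->]; have [] := pP i; exists (p i).2.
Qed.

End HighestWeightExistence.

(** * Semisimple Lie algebras are perfect *)

(** A largest free family of weight vectors spans, because root vectors and h span g. The clause on
    weight 0 leads to [root_space0]: h is the whole zero weight space, that is, its own
    centralizer. *)
Lemma exists_weight_basis (k : fieldType) (g : finLieAlgType k)
    (td : triangular_decomposition g) :
  exists n (e : n.-tuple g) (w : 'I_n -> weight td),
    [/\ basis_of {:g} e, forall i, root_space (w i) e`_i
      & forall i, w i = 0 -> e`_i \in cartan td].
Proof.
pose Q (a : weight td) x := root_space a x /\ (a = 0 -> x \in cartan td).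
pose good n := `[< exists X : seq g,
  [/\ free X, forall x, x \in X -> exists a, Q a x & size X = n] >].
have ex : exists n, good n.
  by exists 0%N; apply/asboolP; exists [::]; split=> //; exact: nil_free.
have ub n : good n -> (n <= \dim {:g})%N.
  move=> /asboolP[X [fX _ <-]]; move: (fX); rewrite /free => /eqP <-.
  exact/dimvS/subvf.
have [n /asboolP[X [fX XQ sX]] nmax] := ex_maxnP ex ub.
have inX a x : Q a x -> x \in <<X>>%VS.
  move=> ax; apply: contrapT => /negP xX.
  have : good n.+1.
    apply/asboolP; exists (x :: X); split; rewrite /= ?sX ?free_cons ?xX //.
    by move=> y; rewrite inE => /predU1P[->|/XQ//]; exists a.
  by move/nmax; rewrite ltnn.
have span z : z \in <<X>>%VS.
  apply: (triangular_ind (td := td) (P := fun z => z \in <<X>>%VS)).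
  - by split=> [|c u v uX vX]; rewrite ?mem0v // memvD ?memvZ.
  - by move=> a x [[a0 _] _ ax]; apply: (inX a).
  - move=> x xh; apply: (inX 0); split=> // H.
    by rewrite (cartan_abelian (subvsP H) xh) zero_lfunE scale0r.
  - by move=> a x [[a0 _] _ ax]; apply: (inX a).
have XQ' (i : 'I_(size X)) : exists a, Q a (in_tuple X)`_i.
  by apply: XQ; rewrite mem_nth.
have [w wP] := choice XQ'.
exists (size X), (in_tuple X), w; split=> [|i|i]; [|by case: (wP i)|by case: (wP i)].
rewrite basisEfree fX subvf /=.
suff /eqP <- : <<X>>%VS == fullv by move: fX; rewrite /free => /eqP ->.
by rewrite eqEsubv subvf; apply/subvP.
Qed.

Section Structure.
Variables (k : fieldType) (g : finLieAlgType k) (td : triangular_decomposition g).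
Hypothesis char0 : [pchar k] =i pred0.
Hypothesis ss : semisimple g.
Local Notation h := (cartan td).
Local Notation wt := (weight td).
Implicit Types (x y z u : g) (a b : wt).

Lemma abelian_ideal0 (P : set g) : lin_closed P ->
  (forall x y, P y -> P (lie x y)) -> (forall x y, P x -> P y -> lie x y = 0) ->
  forall x, P x -> x = 0.
Proof.
move=> PP Pi Pab; have [I IP] := vspace_of_set PP.
suff I0 : I = 0%VS.
  by move=> x /IP; rewrite I0 memv0 => /eqP.
apply: ss; first by move=> x y /IP /(Pi x) /IP.
exists 1%N; apply/eqP; rewrite -subv0 /=; apply/span_subvP => z.
case/allpairsP => -[x y] /= [/vbasis_mem/IP Px /vbasis_mem/IP Py ->].
by rewrite (Pab _ _ Px Py) mem0v.
Qed.

Lemma lie0r x : lie x 0 = 0.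
Proof. by rewrite -adjointE linear0. Qed.

Lemma center0 z : (forall x, lie x z = 0) -> z = 0.
Proof.
apply: (abelian_ideal0 (P := [set z | forall x, lie x z = 0])).
- split=> [x|c u v hu hv x] /=; first exact: lie0r.
  by rewrite lie_linearr hu hv scaler0 addr0.
- by move=> x y hy z'; rewrite hy lie0r.
- by move=> x y _; apply.
Qed.

Variables (n : nat) (e : n.-tuple g) (w : 'I_n -> wt).
Hypothesis eb : basis_of {:g} e.
Hypothesis ew : forall i, root_space (w i) e`_i.
Hypothesis eh : forall i, w i = 0 -> e`_i \in h.
Local Notation co i := (coord e i).

Lemma coE z : z = \sum_i co i z *: e`_i.
Proof. exact: (coord_basis eb (memvf z)). Qed.

Lemma co_e (i j : 'I_n) : co i e`_j = (j == i)%:R.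
Proof. exact: (coord_free j i (basis_free eb)). Qed.

Lemma lie_sumr (J : finType) x (F : J -> g) :
  lie x (\sum_j F j) = \sum_j lie x (F j).
Proof. by rewrite -adjointE linear_sum; apply: eq_bigr => j _; rewrite /= adjointE. Qed.

Lemma lieZr c x y : lie x (c *: y) = c *: lie x y.
Proof. by rewrite -!adjointE linearZ. Qed.

Lemma lie_basis x y : lie x y = \sum_i co i y *: lie x e`_i.
Proof.
by rewrite {1}[y]coE lie_sumr; apply: eq_bigr => i _; rewrite lieZr.
Qed.

Lemma root_spaceD a b x y :
  root_space a x -> root_space b y -> root_space (a + b) (lie x y).
Proof.
move=> ax /wvec_root_space yb; apply/wvec_root_space.
by rewrite -adjointE; apply: wvec_act.
Qed.

Lemma root_space_lin a : lin_closed (@root_space k g h a).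
Proof.
have [w0 wP] := @wvec_lin k g td (adjoint g) a; split; first exact/wvec_root_space.
by move=> c u v /wvec_root_space uu /wvec_root_space vv; apply/wvec_root_space/wP.
Qed.

Lemma co_ad H i z : co i (lie (vsval H) z) = (w i H : k) * co i z.
Proof.
rewrite lie_basis linear_sum (bigD1 i) //= big1 ?addr0 => [|j ji].
  by rewrite ew !linearZ /= co_e eqxx mulr1 mulrC.
by rewrite ew !linearZ /= co_e (negbTE ji) !mulr0.
Qed.

Lemma co_weight a z i : root_space a z -> co i z != 0 -> w i = a.
Proof.
move=> az zi; apply: wt_ext => H; apply: (mulIf zi).
by rewrite -co_ad az linearZ.
Qed.

Lemma root_space_weight a z : root_space a z -> z <> 0 -> exists i, w i = a.
Proof.
move=> az z0; apply: contrapT => no; apply: z0; rewrite [z]coE big1 // => i _.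
have [->|zi] := eqVneq (co i z) 0; first by rewrite scale0r.
by case: no; exists i; apply: co_weight zi.
Qed.

Lemma root_space0 z : root_space (0 : wt) z -> z \in h.
Proof.
move=> z0; rewrite [z]coE; apply: memv_suml => i _.
have [->|zi] := eqVneq (co i z) 0; first by rewrite scale0r mem0v.
by apply/memvZ/eh/(co_weight z0).
Qed.

Definition adm x : 'M[k]_n := \matrix_(i, j) co j (lie x e`_i).

Lemma adm_lie x y : adm (lie x y) = adm y *m adm x - adm x *m adm y.
Proof.
have E u v (i l : 'I_n) : co l (lie u (lie v e`_i)) = (adm v *m adm u) i l.
  rewrite lie_basis linear_sum !mxE; apply: eq_bigr => j _ /=.
  by rewrite linearZ !mxE.
by apply/matrixP => i l; rewrite mxE jacobi_comm linearB /= !E !mxE.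
Qed.

Lemma adm_weight a x i j : root_space a x -> adm x i j != 0 -> w j = a + w i.
Proof. by move=> ax; rewrite mxE; apply: co_weight; apply: root_spaceD. Qed.

Lemma adm_cartan H i j : adm (vsval H) i j = (w i H : k) *+ (i == j).
Proof. by rewrite mxE co_ad co_e; case: eqP => [->|_]; rewrite ?mulr1 ?mulr0. Qed.

Lemma adm_lin x y c : adm (c *: x + y) = c *: adm x + adm y.
Proof. by apply/matrixP => i j; rewrite !mxE lie_linearl linearP. Qed.

(* The trace of ad H on the sum of the weight spaces of the a-string through
   w i0 is zero, since H is a commutator of operators preserving that sum. *)
Lemma string_trace a i0 : exists d m, (0 < d)%N /\
  forall x y H, root_space a x -> root_space (- a) y -> lie x y = vsval H ->
    d%:R * (w i0 H : k) = m%:~R * (a H : k).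
Proof.
pose I := [pred i | `[< exists m, w i = w i0 + a *~ m >]].
have [m mP] : {m : 'I_n -> int & forall i, i \in I -> w i = w i0 + a *~ (m i)}.
  apply: (choice (P := fun i m => i \in I -> w i = w i0 + a *~ m)) => i.
  have [/asboolP[m im]|iI] := boolP (i \in I); [by exists m|by exists 0].
have Ii0 : i0 \in I by apply/asboolP; exists 0; rewrite mulr0z addr0.
exists #|I|, (- \sum_(i in I) m i); split; first by apply/card_gt0P; exists i0.
move=> x y H ax ay xyH; have zero : \sum_(i in I) (w i H : k) = 0.
  transitivity (\sum_(i in I) adm (lie x y) i i).
    by apply: eq_bigr => i _; rewrite xyH adm_cartan eqxx.
  have swap u v b : root_space b u -> root_space (- b) v -> (b = a \/ b = - a) ->
      \sum_(i in I) (adm u *m adm v) i i =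
      \sum_(i in I) \sum_(j in I) adm u i j * adm v j i.
    move=> bu bv ba; apply: eq_bigr => i iI; rewrite mxE [RHS]big_mkcond.
    apply: eq_bigr => j _; case: ifPn => // jI.
    have [->|uij] := eqVneq (adm u i j) 0; first by rewrite mul0r.
    case/negP: jI; apply/asboolP; have wj := adm_weight bu uij.
    have wi := mP i iI; case: ba => ba.
      by exists (m i + 1); rewrite wj wi ba mulrzDr mulr1z addrCA [a + _]addrC.
    by exists (m i - 1); rewrite wj wi ba mulrzBr mulr1z addrCA [- a + _]addrC.
  have -> : \sum_(i in I) adm (lie x y) i i =
     \sum_(i in I) (adm y *m adm x) i i - \sum_(i in I) (adm x *m adm y) i i.
    by rewrite -sumrB; apply: eq_bigr => i _; rewrite adm_lie mxE; congr (_ + _); rewrite [LHS]mxE.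
  rewrite (swap y x (- a)) ?opprK //; last by right.
  rewrite (swap x y a) //; last by left.
  rewrite [X in _ - X]exchange_big /=; apply/eqP; rewrite subr_eq0; apply/eqP.
  by apply: eq_bigr => i _; apply: eq_bigr => j _; rewrite mulrC.
have evz i l : (w i0 + a *~ l) i = (w i0 i : k) + (a i : k) *~ l.
  rewrite add_lfunE; congr (_ + _); case: l => l; first by rewrite -!pmulrn wt_mulrn.
  by rewrite !NegzE !mulrNz opp_lfunE -!pmulrn wt_mulrn.
move: zero; under eq_bigr => i iI do rewrite mP // evz.
rewrite big_split /= sumr_const => /eqP; rewrite addr_eq0 => /eqP e0.
by rewrite mulr_natl e0 mulrzl mulrNz mulrz_sumr.
Qed.

Lemma commutator_cartan a x y : root_space a x -> root_space (- a) y ->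
  exists H : subvs_of h, lie x y = vsval H.
Proof.
move=> ax ay; have xy : lie x y \in h.
  by apply: root_space0; rewrite -(subrr a); apply: root_spaceD.
by exists (Sub (lie x y) xy).
Qed.

Lemma cartan_faithful (H : subvs_of h) : (forall i, w i H = 0 :> k) -> vsval H = 0.
Proof.
move=> H0; apply: center0 => x; rewrite lie_anti lie_basis big1 ?oppr0 // => i _.
by rewrite ew H0 scale0r scaler0.
Qed.

Definition brackets a : set g :=
  [set lie x y | x in @root_space _ _ h a & y in root_space (- a)].

(** The rational factor in [string_trace] does not depend on the bracket, so it persists on the
    span: every weight is a multiple of a there. If a vanishes on H, so do all weights, and H is
    central. *)
Lemma lspan_brackets_eq0 a (H : subvs_of h) :
  lspan (brackets a) (vsval H) -> (a H : k) = 0 -> vsval H = 0.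
Proof.
move=> spanH aH; apply: cartan_faithful => i.
have [d [m [d0 dm]]] := string_trace a i.
pose P z := exists2 H : subvs_of h, z = vsval H &
  d%:R * (w i H : k) = m%:~R * (a H : k).
have PP : lin_closed P.
  split; first by exists 0; rewrite ?linear0 ?mulr0.
  move=> c _ _ [H1 -> e1] [H2 -> e2]; exists (c *: H1 + H2).
    by rewrite linearP.
  rewrite !linearP /= /GRing.scale /= !mulrDr mulrCA e1 e2.
  by congr (_ + _); rewrite mulrCA.
have [_ [x ax [y ay <-]]|H' /val_inj HH'] := lspan_least PP _ spanH.
  have [H' xyH'] := commutator_cartan ax ay; exists H' => //; exact: dm xyH'.
by rewrite -HH' aH mulr0 => /eqP; rewrite mulf_eq0 natr_eq0 // eqn0Ngt d0 => /eqP.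
Qed.

(** As a(H) = 2, some single bracket [x, y] has a nonzero value under a. Rescaled to the value 2, it
    differs from H by an element of the span on which a vanishes, so it equals H by
    [lspan_brackets_eq0]. *)
Lemma coroot_commutator a (H : subvs_of h) : coroot a H ->
  exists x y, [/\ root_space a x, root_space (- a) y & lie x y = vsval H].
Proof.
move=> [spanH aH2]; have [s [sB HE]] := spanH.
have two0 : 2%:R != 0 :> k by rewrite natr_eq0.
have [x [y [H' [ax ay xyH' aH']]]] : exists x y (H' : subvs_of h),
    [/\ root_space a x, root_space (- a) y, lie x y = vsval H' & (a H' : k) != 0].
  apply: contrapT => no; move/eqP: two0; apply.
  pose P z := exists2 H : subvs_of h, z = vsval H & (a H : k) = 0.
  have PP : lin_closed P.
    split; first by exists 0; rewrite ?linear0.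
    move=> c _ _ [H1 -> e1] [H2 -> e2]; exists (c *: H1 + H2); rewrite linearP //=.
    by rewrite e1 e2 addr0 scaler0.
  have [_ [x ax [y ay <-]]|H' /val_inj HH' aH'] := lspan_least PP _ spanH.
    have [H' xyH'] := commutator_cartan ax ay; exists H' => //.
    by apply: contrapT => /eqP aH'; apply: no; exists x, y, H'.
  by rewrite -aH2 HH'.
pose t := 2%:R / (a H' : k).
exists (t *: x), y; split=> //; first by exact: (lin_closedZ _ (root_space_lin a)).
have txy : lie (t *: x) y = t *: vsval H'.
  by rewrite lie_anti lieZr lie_anti scalerN opprK xyH'.
apply/eqP; rewrite txy -subr_eq0 -linearZ -linearB; apply/eqP.
apply: (lspan_brackets_eq0 (a := a)).
  rewrite linearB linearZ /=; apply: (lin_closedB (lspan_lin _)) => //.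
  apply: (lin_closedZ _ (lspan_lin _)); apply: lspan_sub.
  by exists x => //; exists y.
by rewrite linearB linearZ /= aH2 /GRing.scale /= /t divfK // subrr.
Qed.

Lemma simple_pos_vector a x : a \in simple_roots td -> root_space a x -> pos_vector a x.
Proof.
move=> aS ax; split=> //; first exact: simple_roots_root aS.
exists (fun b => b == a : nat); rewrite (bigD1_seq a) //=; last first.
  exact/free_uniq/simple_roots_free.
by rewrite eqxx mulr1n big1 ?addr0 // => b /negbTE ->; rewrite mulr0n.
Qed.

(** This is the sl2 relation x y^(i+1) v = (i + 1)(l(H) - i) y^i v. As y acts nilpotently on v, the
    relation at the last nonzero y^i v reads l(H) = i in characteristic zero. *)
Lemma highest_weight_dominant (V : liemod g) (l : wt) :
  has_highest_weight V l -> dominant_integral l.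
Proof.
move=> [v [v0 nv lv]] a H aS aH; have [x [y [ax ay xyH]]] := coroot_commutator aH.
have [a0 _] := simple_roots_root aS; have [_ aH2] := aH.
pose u i := iter i (action V y) v.
have uw i : wvec (l + (- a) *+ i) (u i).
  elim: i => [|i IH]; first by rewrite mulr0n addr0.
  by rewrite mulrS addrCA; apply: wvec_act.
have xu i : action V x (u i.+1) = (i.+1%:R * ((l H : k) - i%:R)) *: u i.
  have xyu i' : action V x (u i'.+1) = ((l H : k) - i'%:R * 2%:R) *: u i'
      + action V y (action V x (u i')).
    rewrite /u iterS action_comm xyH uw; congr (_ *: _ + _).
    by rewrite add_lfunE wt_mulrn opp_lfunE aH2 mulNrn mulr_natl.
  elim: i => [|i IH]; rewrite xyu.
    have -> : action V x (u 0%N) = 0.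
      apply: nv; apply/nposP; apply: lspan_sub; exists a.
      exact: simple_pos_vector.
    by rewrite linear0 addr0 mul0r mul1r.
  rewrite IH linearZ /= -[action V y (u i)]/(u i.+1) -scalerDl; congr (_ *: _).
  ring.
have a0' : - a <> 0 by move=> /eqP; rewrite oppr_eq0 => /eqP.
have [i0 ui0] := string_nil char0 a0' uw.
have ex : exists i, u i == 0 by exists i0; apply/eqP.
have [[|i] /eqP ui imin] := ex_minnP ex; first by case: v0.
exists i; have := xu i; rewrite ui linear0 => /esym/eqP; rewrite scaler_eq0.
case/orP => [|/imin]; last by rewrite ltnn.
by rewrite mulf_eq0 natr_eq0 //= subr_eq0 => /eqP.
Qed.

Definition killing x y : k := \tr (adm x *m adm y).

Lemma killingC x y : killing x y = killing y x.
Proof. exact: mxtrace_mulC. Qed.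

Lemma killing_invariant x y z : killing (lie x y) z = killing x (lie y z).
Proof.
rewrite /killing !adm_lie mulmxBl mulmxBr !linearB /= -!mulmxA.
by rewrite mxtrace_mulC -!mulmxA.
Qed.

Lemma killing_lin y : lin_closed [set x | killing x y = 0].
Proof.
split=> [|c u v] /=; rewrite /killing.
  have -> : adm 0 = 0 by apply/matrixP => i j; rewrite !mxE lie_anti lie0r oppr0 linear0.
  by rewrite mul0mx linear0.
by rewrite adm_lin mulmxDl -scalemxAl linearP /= => -> ->; rewrite mulr0 addr0.
Qed.

Lemma killing_weight a b x y : root_space a x -> root_space b y -> a + b <> 0 ->
  killing x y = 0.
Proof.
move=> ax yb ab; rewrite /killing /mxtrace big1 // => i _; rewrite mxE big1 // => j _.
have [->|xij] := eqVneq (adm x i j) 0; first by rewrite mul0r.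
have [->|yji] := eqVneq (adm y j i) 0; first by rewrite mulr0.
case: ab; apply: (addIr (w i)); rewrite add0r [in RHS](adm_weight yb yji).
by rewrite (adm_weight ax xij) addrCA addrA.
Qed.

Lemma killing_cartan (H : subvs_of h) :
  killing (vsval H) (vsval H) = \sum_i (w i H : k) ^+ 2.
Proof.
apply: eq_bigr => i _; rewrite mxE (bigD1 i) //= big1 ?addr0 => [|j ji].
  by rewrite adm_cartan eqxx mulr1n expr2.
by rewrite adm_cartan eq_sym (negbTE ji) mul0r.
Qed.

Definition killing_radical : set g := [set z | forall y, killing z y = 0].
Local Notation J := killing_radical.

Lemma radical_lin : lin_closed J.
Proof.
split=> [y|c u v hu hv y]; first by case: (killing_lin y).
by have [_ ] := killing_lin y; apply; [exact: hu|exact: hv].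
Qed.

Lemma radical_ideal x z : J z -> J (lie x z).
Proof.
move=> Jz y; rewrite lie_anti.
have := (killing_lin y).2 (-1) (lie z x) 0; rewrite scaleN1r addr0; apply.
  by rewrite /= killing_invariant Jz.
by have [] := killing_lin y.
Qed.

(* On [g_a, g_-a] all weights are rational multiples of a, so that the Killing
   form is a(H)^2 times a positive rational number. *)
Lemma radical_commutator a x y : J x -> root_space a x -> root_space (- a) y ->
  lie x y = 0.
Proof.
move=> Jx ax ay; have [->|/eqP x0] := eqVneq x 0; first by rewrite lie_anti lie0r oppr0.
have [H xyH] := commutator_cartan ax ay; rewrite xyH.
apply: (lspan_brackets_eq0 (a := a)).
  by apply: lspan_sub; exists x => //; exists y.
apply: contrapT => /eqP aH.
have [i0 wi0] := root_space_weight ax x0.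
have [d dP] : {d : 'I_n -> nat * int & forall i, (0 < (d i).1)%N /\
    (d i).1%:R * (w i H : k) = (d i).2%:~R * (a H : k)}.
  apply: (choice (P := fun i (d : nat * int) => (0 < d.1)%N /\
    d.1%:R * (w i H : k) = d.2%:~R * (a H : k))) => i.
  by have [d [m [d0 dm]]] := string_trace a i; exists (d, m); split=> //; apply: dm xyH.
(* D clears the denominators of all the ratios of [w i] to a on H. The numerators [M i] are taken in
   absolute value, as only their squares occur; the sum of these squares is zero, although the one
   for w i0 = a is not. *)
pose D := (\prod_i (d i).1)%N.
pose M i := (`|(d i).2| * \prod_(j | j != i) (d j).1)%N.
have D0 : (0 < D)%N by apply: prodn_gt0 => i; case: (dP i).
have DM i : (D%:R * (w i H : k)) ^+ 2 = (M i ^ 2)%:R * (a H : k) ^+ 2.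
  rewrite /D (bigD1 i) //= natrM mulrAC (dP i).2 mulrAC exprMn; congr (_ * _).
  rewrite /M natrX natrM !exprMn; congr (_ * _).
  by case: (d i).2 => j //; rewrite NegzE mulrNz sqrrN abszN.
have J0 : killing (vsval H) (vsval H) = 0.
  have JH : J (vsval H).
    by rewrite -xyH lie_anti; apply: (lin_closedN radical_lin); exact: radical_ideal.
  exact: JH.
have : (\sum_i M i ^ 2)%N = 0%N.
  apply/eqP; rewrite -(natr_eq0 char0) natr_sum; have : (a H : k) ^+ 2 != 0 by rewrite expf_neq0.
  move/mulIf => inj; apply/eqP/inj; rewrite mul0r mulr_suml.
  under eq_bigr => i _ do rewrite -DM exprMn.
  by rewrite -mulr_sumr -killing_cartan J0 mulr0.
move/eqP; rewrite sum_nat_eq0 => /forallP/(_ i0); rewrite /= expn_eq0 andbT => /eqP Mi0.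
have := DM i0; rewrite Mi0 mul0r => /eqP; rewrite expf_eq0 /= mulf_eq0 natr_eq0 //.
by rewrite eqn0Ngt D0 wi0 (negbTE aH).
Qed.

Definition component b z := \sum_(i | w i == b) co i z *: e`_i.
Local Notation ws := (undup (codom w)).

Lemma component_weight b z : root_space b (component b z).
Proof.
apply: lin_closed_sum; first exact: root_space_lin.
by move=> i /eqP <-; apply: (lin_closedZ _ (root_space_lin (w i))).
Qed.

Lemma componentE z : z = \sum_(b <- ws) component b z.
Proof.
rewrite [LHS]coE (exchange_big_dep xpredT) //=; apply: eq_bigr => i _.
rewrite big_mkcond (bigD1_seq (w i)) ?undup_uniq ?mem_undup ?codom_f //= eqxx.
by rewrite big1 ?addr0 // => b; rewrite eq_sym => /negbTE ->.
Qed.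

Lemma co_component b z i : co i (component b z) = if w i == b then co i z else 0.
Proof.
rewrite linear_sum /=; case: ifPn => wi.
  rewrite (bigD1 i) //= linearZ /= co_e eqxx mulr1 big1 ?addr0 // => j /andP[_ ji].
  by rewrite linearZ /= co_e (negbTE ji) mulr0.
rewrite big1 // => j /eqP wj; rewrite linearZ /= co_e; case: eqP => [ji|]; rewrite ?mulr0 //.
by rewrite -ji wj eqxx in wi.
Qed.

Lemma killing_linear y : linear (fun z => killing z y : k^o).
Proof. by move=> c u v; rewrite /killing adm_lin mulmxDl -scalemxAl linearP. Qed.

Lemma killing_basis z y : killing z y = \sum_i co i z * killing e`_i y.
Proof.
pose F : {linear g -> k^o} := HB.pack (fun z => killing z y : k^o)
  (GRing.isLinear.Build k g k^o _ (fun z => killing z y : k^o)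
    (killing_linear y)).
rewrite -[LHS]/(F _) {1}[z]coE linear_sum; apply: eq_bigr => i _.
by rewrite linearZ.
Qed.

(** The Killing form pairs weight b only with -b: against [e_j] the component of z gives either zero
    or what z gives. *)
Lemma radical_component b z : J z -> J (component b z).
Proof.
move=> Jz y; rewrite killingC killing_basis big1 // => j _; rewrite killingC.
suff -> : killing (component b z) e`_j = 0 by rewrite mulr0.
have [bj|/eqP bj] := eqVneq (b + w j) 0; last first.
  exact: killing_weight (component_weight _ _) (ew j) bj.
rewrite -[RHS](Jz e`_j) killing_basis [RHS]killing_basis; apply: eq_bigr => i _.
rewrite co_component; case: ifPn => // wib; rewrite mul0r.
rewrite (killing_weight (ew i) (ew j)) ?mulr0 // => wij.
by case/eqP: wib; apply: (addIr (w j)); rewrite wij bj.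
Qed.

(** Elements of the Killing radical without component of weight 0. Its weight vectors have nonzero
    weight and are ad-nilpotent, which prepares for Engel's theorem. *)
Definition nil_part : set g := [set z | J z /\ forall i, w i = 0 -> co i z = 0].
Local Notation N := nil_part.

Lemma nil_part_lin : lin_closed N.
Proof.
split=> [|c u v [Ju u0] [Jv v0]].
  by split=> [|i _]; [case: radical_lin|rewrite linear0].
split=> [|i wi]; first by case: radical_lin => _; apply.
by rewrite linearP /= u0 // v0 // mulr0 addr0.
Qed.

Lemma nil_part_component b z : N z -> N (component b z).
Proof.
move=> [Jz z0]; split=> [|i wi]; first exact: radical_component.
by rewrite co_component; case: ifP => // _; apply: z0.
Qed.

(** A weight 0 component of [x, z] could only come from opposite weights, and such brackets vanish
    by [radical_commutator]. *)
Lemma nil_part_ideal x z : N z -> N (lie x z).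
Proof.
move=> Nz; have [Jz z0] := Nz; split=> [|i wi]; first exact: radical_ideal.
rewrite [z]componentE big_seq -adjointE linear_sum /= linear_sum big1 //= => b _.
rewrite adjointE lie_anti lie_basis linearN linear_sum big1 ?oppr0 //= => j _.
rewrite linearZ /=; have [bj|bj] := eqVneq (b + w j) 0.
  rewrite (radical_commutator (radical_component b Jz) (component_weight b z)).
    by rewrite linear0 mulr0.
  by have -> : - b = w j; [apply/eqP; rewrite eq_sym -addr_eq0 addrC bj|exact: ew].
have [->|c0] := eqVneq (co i (lie (component b z) e`_j)) 0; first by rewrite mulr0.
case/eqP: bj; rewrite -wi.
by rewrite (co_weight (root_spaceD (component_weight b z) (ew j)) c0).
Qed.

Lemma nil_part_weight a z : N z -> root_space a z -> z <> 0 -> a <> 0.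
Proof.
move=> [_ z0] az zn0 a0; apply: zn0; rewrite [z]coE big1 // => i _.
have [->|ci] := eqVneq (co i z) 0; first by rewrite scale0r.
by rewrite z0 ?scale0r // (co_weight az ci).
Qed.

(* Engel's theorem for the set of weight vectors of N, which act nilpotently
   and are stable under brackets. *)
Lemma nil_part_center : (exists2 z, N z & z <> 0) ->
  exists2 z, N z /\ z <> 0 & forall x, N x -> lie x z = 0.
Proof.
move=> Nn0.
(* Engel's conclusion for M acting on N modulo an M-stable subspace U. The vector found has a pure
   weight, which makes [string_nil] applicable when M grows. *)
pose nilp (M : set g) := forall U : set g, lin_closed U ->
  (forall x y, M x -> U y -> U (lie x y)) -> (exists2 z, N z & ~ U z) ->
  exists a v, [/\ root_space a v, N v, ~ U v & forall x, M x -> U (lie x v)].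
pose good m := `[< exists M : {vspace g}, [/\ \dim M = m,
  forall x, x \in M -> N x, forall x y, x \in M -> y \in M -> lie x y \in M
  & nilp [set` M]] >].
have ex : exists m, good m.
  exists 0%N; apply/asboolP; exists 0%VS; split; first by rewrite dimv0.
  - by move=> x; rewrite memv0 => /eqP ->; case: nil_part_lin.
  - by move=> x y _; rewrite memv0 => /eqP ->; rewrite lie0r mem0v.
  - move=> U UL _ [z Nz Uz].
    have [b Ub] : exists b, ~ U (component b z).
      apply: contrapT => no; apply: Uz; rewrite [z]componentE; apply: lin_closed_sum => //.
      by move=> b _; apply: contrapT => Ub; apply: no; exists b.
    exists b, (component b z); split=> //; first exact: component_weight.
      exact: nil_part_component.
    by move=> x /=; rewrite memv0 => /eqP ->; rewrite lie_anti lie0r oppr0; case: UL.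
have ub m : good m -> (m <= \dim {:g})%N.
  by move=> /asboolP[M [<- _ _ _]]; apply/dimvS/subvf.
have [m /asboolP[M [dM MN Malg Mnil]] mmax] := ex_maxnP ex ub.
have NM z : N z -> z \in M.
  move=> Nz; apply: contrapT => zM.
  have ML : lin_closed [set` M].
    by split=> [|c u v uM vM] /=; rewrite ?mem0v // memvD ?memvZ.
  (* Taking U = M gives a weight vector x of N outside M that normalises M, so M can be enlarged by
     x. *)
  have [a [x [ax Nx xM Mx]]] := Mnil _ ML Malg (ex_intro2 _ _ z Nz zM).
  have x0 : x <> 0 by move=> x0; apply: xM; rewrite x0 /= mem0v.
  have a0 := nil_part_weight Nx ax x0.
  suff : good (\dim (M + <[x]>)%VS).
    move/mmax; apply/negP; rewrite -ltnNge -dM.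
    have [le eq] := dimv_leqif_sup (addvSl M <[x]>%VS).
    rewrite ltn_neqAle le eq andbT subv_add subvv /= -memvE; exact/negP.
  have decomp y : y \in (M + <[x]>)%VS -> exists2 u, u \in M & exists c, y = u + c *: x.
    by move=> /memv_addP[u uM [_ /vlineP[c ->] ->]]; exists u => //; exists c.
  have lx0 : lie x x = 0 by exact: liexx.
  apply/asboolP; exists (M + <[x]>)%VS; split=> //.
  - move=> _ /decomp[u /MN Nu [c ->]]; apply: (lin_closedD nil_part_lin) => //.
    exact: (lin_closedZ _ nil_part_lin).
  - move=> _ _ /decomp[u uM [c ->]] /decomp[v vM [d ->]].
    rewrite lieDr !lieDl lieZr [lie (c *: x) v]lie_anti [lie (c *: x) (d *: x)]lie_anti.
    rewrite !lieZr [lie (d *: x) x]lie_anti lieZr lx0 scaler0 oppr0 scaler0 oppr0 addr0.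
    apply: (subvP (addvSl M <[x]>%VS)); apply: memvD; last by apply/memvZ/Mx.
    by apply: memvB; [exact: Malg|apply/memvZ/Mx].
  - move=> U UL Ust Uz.
    have [|b [v0 [bv0 Nv0 Uv0 Mv0]]] := Mnil U UL _ Uz.
      by move=> y u yM Uu; apply: Ust => //=; exact: (subvP (addvSl M <[x]>%VS) _ yM).
    (* The string (ad x)^i v0 stays in N, is sent into U by M, and reaches zero because a <> 0. The
       term just before it first enters U is sent into U by x as well. *)
    pose u i := iter i (lie x) v0.
    have xM' : x \in (M + <[x]>)%VS by exact: (subvP (addvSr M <[x]>%VS) _ (memv_line x)).
    have uP i : N (u i) /\ forall y, y \in M -> U (lie y (u i)).
      elim: i => [//|i [IH1 IH2]]; split; first exact: nil_part_ideal.
      move=> y yM; have -> : lie y (u i.+1) = lie (lie y x) (u i) + lie x (lie y (u i)).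
        by rewrite jacobi_comm subrK.
      by apply: lin_closedD => //; [exact/IH2/Mx|apply: Ust => //; exact: IH2].
    have uw i : wvec (V := adjoint g) (b + a *+ i) (u i).
      elim: i => [|i IH]; first by rewrite mulr0n addr0; exact/wvec_root_space.
      by rewrite mulrS addrCA /u iterS -adjointE; apply: wvec_act.
    have [i0 ui0] := string_nil char0 a0 uw.
    have exi : exists i, `[< U (u i) >].
      by exists i0; apply/asboolP; rewrite ui0; case: UL.
    have [[|i] /asboolP Ui imin] := ex_minnP exi; first by [].
    have [Nui Mui] := uP i.
    exists (b + a *+ i), (u i); split=> //; first exact/wvec_root_space.
      by move=> Uui; have := imin i; rewrite ltnn => /(_ (asboolT Uui)).
    move=> _ /decomp[y yM [c ->]]; rewrite lieDl; apply: lin_closedD => //.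
      exact: Mui.
    rewrite lie_anti lieZr lie_anti scalerN opprK; exact: lin_closedZ.
have [|||a [z [_ Nz z0 Mz]]] := Mnil [set 0].
- by split=> // c _ _ -> ->; rewrite scaler0 addr0.
- by move=> x _ _ ->; rewrite /= lie0r.
- by have [z Nz z0] := Nn0; exists z.
by exists z => // x /NM/Mz.
Qed.

(** Were [nil_part] nonzero, its center would be a nonzero abelian ideal of g, against
    semisimplicity. *)
Lemma nil_part0 z : N z -> z = 0.
Proof.
move=> Nz; apply: contrapT => z0.
have [u [Nu u0] uc] := nil_part_center (ex_intro2 _ _ z Nz z0).
apply: u0; apply: (abelian_ideal0 (P := [set u | N u /\ forall x, N x -> lie x u = 0])) => //.
- split; first by split; [case: nil_part_lin|move=> x _; exact: lie0r].
  move=> c v v' [Nv vc] [Nv' vc']; split; first by case: nil_part_lin => _; apply.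
  by move=> x Nx; rewrite lie_linearr vc // vc' // scaler0 addr0.
- move=> x y [Ny yc]; split; first exact: nil_part_ideal.
  move=> v Nv; have := jacobi_comm v x y; rewrite (yc _ Nv) lie0r subr0 => <-.
  by apply: yc; rewrite lie_anti; apply: (lin_closedN nil_part_lin); exact: nil_part_ideal.
- by move=> x y [Nx _] [_ yc]; apply: yc.
Qed.

(** With [nil_part] zero, the radical lies in weight 0, that is in h. Its brackets with root vectors
    lie in the radical and have no weight 0 component, so they vanish too, and the radical is
    central. *)
Lemma radical0 z : J z -> z = 0.
Proof.
move=> Jz; have z0 : root_space (0 : wt) z.
  have -> : z = component 0 z; last exact: component_weight.
  rewrite {1}[z]componentE; have [w0|w0] := boolP (0 \in ws).
    rewrite (bigD1_seq 0) ?undup_uniq //= big1 ?addr0 // => b b0.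
    apply: nil_part0; split=> [|i wi]; first exact: radical_component.
    by rewrite co_component wi eq_sym (negbTE b0).
  rewrite big_seq big1 => [|b bw].
    apply/esym/big1 => i /eqP wi; move: w0.
    by rewrite mem_undup -wi codom_f.
  apply: nil_part0; split=> [|i wi]; first exact: radical_component.
  rewrite co_component wi; case: eqP => // b0; move: w0.
  by rewrite b0 bw.
apply: center0 => x; rewrite lie_anti lie_basis big1 ?oppr0 // => j _.
have [wj|wj] := eqVneq (w j) 0.
  by rewrite (cartan_abelian (root_space0 z0) (eh wj)) scaler0.
have -> : lie z e`_j = 0; last by rewrite scaler0.
apply: nil_part0; split.
  by rewrite lie_anti; apply: (lin_closedN radical_lin); exact: radical_ideal.
move=> i wi; apply/eqP; apply: contrapT => /negP ci.
have := co_weight (root_spaceD z0 (ew j)) ci; rewrite add0r wi => wj0.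
by rewrite -wj0 eqxx in wj.
Qed.

(** If [g, g] were smaller, a dimension count would give u <> 0 orthogonal to it. By invariance
    every [u, x] then lies in the radical, which is zero, and u would be central. *)
Lemma perfect_of_basis z : lspan [set lie x y | x in setT & y in setT] z.
Proof.
have [D DP] := vspace_of_set (lspan_lin (V := g) [set lie x y | x in setT & y in setT]).
apply/DP; apply: contrapT => zD.
have rowl : linear (fun z => \row_j killing z (vbasis D)`_j : 'rV[k]_(\dim D)).
  by move=> c u v; apply/rowP => j; rewrite !mxE; exact: killing_linear.
pose K := linfun (HB.pack_for {linear g -> 'rV[k]_(\dim D)}
  (fun z => \row_j killing z (vbasis D)`_j)
  (GRing.isLinear.Build _ _ _ _ (fun z => \row_j killing z (vbasis D)`_j) rowl)).
have : lker K != 0%VS.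
  rewrite -dimv_eq0 -lt0n.
  have /eqP := limg_ker_dim K {:g}; rewrite capfv => /eqP dimE.
  have : (\dim (limg K) <= \dim D)%N.
    by apply: leq_trans (dimvS (subvf _)) _; rewrite dimvf /dim /= mul1n.
  have : (\dim D < \dim {:g})%N.
    have [le eq] := dimv_leqif_sup (subvf D).
    rewrite ltn_neqAle le eq andbT; apply/negP => /subvP/(_ z (memvf z)); exact: zD.
  by rewrite -dimE; case: (\dim (lker K)) => // h1 h2; rewrite add0n ltnNge h2 in h1.
rewrite -vpick0 => /eqP; set u := vpick _ => u0; apply: u0.
have uK : u \in lker K by exact: memv_pick.
have uD y : y \in D -> killing u y = 0.
  move=> /coord_vbasis ->; apply: (lin_closed_sum (P := [set y | killing u y = 0])).
    split=> [|c v v' ev ev'] /=; rewrite killingC; first by case: (killing_lin u).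
    by case: (killing_lin u) => _; apply; rewrite /= killingC.
  move=> j _ /=; rewrite killingC; apply: (lin_closedZ _ (killing_lin u)).
  rewrite /= killingC; move: uK; rewrite memv_ker lfunE /= => /eqP/rowP/(_ j).
  by rewrite !mxE.
apply: center0 => x; apply: radical0 => y; rewrite lie_anti.
apply: (lin_closedN (killing_lin y)) => /=.
rewrite killing_invariant; apply: uD; apply/DP; apply: lspan_sub.
by exists x => //; exists y.
Qed.

End Structure.

Lemma semisimple_perfect (k : fieldType) (g : finLieAlgType k)
    (td : triangular_decomposition g) : [pchar k] =i pred0 -> semisimple g ->
  forall z : g, lspan [set lie x y | x in setT & y in setT] z.
Proof.
move=> char0 ss; have [n [e [w [eb ew eh]]]] := exists_weight_basis td.
exact: (perfect_of_basis char0 ss eb ew eh).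
Qed.

Lemma dominant_of_highest_weight (k : fieldType) (g : finLieAlgType k)
    (td : triangular_decomposition g) (V : liemod g) (l : weight td) :
  [pchar k] =i pred0 -> semisimple g -> has_highest_weight V l -> dominant_integral l.
Proof.
move=> char0 ss; have [n [e [w [eb ew eh]]]] := exists_weight_basis td.
exact: (highest_weight_dominant char0 ss eb ew eh).
Qed.

(** * The action on weights and points *)

Section WeightAction.
Variables (gT : finGroupType) (k : closedFieldType) (g : finLieAlgType k).
Variable td : triangular_decomposition g.
Variable ag : lie_action gT g.
Hypothesis char0 : [pchar k] =i pred0.
Implicit Types (V W : liemod g) (l m : weight td) (c d : gT).

Lemma lie_actK c a : ag c (ag c^-1%g a) = a.
Proof. by rewrite -lie_actM mulgV lie_act1. Qed.

Lemma pull_act_irreducible V c : irreducible V -> irreducible (pull (ag c) V).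
Proof.
case=> V0 irr; split=> // U Usub; apply: irr => a u uU.
by rewrite -[a](lie_actK c); exact: (Usub (ag c^-1%g a)).
Qed.

(** The module picked by [xget] may differ from V, but [highest_weight_pull] transfers its twisted
    highest weight to V; [exists_highest_weight] ensures that the default is not taken. *)
Lemma weight_act_pull V l c : irreducible_of_weight V l ->
  irreducible_of_weight (pull (ag c^-1%g) V) (weight_act ag c l).
Proof.
move=> Vl; have [irrV _] := Vl; split; first exact: pull_act_irreducible.
have [m hm] : exists m : weight td, has_highest_weight (pull (ag c^-1%g) V) m.
  by apply: exists_highest_weight => //; exact: (irreducible_neq0 irrV).
rewrite /weight_act; case: xgetP => [w _ [W Wl hw]|no].
  exact: (highest_weight_pull char0 Wl Vl hw).
by case: (no m); exists V.
Qed.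

Lemma weight_act_default l c : ~ (exists V, irreducible_of_weight V l) ->
  weight_act ag c l = l.
Proof. by move=> no; rewrite /weight_act; case: xgetP => // w _ [V Vl _]; case: no; exists V. Qed.

Lemma weight_act_eq V l m c : irreducible_of_weight V l ->
  has_highest_weight (pull (ag c^-1%g) V) m -> weight_act ag c l = m.
Proof.
by move=> /(weight_act_pull c)[irr hc] hm; exact: (highest_weight_uniq char0 irr hc hm).
Qed.

Lemma weight_act1 l : weight_act ag 1%g l = l.
Proof.
have [[V Vl]|] := pselect (exists V, irreducible_of_weight V l); last first.
  exact: weight_act_default.
apply: (weight_act_eq Vl); have [_ [v [v0 nv lv]]] := Vl; exists v; split=> //.
  by move=> x xn /=; rewrite invg1 lie_act1 nv.
by move=> H /=; rewrite invg1 lie_act1 lv.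
Qed.

(* No existence theorem for irreducible modules is needed: every c fixes the
   weights that are not the highest weight of an irreducible module. *)
Lemma weight_actM c d l : weight_act ag (c * d)%g l = weight_act ag c (weight_act ag d l).
Proof.
have [[V Vl]|no] := pselect (exists V, irreducible_of_weight V l); last first.
  by rewrite (weight_act_default d no) !weight_act_default.
have [_ [v [v0 nv lv]]] := weight_act_pull c (weight_act_pull d Vl).
apply: (weight_act_eq Vl); exists v; split=> // [x xn|H] /=; rewrite invMg lie_actM.
  exact: nv.
exact: lv.
Qed.

Lemma weight_actK c : cancel (@weight_act gT k g ag td c^-1%g) (weight_act ag c).
Proof. by move=> l; rewrite -weight_actM mulgV weight_act1. Qed.

Lemma trivial_irreducible : irreducible (LieMod (trivial_rep g k^o)).
Proof.
have full1 : \dim (fullv : {vspace k^o}) = 1%N by rewrite dimvf.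
split=> [/(congr1 (fun U => \dim U))|U _]; first by rewrite full1 dimv0.
have [->|U0] := eqVneq U 0%VS; [by left|right].
by apply/eqP; rewrite -(dimv_leqif_eq (subvf U)) full1 eqn_leq lt0n dimv_eq0 U0 andbT
  -full1 dimvS ?subvf.
Qed.

Lemma weight_act0 c : weight_act ag c (0 : weight td) = 0.
Proof.
have triv0 (f : lie_hom g g) : has_highest_weight (td := td)
    (pull f (LieMod (trivial_rep g k^o))) 0.
  exists (1 : k^o); split=> [|x _|H]; first exact/eqP/oner_neq0.
    by rewrite /= zero_lfunE.
  by rewrite /= !zero_lfunE scale0r.
apply: (weight_act_eq (V := LieMod (trivial_rep g k^o))); last exact: triv0.
split; first exact: trivial_irreducible.
by have [v [v0 nv lv]] := triv0 (ag 1%g); exists v; split.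
Qed.

(** The new weight is a highest weight of a finite-dimensional module, so the sl2 argument applies
    to it; a weight that belongs to no irreducible module is fixed. *)
Lemma weight_act_dominant l c : semisimple g -> dominant_integral l ->
  dominant_integral (weight_act ag c l).
Proof.
move=> ss dl; have [[V Vl]|no] := pselect (exists V, irreducible_of_weight V l).
  by have [_] := weight_act_pull c Vl; exact: dominant_of_highest_weight.
by rewrite weight_act_default.
Qed.

End WeightAction.

Section PointAction.
Variables (gT : finGroupType) (k : fieldType) (g : finLieAlgType k) (A : comAlgType k).
Variables (aA : alg_action gT A) (ag : lie_action gT g).
Local Notation X := (ratpt A).
Local Notation gA := (gtensor g A).
Implicit Types (x y : X) (c d : gT) (S : set X).

Lemma pt_actE c x f : pt_act aA c x f = x (aA c^-1%g f).
Proof. by []. Qed.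

Lemma pt_act1 x : pt_act aA 1%g x = x.
Proof. by apply: ratptP => f; rewrite pt_actE invg1 alg_act1. Qed.

Lemma pt_actM c d x : pt_act aA (c * d)%g x = pt_act aA c (pt_act aA d x).
Proof. by apply: ratptP => f; rewrite !pt_actE invMg alg_actM. Qed.

Lemma pt_actK c : cancel (pt_act aA c) (pt_act aA c^-1%g).
Proof. by move=> x; rewrite -pt_actM mulVg pt_act1. Qed.

Lemma pt_actKV c : cancel (pt_act aA c^-1%g) (pt_act aA c).
Proof. by move=> x; rewrite -pt_actM mulgV pt_act1. Qed.

Lemma Xstar_eq S c d x y : acts_freely aA -> in_Xstar aA S -> S x -> S y ->
  pt_act aA c x = pt_act aA d y -> c = d /\ x = y.
Proof.
move=> free [_ disj] Sx Sy e; have xy : x = y.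
  apply: contrapT => xy; have := disj _ _ Sx Sy xy.
  by move/seteqP => [/(_ (pt_act aA c x)) h _]; apply: h; split;
    [exists c|rewrite e; exists d].
split=> //; move: e; rewrite xy => /(congr1 (pt_act aA d^-1%g)).
rewrite pt_actK -pt_actM => /free /(congr1 (mulg d)).
by rewrite mulKVg mulg1.
Qed.

Lemma ev_at_tens x (a : g) f : ev_at x (tens a f) = (x f : k) *: a.
Proof.
apply: (tlift_tens (phi := fun a f => (x f : k) *: a)); split=> [b|f'] c u v /=.
  by rewrite linearP scalerDl scalerA.
by rewrite scalerDr !scalerA mulrC.
Qed.

Lemma ev_at_linear x : linear (ev_at x : gA -> g).
Proof.
apply: (tlift_linear (phi := fun a f => (x f : k) *: a)) => a c u v.
by rewrite linearP scalerDl scalerA.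
Qed.

Lemma ev_at_act c x (t : gA) :
  ev_at (pt_act aA c x) (tens_act aA ag c t) = ag c (ev_at x t).
Proof.
have D y s s' : ev_at y (s + s') = ev_at y s + ev_at y s' :> g.
  by have := ev_at_linear y 1 s s'; rewrite !scale1r.
have E0 y : ev_at y (0 : gA) = 0 by apply: (addrI (ev_at y 0)); rewrite -D !addr0.
elim/gtensor_ind: t => [|s t IHs IHt|a f].
- by rewrite tens_act0 !E0 linear0.
- by rewrite tens_actD !D linearD IHs IHt.
by rewrite tens_actE !ev_at_tens linearZ pt_actE -alg_actM mulVg alg_act1.
Qed.

Lemma ev_at_fixed c x (t : fixed_alg aA ag) :
  ev_at (pt_act aA c x) (fixed_val t) = ag c (ev_at x (fixed_val t)).
Proof. by rewrite -ev_at_act (fixedP _ _ _ (fixed_valP t)). Qed.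

End PointAction.

(** * Ideals with finite support *)

Section Ideals.
Variables (k : fieldType) (A : comAlgType k).
Local Notation X := (ratpt A).
Implicit Types (I J : set A) (S : set X) (f : A).

Lemma ideal_lin I : ideal I -> lin_closed I.
Proof.
by case=> I0 ID IM; split=> // c u v Iu Iv; rewrite -mulr_algl; apply: ID => //; apply: IM.
Qed.

Lemma ideal_setT : ideal (setT : set A). Proof. by []. Qed.

Lemma ideal_mul_least I J (P : set A) : lin_closed P ->
  (forall f f', I f -> J f' -> P (f * f')) -> ideal_mul I J `<=` P.
Proof. by move=> PP h; apply: lspan_least => // _ [f If [f' Jf' <-]]; apply: h. Qed.

Lemma ideal_mul_mem I J f f' : I f -> J f' -> ideal_mul I J (f * f').
Proof. by move=> If Jf'; apply: lspan_sub; exists f => //; exists f'. Qed.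

Lemma lin_closed_mulr (P : set A) f : lin_closed P -> lin_closed (fun f' => P (f * f')).
Proof.
by case=> P0 PP; split=> [|c u v Pu Pv]; rewrite ?mulr0 // mulrDr -scalerAr; apply: PP.
Qed.

Lemma lin_closed_mull (P : set A) f : lin_closed P -> lin_closed (fun f' => P (f' * f)).
Proof.
by case=> P0 PP; split=> [|c u v Pu Pv]; rewrite ?mul0r // mulrDl -scalerAl; apply: PP.
Qed.

Lemma ideal_mul_ideal I J : ideal J -> ideal (ideal_mul I J).
Proof.
move=> [_ _ JM]; have L : lin_closed (ideal_mul I J) := lspan_lin _.
split=> [|a b|a]; [by case: L|exact: lin_closedD|].
apply: ideal_mul_least; first exact: lin_closed_mulr.
by move=> f f' If Jf'; rewrite mulrCA; apply: ideal_mul_mem => //; apply: JM.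
Qed.

Lemma ideal_pow_ideal I n : ideal (ideal_pow I n).
Proof. by elim: n => [|n IH]; [exact: ideal_setT|exact: ideal_mul_ideal]. Qed.

Lemma ideal_pow_mem I f n : I f -> ideal_pow I n (f ^+ n).
Proof.
by move=> If; elim: n => [//|n IH]; rewrite exprS; apply: ideal_mul_mem.
Qed.

Lemma ideal_pow_mul I J K n : (forall f f', I f -> J f' -> K (f * f')) ->
  forall f f', ideal_pow I n f -> ideal_pow J n f' -> ideal_pow K n (f * f').
Proof.
move=> h; elim: n => [//|n IH] f f' If; have L := ideal_lin (ideal_pow_ideal K n.+1).
move: f'; apply: ideal_mul_least; first exact: lin_closed_mulr.
move=> v q Jv Jq; move: f If; apply: ideal_mul_least; first exact: lin_closed_mull.
by move=> u p Iu Ip; rewrite mulrACA; apply: ideal_mul_mem; [apply: h|apply: IH].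
Qed.

Definition vanishing S : set A := [set f | forall x, S x -> x f = 0].

Lemma vanishing_ideal S : ideal (vanishing S).
Proof.
split=> [x _|f f' hf hf' x Sx|f f' hf x Sx]; first by rewrite rmorph0.
  by rewrite rmorphD /= hf // hf' // addr0.
by rewrite rmorphM /= hf // mulr0.
Qed.

Lemma big_ideal_ideal (s : seq X) (F : X -> set A) :
  (forall x, ideal (F x)) -> ideal (\big[@ideal_mul k A/setT]_(x <- s) F x).
Proof.
move=> FI; elim: s => [|x s IH]; first by rewrite big_nil; exact: ideal_setT.
by rewrite big_cons; apply: ideal_mul_ideal.
Qed.

(** The radical of J contains the ideal of S. This is what [ideal_of eta] and [vanishing S] have in
    common, and it passes to intersections. *)
Definition primary S J := ideal J /\ forall f, vanishing S f -> exists n, J (f ^+ n).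

Lemma primaryI S I J : primary S I -> primary S J -> primary S (I `&` J).
Proof.
move=> [II Ip] [JJ Jp]; split.
  have [I0 ID IM] := II; have [J0 JD JM] := JJ.
  split=> [//|a b [Ia Ja] [Ib Jb]|a b [Ib Jb]]; first by split; [apply: ID|apply: JD].
  by split; [apply: IM|apply: JM].
move=> f fS; have [n In] := Ip f fS; have [m Jm] := Jp f fS; exists (n + m)%N.
by rewrite exprD; split; [apply: ideal_mulr|case: JJ => _ _; apply].
Qed.

Lemma primary_vanishing S : primary S (vanishing S).
Proof. by split; [exact: vanishing_ideal|move=> f fS; exists 1%N; rewrite expr1]. Qed.

Lemma ideal_of_primary S (eta : X -> nat) : finite_set (nat_supp eta) ->
  nat_supp eta `<=` S -> primary S (ideal_of eta).
Proof.
move=> fin sub; rewrite /ideal_of.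
set s := finite_support _ _ _; have sS x : x \in s -> S x.
  rewrite in_finite_support; last exact: sub_finite_set (@subIsetl _ _ _) fin.
  by rewrite inE => -[/sub].
split; first by apply: big_ideal_ideal => x; exact: ideal_pow_ideal.
move=> f fS; elim: s sS => [|x s IH] sS; first by exists 0%N; rewrite big_nil.
have [|n fn] := IH; first by move=> y ys; apply: sS; rewrite inE ys orbT.
exists (eta x + n)%N; rewrite big_cons exprD; apply: ideal_mul_mem => //.
by apply: ideal_pow_mem; apply: fS; apply: sS; rewrite mem_head.
Qed.

Lemma finite_pt (S : set X) : finite_set S -> exists s : seq X, forall x, x \in s <-> S x.
Proof. by move=> /finite_seqP[s ->]; exists s. Qed.

Lemma ideal_of_const S m : (0 < m)%N -> finite_set S ->
  let eta x := if `[< S x >] then m else 0%N in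
  [/\ finite_set (nat_supp eta), nat_supp eta `<=` S
    & ideal_of eta `<=` ideal_pow (vanishing S) m].
Proof.
move=> m0 fin eta; have sub : nat_supp eta `<=` S.
  by move=> x; rewrite /nat_supp /= /eta; case: asboolP.
have fin' : finite_set (nat_supp eta) by exact: sub_finite_set sub fin.
split=> //; rewrite /ideal_of; set s := finite_support _ _ _.
have sS x : S x -> x \in s.
  move=> Sx; rewrite in_finite_support; last exact: sub_finite_set (@subIsetl _ _ _) fin'.
  have ex : eta x = m by rewrite /eta asboolT.
  rewrite inE; split; first by rewrite /nat_supp /= ex; apply/eqP; rewrite -lt0n.
  (* A factor equal to the neutral [setT] would be left out of the product. The power of
     [max_ideal x] is not such a factor: as m > 0 it lies in [max_ideal x], which does not contain
     1. *)
  rewrite /= ex => /seteqP[_ /(_ 1 I)]; case: m m0 {eta sub fin' s ex} => // m _.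
  have : ideal_mul (max_ideal x) (ideal_pow (max_ideal x) m) `<=` max_ideal x.
    apply: ideal_mul_least; last first.
      by move=> f f'; rewrite /max_ideal /= => hf _; rewrite rmorphM /= hf mul0r.
    split=> [|c u v hu hv]; rewrite /max_ideal /= ?linear0 //.
    by rewrite linearP /= hu hv scaler0 addr0.
  by move=> h /h; rewrite /max_ideal /= rmorph1 => /eqP; rewrite oner_eq0.
have sS' x : x \in s -> eta x = m.
  rewrite in_finite_support; last exact: sub_finite_set (@subIsetl _ _ _) fin'.
  by rewrite inE => -[/sub Sx _]; rewrite /eta asboolT.
suff : \big[@ideal_mul k A/setT]_(x <- s) ideal_pow (max_ideal x) (eta x) `<=`
    ideal_pow (vanishing [set` s]) m.
  move=> h f /h hf; rewrite -[f]mulr1.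
  apply: (ideal_pow_mul (I := vanishing [set` s]) (J := setT) _ hf).
    by move=> u v us _ x /sS xs; rewrite rmorphM /= us // mul0r.
  by have := @ideal_pow_mem setT 1 m I; rewrite expr1n.
elim: s sS' {sS} => [|x s IH] sS'.
  rewrite big_nil => f _; have := @ideal_pow_mem (vanishing [set` [::]]) 1 m.
  rewrite expr1n => h; rewrite -[f]mulr1.
  have [_ _ M] := ideal_pow_ideal (vanishing [set` ([::] : seq X)]) m.
  by apply: M; apply: h => y /=.
rewrite big_cons; apply: ideal_mul_least; first exact/ideal_lin/ideal_pow_ideal.
rewrite (sS' _ (mem_head _ _)) => f f' hf hf'.
apply: (ideal_pow_mul _ hf); last first.
  by apply: IH hf' => y ys; apply: sS'; rewrite inE ys orbT.
move=> u v ux vs y /=; rewrite inE rmorphM /= => /predU1P[->|ys].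
  by rewrite ux mul0r.
by rewrite (vs y ys) mulr0.
Qed.

Lemma separate_points (x y : X) : x <> y -> exists f, x f = 1 /\ y f = 0.
Proof.
move=> xy; have [f xyf] : exists f, x f - y f != 0 :> k.
  apply: contrapT => no; apply/xy/ratptP => f; apply/eqP; rewrite -subr_eq0.
  by apply: contrapT => /negP h; apply: no; exists f.
have E (z : X) : z (f - (y f : k)%:A) = (z f : k) - y f.
  rewrite rmorphB /=; congr (_ - _).
  by have := ratpt_scale z (y f) 1; rewrite rmorph1 mulr1.
exists ((x f - y f : k)^-1 *: (f - (y f : k)%:A)).
by rewrite !ratpt_scale !E mulVf // subrr mulr0.
Qed.

Lemma interpolate (s t : seq X) : (forall x y, x \in s -> y \in t -> x <> y) ->
  exists f, (forall x, x \in s -> x f = 1) /\ (forall y, y \in t -> y f = 0).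
Proof.
elim: s => [|x s IH] st; first by exists 0; split=> // y _; rewrite rmorph0.
have [|f [fs ft]] := IH; first by move=> y z ys; apply: st; rewrite inE ys orbT.
have [f' [fx ft']] : exists f', x f' = 1 /\ forall y, y \in t -> y f' = 0.
  have xt y : y \in t -> x <> y by apply: st; rewrite mem_head.
  elim: t xt {st ft IH} => [|y t IHt] xt; first by exists 1; split=> //; rewrite rmorph1.
  have [|u [xu ut]] := IHt; first by move=> z zt; apply: xt; rewrite inE zt orbT.
  have [v [xv yv]] := separate_points (xt y (mem_head _ _)).
  exists (v * u); rewrite rmorphM /= xv xu mulr1; split=> // z.
  rewrite inE rmorphM /= => /predU1P[->|/ut ->]; last by rewrite mulr0.
  by rewrite yv mul0r.
exists (1 - (1 - f) * (1 - f')); split=> y; last first.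
  move=> yt; rewrite !(rmorphB, rmorphM, rmorph1) /= ft // ft' // subr0 mulr1.
  by rewrite subrr.
rewrite inE !(rmorphB, rmorphM, rmorph1) /= => /predU1P[->|/fs ->].
  by rewrite fx subrr mulr0 subr0.
by rewrite subrr mul0r subr0.
Qed.

End Ideals.

(** * Traces and Galois coordinates *)

Section TensorIdeals.
Variables (k : fieldType) (g : finLieAlgType k) (A : comAlgType k).
Local Notation gA := (gtensor g A).
Implicit Types (I J : set A) (s t : gA).
Local Notation e i := ((vbasis {:g})`_(i : 'I_(\dim {:g}))).

Lemma tens_idealP I t : ideal I -> tens_ideal I t <-> forall i, I (t i).
Proof.
move=> II; have IL := ideal_lin II; split.
  apply: (lspan_least (P := fun t => forall i, I (t i))).
    split=> [i|c u v hu hv i]; rewrite !ffunE; first by case: II.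
    by case: IL => _; apply.
  by move=> _ [a _ [f If <-]] i; rewrite ffunE; apply: lin_closedZ.
move=> h; rewrite [t]tensE; apply: lin_closed_sum; first exact: lspan_lin.
by move=> i _; apply: lspan_sub; exists (e i) => //; exists (t i).
Qed.

Definition amul (f : A) (t : gA) : gA := [ffun i => f * t i].

Lemma amulE f t i : amul f t i = f * t i. Proof. by rewrite ffunE. Qed.

Lemma amul_linear f : linear (amul f).
Proof.
move=> c s t; apply: gtensorP => i.
by rewrite !ffunE mulrDr scalerAr.
Qed.

Lemma amul_tens f a f' : amul f (tens a f') = tens a (f * f').
Proof. by apply: gtensorP => i; rewrite !ffunE scalerAr. Qed.

Lemma tens_linearr (a : g) : linear (tens a : A -> gA).
Proof. exact: (@tens_bilinear k g A).1. Qed.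

Lemma tens_linearl (f : A) : linear (fun a : g => tens a f : gA).
Proof. exact: (@tens_bilinear k g A).2. Qed.

Lemma lie_ideal_coords I s t : ideal I -> (forall i, I (t i)) -> forall i, I (lie s t i).
Proof.
move=> II It; have IL := ideal_lin II.
have PL i : lin_closed (fun u : gA => I (u i)).
  by split=> [|c u v hu hv]; rewrite !ffunE; [case: II|case: IL => _; apply].
have h t' s' : tens_ideal I t' -> forall i, I (lie s' t' i).
  move=> It' i; move: t' It'; apply: (lspan_least (P := fun t' => I (lie s' t' i))).
    split=> [|c u v hu hv]; last by rewrite lie_linearr; case: (PL i) => _; apply.
    have -> : lie s' 0 = 0 by apply: (addrI (lie s' 0)); rewrite -lieDr !addr0.
    by case: (PL i).
  move=> _ [b _ [f If <-]]; elim/gtensor_ind: s' => [|u v hu hv|a f'].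
  - have -> : lie 0 (tens b f) = 0 :> gA.
      by apply: (addrI (lie 0 (tens b f))); rewrite -lieDl !addr0.
    by case: (PL i).
  - by rewrite lieDl; apply: (lin_closedD (PL i)).
  - have -> : lie (tens a f' : gA) (tens b f) = tens (lie a b) (f' * f) by exact: tens_lieE.
    by rewrite ffunE; apply: lin_closedZ => //; case: II => _ _; apply.
by apply: h; apply/tens_idealP.
Qed.

Lemma ev_at_sum (x : ratpt A) t : ev_at x t = \sum_i (x (t i) : k) *: e i.
Proof. by []. Qed.

Lemma ev_at_vanish (S : set (ratpt A)) x t :
  (forall i, vanishing S (t i)) -> S x -> ev_at x t = 0.
Proof. by move=> h Sx; rewrite ev_at_sum big1 // => i _; rewrite h // scale0r. Qed.

End TensorIdeals.

Section Trace.
Variables (gT : finGroupType) (k : fieldType) (g : finLieAlgType k) (A : comAlgType k).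
Variables (aA : alg_action gT A) (ag : lie_action gT g).
Local Notation X := (ratpt A).
Local Notation gA := (gtensor g A).
Local Notation L := (fixed_alg aA ag).
Local Notation act := (tens_act aA ag).
Implicit Types (c d : gT) (S : set X) (I J : set A) (s t : gA).

Lemma tens_act1 t : act 1%g t = t.
Proof.
elim/gtensor_ind: t => [|s t hs ht|a f]; first exact: tens_act0.
  by rewrite tens_actD hs ht.
by rewrite tens_actE lie_act1 alg_act1.
Qed.

Lemma tens_actM c d t : act (c * d)%g t = act c (act d t).
Proof.
elim/gtensor_ind: t => [|s t hs ht|a f]; first by rewrite !tens_act0.
  by rewrite !tens_actD hs ht.
by rewrite !tens_actE lie_actM alg_actM.
Qed.

Lemma tens_act_sum c (J : Type) (r : seq J) (F : J -> gA) :
  act c (\sum_(j <- r) F j) = \sum_(j <- r) act c (F j).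
Proof. by apply: (big_morph (act c)); [exact: tens_actD|exact: tens_act0]. Qed.

Lemma tens_act_amul c f t : act c (amul f t) = amul (aA c f) (act c t).
Proof.
have amulD (f' : A) u v : amul f' (u + v) = amul f' u + amul f' v :> gA.
  by have := amul_linear f' 1 u v; rewrite !scale1r.
have amul0 (f' : A) : amul f' 0 = 0 :> gA by apply: (addrI (amul f' 0)); rewrite -amulD !addr0.
elim/gtensor_ind: t => [|s t hs ht|a f']; first by rewrite !(amul0, tens_act0).
  by rewrite !(amulD, tens_actD) hs ht.
by rewrite !(amul_tens, tens_actE) rmorphM.
Qed.

Lemma tens_act_coords c I J t : ideal J -> (forall f, I f -> J (aA c f)) ->
  (forall i, I (t i)) -> forall i, J (act c t i).
Proof.
move=> JJ IJ It i; rewrite /tens_act /tlift sum_ffunE.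
apply: lin_closed_sum => [|j _]; first exact: ideal_lin.
rewrite ffunE; apply: lin_closedZ; first exact: ideal_lin.
exact: IJ.
Qed.

Definition trace t : gA := \sum_c act c t.

Lemma trace_fixed t : trace t \in fixed aA ag.
Proof.
apply/fixedP => d; rewrite /trace tens_act_sum.
under eq_bigr => c _ do rewrite -tens_actM.
by rewrite [RHS](reindex_inj (mulgI d)).
Qed.

Definition ftrace t : L := FixedAlg (trace_fixed t).

Lemma ftrace_linear : linear ftrace.
Proof.
move=> c s t; apply: val_inj => /=; rewrite /trace scaler_sumr -big_split /=.
by apply: eq_bigr => d _; exact: tens_act_linear.
Qed.

Lemma fixed_act c (t : L) : act c (fixed_val t) = fixed_val t.
Proof. exact: (fixedP _ _ _ (fixed_valP t)). Qed.

Hypothesis free : acts_freely aA.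

Lemma separating_function S : in_Xstar aA S -> exists f : A,
  (forall x, S x -> x f = 1) /\ forall c, c <> 1%g -> vanishing S (aA c f).
Proof.
move=> XS; have [/finite_pt[s sS] _] := XS.
pose t := [seq pt_act aA c x | c <- [seq c <- enum gT | c != 1%g], x <- s].
have [|f [fs ft]] := @interpolate _ _ s t.
  move=> x y xs /allpairsP[[c z] /= []]; rewrite mem_filter => /andP[c1 _] zs -> xy.
  have [] := Xstar_eq (c := 1%g) (d := c) free XS ((sS x).1 xs) ((sS z).1 zs).
    by rewrite pt_act1.
  by move/esym/eqP; rewrite (negbTE c1).
exists f; split=> [x /sS/fs //|c c1 x /sS xs].
have := ft (pt_act aA c^-1%g x); rewrite pt_actE invgK; apply.
apply/allpairsP; exists (c^-1%g, x); split=> //=.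
by rewrite mem_filter mem_enum andbT invg_eq1; apply/eqP.
Qed.

Lemma primary_finite (J : set A) S (I : finType) (F : I -> A) :
  primary S J -> (forall i, vanishing S (F i)) ->
  exists n, (0 < n)%N /\ forall i, J (F i ^+ n).
Proof.
move=> [JJ Jp] FS; have [n nP] := choice (fun i => Jp _ (FS i)).
exists (\sum_i n i).+1%N; split=> // i; rewrite (bigD1 i) //= -addnS exprD.
exact: ideal_mulr.
Qed.

(** A separating f is 1 on S but not modulo J. A power f^n has its nontrivial translates in J, and 1
    - (1 - f^n)^m is 1 modulo J while still a multiple of f^n. *)
Lemma cutoff S J : in_Xstar aA S -> primary S J ->
  exists f, J (1 - f) /\ forall c, c <> 1%g -> J (aA c f).
Proof.
move=> XS Jp; have [f [f1 f0]] := separating_function XS; have [JJ JM] := Jp.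
have [|n [n0 Jn]] := primary_finite (I := {c : gT | c != 1%g})
    (F := fun c : {c : gT | c != 1%g} => aA (sval c) f) Jp.
  by move=> [c /= /eqP c1]; exact: f0.
have [m Jm] : exists m, J ((1 - f ^+ n) ^+ m).
  apply: JM => x Sx; rewrite rmorphB rmorphXn /= f1 // expr1n rmorph1.
  exact: subrr.
exists (1 - (1 - f ^+ n) ^+ m); split; first by rewrite subKr.
move=> c c1; have -> : 1 - (1 - f ^+ n) ^+ m = f ^+ n * \sum_(i < m) (1 - f ^+ n) ^+ i.
  apply: oppr_inj; rewrite opprB subrX1 [in LHS]addrAC subrr add0r.
  by rewrite mulNr.
rewrite rmorphM rmorphXn /=; apply: ideal_mulr => //.
by have /eqP c1' := c1; exact: (Jn (exist _ c c1')).
Qed.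

(** T s is the trace of f s for f as in [cutoff]: the term c = 1 is s modulo J and the others vanish
    modulo J. Linearity of T is recorded because an untwisted action is obtained by composing with
    T. *)
Lemma fixed_approx S J : in_Xstar aA S -> primary S J ->
  exists T : {linear gA -> L}, forall s i, J ((s - fixed_val (T s)) i).
Proof.
move=> XS Jp; have [f [Jf Jcf]] := cutoff XS Jp; have [JJ _] := Jp.
pose T s := ftrace (amul f s).
have Tl : linear T by move=> c s t; rewrite /T amul_linear ftrace_linear.
exists (HB.pack_for {linear gA -> L} T (GRing.isLinear.Build _ _ _ _ T Tl)) => s i /=.
rewrite /T /= /trace (bigD1 1%g) //= tens_act1 opprD addrA !ffunE.
apply: idealB => //.
  by rewrite -{1}[s i]mul1r -mulrBl; apply: ideal_mulr.
rewrite sum_ffunE; apply: ideal_sum => // c /eqP c1.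
by rewrite tens_act_amul amulE; apply: ideal_mulr => //; apply: Jcf.
Qed.

End Trace.

Section GaloisCoordinates.
Variables (gT : finGroupType) (k : closedFieldType) (A : comAlgType k).
Variables (aA : alg_action gT A).
Hypothesis free : acts_freely aA.
Hypothesis fg : finitely_generated A.

(** The image of A (x) A in the functions from Gamma to A, which contains the constants and is
    closed under products. *)
Let coeffs (F : gT -> A) :=
  exists ps : seq (A * A), forall c, F c = \sum_(p <- ps) p.1 * aA c p.2.

(** A point on the ideal generated by all f - c f would be fixed by c, so this is the unit ideal.
    Writing 1 = sum a (b - c b), the function d -> sum a d(b), lowered by its value at c, is 1 at
    the identity and 0 at c. *)
Lemma galois_coords_pair (c : gT) : c != 1%g ->
  exists F, [/\ coeffs F, F 1%g = 1 & F c = 0].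
Proof.
move=> c1; pose J : set A := [set f | exists ps : seq (A * A),
  f = \sum_(p <- ps) p.1 * (p.2 - aA c p.2)].
have JJ : ideal J.
  split; first by exists [::]; rewrite big_nil.
    by move=> _ _ [ps ->] [qs ->]; exists (ps ++ qs); rewrite big_cat.
  move=> f _ [ps ->]; exists [seq (f * p.1, p.2) | p <- ps].
  by rewrite big_map mulr_sumr; apply: eq_bigr => p _; rewrite mulrA.
have [[ps e1]|J1] := pselect (J 1).
  exists (fun d => \sum_(p <- ps) p.1 * aA d p.2 - \sum_(p <- ps) p.1 * aA c p.2).
  split; last exact: subrr.
    exists ((- \sum_(p <- ps) p.1 * aA c p.2, 1) :: ps) => d.
    by rewrite big_cons /= rmorph1 mulr1 addrC.
  by rewrite e1 -sumrB; apply: eq_bigr => p _; rewrite alg_act1 mulrBr.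
have [x xJ] := nullstellensatz fg JJ J1; case/eqP: c1.
apply: invg_inj; rewrite invg1; apply: (free (x := x)); apply: ratptP => f.
rewrite pt_actE invgK; apply/esym/eqP; rewrite -subr_eq0 -rmorphB; apply/eqP/xJ.
by exists [:: (1, f)]; rewrite big_seq1 mul1r.
Qed.

(** The product over all c <> 1 of the functions separating 1 from c is the delta function at 1, and
    it still comes from A (x) A. *)
Lemma galois_coords : exists ps : seq (A * A),
  forall c, \sum_(p <- ps) p.1 * aA c p.2 = (c == 1%g)%:R.
Proof.
have [F FP] : {F : gT -> gT -> A & forall c, c != 1%g ->
    [/\ coeffs (F c), F c 1%g = 1 & F c c = 0]}.
  apply: (choice (P := fun c F => c != 1%g -> [/\ coeffs F, F 1%g = 1 & F c = 0])) => c.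
  have [c1|c1] := boolP (c != 1%g); last by exists (fun=> 0).
  by have [F FP] := galois_coords_pair c1; exists F.
suff [G [[ps GE] G1 G0]] : exists G, [/\ coeffs G, G 1%g = 1 &
    forall c, c \in enum gT -> c != 1%g -> G c = 0].
  exists ps => c; rewrite -GE; case: eqVneq => [->//|c1].
  by apply: G0 => //; rewrite mem_enum.
elim: (enum gT) => [|c s [G [[ps GE] G1 G0]]].
  exists (fun=> 1); split=> //; exists [:: (1, 1)] => c.
  by rewrite big_seq1 /= rmorph1 mulr1.
have [c1|c1] := boolP (c != 1%g); last first.
  exists G; split=> //; first by exists ps.
  move=> d; rewrite inE => /predU1P[->|]; last exact: G0.
  by rewrite (negbTE c1).
have [[qs FE] F1 Fc] := FP _ c1.
exists (fun d => F c d * G d); split; last 1 first.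
- move=> d; rewrite inE => /predU1P[->|ds d1]; first by rewrite Fc mul0r.
  by rewrite G0 // mulr0.
- exists [seq (q.1 * p.1, q.2 * p.2) | q <- qs, p <- ps] => d.
  rewrite FE GE mulr_suml big_allpairs_dep; apply: eq_bigr => q _.
  by rewrite mulr_sumr; apply: eq_bigr => p _ /=; rewrite rmorphM mulrACA.
- by rewrite F1 G1 mulr1.
Qed.

End GaloisCoordinates.

(** * Nilpotent action and constituents *)

Section Constituents.
Variables (k : fieldType) (L : lieAlgType k).
Implicit Types V W : liemod L.

Section Subquotient.
Variables (V : liemod L) (U U' : {vspace V}).
Hypothesis Usub : submodule U.
Hypothesis U'sub : submodule U'.
(** The quotient of U by U :&: U' is carried by this complement: an operator acts on it and the
    result is projected back along U'. *)
Let C := (U :\: U')%VS.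
Let p := daddv_pi C U'.

Let CU' : (C :&: U' = 0)%VS. Proof. exact: capv_diff. Qed.

Let pC v : p v \in C. Proof. exact: memv_pi. Qed.

Let CU v : v \in C -> v \in U. Proof. by apply/subvP; exact: diffvSl. Qed.

Let p_id v : v \in C -> p v = v. Proof. exact: daddv_pi_id. Qed.

Let pU' v : v \in U' -> p v = 0.
Proof.
move=> vU'; have vCU' : v \in (C + U')%VS by apply: (subvP (addvSr _ _)).
have := daddv_pi_add CU' vCU'; rewrite (@daddv_pi_id _ _ U' C v) //; last by rewrite capvC.
by move/eqP; rewrite -subr_eq0 addrK => /eqP.
Qed.

Let p_sub u : u \in U -> u - p u \in U'.
Proof.
move=> uU; have uCU' : u \in (C + U')%VS by rewrite addv_diff; apply: (subvP (addvSl _ _)).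
by rewrite -{1}(daddv_pi_add CU' uCU') [X in X - _]addrC addrK memv_pi.
Qed.

Let p_act a u : u \in U -> p (action V a (p u)) = p (action V a u).
Proof.
move=> uU; apply/esym/eqP; rewrite -subr_eq0 -!linearB /=; apply/eqP/pU'/U'sub.
exact: p_sub.
Qed.

Let f : 'Hom(V, subvs_of C) := (linfun (vsproj C) \o p)%VF.

Let fE v : vsval (f v) = p v.
Proof. by rewrite comp_lfunE lfunE /= vsprojK. Qed.

Let sact a : 'End(subvs_of C) := (f \o action V a \o linfun (@vsval _ _ C))%VF.

Let sactE a w : vsval (sact a w) = p (action V a (vsval w)).
Proof. by rewrite 2!comp_lfunE fE lfunE. Qed.

Fact subquotient_linear : linear sact.
Proof.
move=> c a b; apply/lfunP => w; apply: subvs_inj.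
rewrite add_lfunE scale_lfunE !linearD !linearZ /= !sactE.
by rewrite actionD actionZ linearD linearZ.
Qed.

Fact subquotient_lie a b w : sact (lie a b) w = sact a (sact b w) - sact b (sact a w).
Proof.
have wU : vsval w \in U by apply/CU/subvsP.
apply: subvs_inj; rewrite linearB /= !sactE lie_rep_lie linearB /=.
by rewrite !p_act //; apply: Usub.
Qed.

Definition subquotient : liemod L := LieMod (LieRep subquotient_linear subquotient_lie).

Definition subquotient_map : 'Hom(V, subquotient) := f.

Lemma subquotient_mapE a u : u \in U ->
  subquotient_map (action V a u) = action subquotient a (subquotient_map u).
Proof. by move=> uU; apply: subvs_inj; rewrite sactE !fE p_act. Qed.

Lemma subquotient_map_eq0 u : u \in U -> subquotient_map u = 0 -> u \in U'.
Proof.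
move=> uU /(congr1 (@vsval _ _ C)); rewrite fE linear0 => pu.
by have := p_sub uU; rewrite pu subr0.
Qed.

Lemma subquotient_map_kernel u : u \in U' -> subquotient_map u = 0.
Proof. by move=> uU'; apply: subvs_inj; rewrite fE pU' // linear0. Qed.

Lemma subquotient_map_full : (subquotient_map @: U)%VS = fullv.
Proof.
apply/eqP; rewrite eqEsubv subvf; apply/subvP => w _.
have -> : w = f (vsval w) by apply: subvs_inj; rewrite fE p_id // subvsP.
by apply: memv_img; apply/CU/subvsP.
Qed.

End Subquotient.

Lemma maximal_submodule V (U : {vspace V}) : submodule U -> U != 0%VS ->
  exists U' : {vspace V}, [/\ submodule U', (U' <= U)%VS, U' <> U &
    forall T : {vspace V}, submodule T -> (U' <= T)%VS -> (T <= U)%VS -> T = U' \/ T = U].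
Proof.
move=> Usub U0; pose good n := `[< exists U' : {vspace V},
  [/\ submodule U', (U' <= U)%VS, U' <> U & \dim U' = n] >].
have ex : exists n, good n.
  exists 0%N; apply/asboolP; exists 0%VS; split; rewrite ?sub0v ?dimv0 //.
    by move=> a u; rewrite memv0 => /eqP ->; rewrite linear0 mem0v.
  by move=> e; rewrite -e eqxx in U0.
have ub n : good n -> (n <= \dim U)%N.
  by move=> /asboolP[U' [_ U'U _ <-]]; exact: dimvS.
have [n /asboolP[U' [U's U'U U'neq dU']] nmax] := ex_maxnP ex ub.
exists U'; split=> // T Ts U'T TU; have [->|/eqP TneqU] := eqVneq T U; [by right|left].
apply/eqP; rewrite eq_sym -(dimv_leqif_eq U'T) eqn_leq dimvS //= dU'; apply: nmax.
by apply/asboolP; exists T.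
Qed.

(** The chain passes at each step to a maximal submodule; the quotient is a constituent, hence
    killed by K. *)
Lemma killed_chain V (K : set L) :
  (forall W, constituent V W -> forall a, K a -> forall w, action W a w = 0) ->
  exists U : nat -> {vspace V}, [/\ U 0%N = fullv, exists d, U d = 0%VS,
    forall i, (U i.+1 <= U i)%VS
    & forall i a u, K a -> u \in U i -> action V a u \in U i.+1].
Proof.
move=> Kkill.
have step (U : {vspace V}) : exists U' : {vspace V}, submodule U ->
   [/\ submodule U', (U' <= U)%VS, (\dim U' <= (\dim U).-1)%N
     & forall a u, K a -> u \in U -> action V a u \in U'].
  have [Us|] := pselect (submodule U); last by exists 0%VS.
  have [U0|U0] := eqVneq U 0%VS.
    exists 0%VS; split; rewrite ?sub0v ?dimv0 //.
      by move=> a u; rewrite memv0 => /eqP ->; rewrite linear0 mem0v.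
    by move=> a u _; rewrite U0 memv0 => /eqP ->; rewrite linear0 mem0v.
  have [U' [U's U'U U'neq max]] := maximal_submodule Us U0.
  exists U' => _; split=> //.
    have [le eq] := dimv_leqif_eq U'U.
    have : (\dim U' < \dim U)%N by rewrite ltn_neqAle le eq andbT; apply/eqP.
    by case: (\dim U).
  pose W := subquotient Us U's.
  have irr : irreducible W.
    split.
      move=> W0; apply: U'neq; apply/eqP; rewrite eqEsubv U'U; apply/subvP => u uU.
      apply: (subquotient_map_eq0 (U'sub := U's) uU); apply/eqP; rewrite -memv0.
      by have := memvf (subquotient_map Us U's u); rewrite -/W W0.
    move=> T Ts; pose q := subquotient_map Us U's.
    pose T' := (U :&: q @^-1: T)%VS.
    have T's : submodule T'.
      move=> a u; rewrite !memv_cap -!memv_preim => /andP[uU uT].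
      by rewrite Us //= subquotient_mapE //; apply: Ts.
    have [||T'E|T'E] := max T' T's.
    - apply/subvP => u uU'; rewrite memv_cap (subvP U'U) //= -memv_preim.
      by rewrite [q u]subquotient_map_kernel // mem0v.
    - exact: capvSl.
    - left; apply/eqP; rewrite -subv0; apply/subvP => w wT.
      have : w \in (q @: U)%VS by rewrite subquotient_map_full memvf.
      case/memv_imgP => u uU wE; have : u \in T'.
        by rewrite memv_cap uU -memv_preim -wE.
      by rewrite T'E wE memv0 => /(subquotient_map_kernel Us U's) ->.
    - right; apply/eqP; rewrite eqEsubv subvf; apply/subvP => w _.
      have : w \in (q @: U)%VS by rewrite subquotient_map_full memvf.
      case/memv_imgP => u uU ->; move: uU; rewrite -T'E memv_cap -memv_preim.
      by case/andP.
  have cW : constituent V W.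
    split=> //; exists U, (subquotient_map Us U's); split=> //.
      exact: subquotient_map_full.
    by move=> a u uU; exact: subquotient_mapE.
  move=> a u Ka uU; apply: (subquotient_map_eq0 (U'sub := U's) (Us a _ uU)).
  by rewrite subquotient_mapE // (Kkill _ cW).
have [next nextP] := choice step.
have sub i : submodule (iter i next fullv).
  elim: i => [|i IH]; first by move=> a u _; exact: memvf.
  by have [] := nextP _ IH.
exists (fun i => iter i next fullv); split=> // [|i|i a u Ka ui].
- exists (\dim {:V}).+1; apply/eqP; rewrite -dimv_eq0 -leqn0.
  have le i : (\dim (iter i next fullv) <= \dim {:V} - i)%N.
    elim: i => [|i IH]; first by rewrite subn0.
    have [_ _ h _] := nextP _ (sub i); apply: leq_trans h _.
    by rewrite subnS -!subn1 leq_sub2r.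
  by apply: leq_trans (le _) _; rewrite leqn0 subn_eq0 leqnSn.
- by have [] := nextP _ (sub i).
- by have [_ _ _ h] := nextP _ (sub i); apply: h.
Qed.

Fixpoint lower_central (K : set L) (m : nat) : set L :=
  if m is m'.+1 then lspan [set lie a b | a in K & b in lower_central K m'] else K.

Lemma lower_central_lin K m : lin_closed K -> lin_closed (lower_central K m).
Proof. by case: m => [//|m] _; exact: lspan_lin. Qed.

(** An element of term m, built from m + 1 factors in K, moves every member of the chain m + 1 steps
    down, and the chain reaches zero. *)
Lemma lower_central_kill V (K : set L) :
  (forall W, constituent V W -> forall a, K a -> forall w, action W a w = 0) ->
  exists m, forall a, lower_central K m a -> forall v, action V a v = 0.
Proof.
move=> /killed_chain[U [U0 [d Ud] Udec UK]]; exists d => a ad v.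
suff main m b : lower_central K m b -> forall i u, u \in U i ->
    action V b u \in U (i + m).+1.
  have := main d a ad 0%N v; rewrite U0 memvf => /(_ isT); rewrite add0n.
  by move=> /(subvP (Udec d)); rewrite Ud memv0 => /eqP.
elim: m b => [|m IH] b; first by move=> Kb i u ui; rewrite addn0; exact: UK.
have P : lin_closed (fun b => forall i u, u \in U i -> action V b u \in U (i + m.+1).+1).
  split=> [i u ui|c x y hx hy i u ui]; first by rewrite action0 mem0v.
  by rewrite actionD actionZ memvD ?memvZ ?hx ?hy.
move: b; apply: (lspan_least P) => _ [x Kx [y Ky <-]] i u ui.
rewrite lie_rep_lie; apply: memvB.
  by rewrite addnS; apply: UK => //; exact: IH.
by have := IH y Ky i.+1 _ (UK i x u Kx ui); rewrite addSnnS.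
Qed.

End Constituents.

Section Evaluation.
Variables (k : fieldType) (g L : lieAlgType k).

Lemma tensor_map_eq n (T : 'I_n -> lmodType k) (V : lmodType k)
    (mu : (forall i, T i) -> V) (W : lmodType k) (f f' : {linear V -> W}) :
  is_tensor mu -> (forall v, f (mu v) = f' (mu v)) -> f =1 f'.
Proof.
move=> [mul univ] ff'; have mphi : multilinear (fun v => f (mu v)).
  by move=> v i c u w; rewrite mul linearP.
have [F [FE Funiq]] := univ W _ mphi.
by move=> x; rewrite (Funiq f) // (Funiq f') // => v; rewrite ff'.
Qed.

Lemma evaluation_kill n (e : 'I_n -> L -> g) (rho : 'I_n -> liemod g) (V : liemod L) a :
  is_evaluation e rho V -> (forall i, e i a = 0) -> forall v, action V a v = 0.
Proof.
move=> [mu [tens actE]] e0.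
have h : forall v, action V a (mu v) = (0 : 'End(V)) (mu v).
  move=> v; rewrite actE zero_lfunE big1 // => i _; rewrite e0 action0.
  have [mul _] := tens; have := mul v i 1 0 0; rewrite !scale1r addr0.
  by move/eqP; rewrite -subr_eq0 opprD addrA subrr sub0r oppr_eq0 => /eqP.
by move=> v; rewrite (tensor_map_eq tens h) /= zero_lfunE.
Qed.

End Evaluation.

(** * Ideals of finite support that annihilate a module *)

Section Annihilation.
Variables (gT : finGroupType) (k : closedFieldType) (g : finLieAlgType k) (A : comAlgType k).
Variables (aA : alg_action gT A) (ag : lie_action gT g) (td : triangular_decomposition g).
Hypothesis char0 : [pchar k] =i pred0.
Hypothesis fg : finitely_generated A.
Hypothesis ss : semisimple g.
Hypothesis free : acts_freely aA.
Variable S : set (ratpt A).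
Hypothesis XS : in_Xstar aA S.
Local Notation X := (ratpt A).
Local Notation gA := (gtensor g A).
Local Notation L := (fixed_alg aA ag).
Local Notation act := (tens_act aA ag).
Local Notation ftr := (ftrace aA ag).
Local Notation e i := ((vbasis {:g})`_(i : 'I_(\dim {:g}))).

Let VS_ideal : ideal (vanishing S). Proof. exact: vanishing_ideal. Qed.

Definition coords_kernel : set gA := [set s | forall i, vanishing S (s i)].

Lemma coords_kernel_lin : lin_closed coords_kernel.
Proof.
have [V0 VP] := ideal_lin VS_ideal.
by split=> [i|c u v hu hv i]; rewrite !ffunE; [exact: V0|exact: VP].
Qed.

(** As g is perfect, a may be taken to be a bracket [b, c], and [b (x) u, c (x) v] = a (x) u v
    trades one factor of the ideal for one step of the series. Term 0 is the kernel itself, whence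
    the exponent [m.+1]. *)
Lemma tens_lower m h (a : g) : ideal_pow (vanishing S) m.+1 h ->
  lower_central coords_kernel m (tens a h).
Proof.
have perfect := semisimple_perfect td char0 ss.
elim: m h a => [|m IH] h a.
  move=> h1; have hS : vanishing S h.
    move: h h1; apply: ideal_mul_least; first exact: ideal_lin.
    by move=> f f' fS _; exact: (ideal_mulr f' VS_ideal fS).
  by move=> i; rewrite ffunE; exact: (lin_closedZ _ (ideal_lin VS_ideal) hS).
have PL := lower_central_lin m.+1 coords_kernel_lin.
move: h; apply: ideal_mul_least; first exact: (lin_closed_comp (tens_linearr a) PL).
move=> u v uS vS.
pose P b := lower_central coords_kernel m.+1 (tens b (u * v)).
apply: (lspan_least (P := P) _ _ (perfect a)).
  exact: (lin_closed_comp (tens_linearl (u * v)) PL).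
move=> _ [b _ [c _ <-]]; apply: lspan_sub; exists (tens b u); last first.
  by exists (tens c v); [exact: IH|exact: tens_lieE].
by move=> i; rewrite ffunE; exact: (lin_closedZ _ (ideal_lin VS_ideal) uS).
Qed.

Lemma coords_lower m (s : gA) : (forall i, ideal_pow (vanishing S) m.+1 (s i)) ->
  lower_central coords_kernel m s.
Proof.
move=> h; rewrite [s]tensE; apply: lin_closed_sum.
  exact: (lower_central_lin m coords_kernel_lin).
by move=> i _; apply: tens_lower.
Qed.

Definition fixed_kernel : set L := [set t | coords_kernel (fixed_val t)].

Lemma fixed_kernel_lin : lin_closed fixed_kernel.
Proof. exact: (lin_closed_comp (f := @fixed_val _ _ _ _ aA ag)) coords_kernel_lin. Qed.

Definition orbit_vanishing : set A := [set f | forall c, vanishing S (aA c f)].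
Local Notation I' := orbit_vanishing.

Lemma orbit_vanishing_ideal : ideal I'.
Proof.
have [V0 VD VM] := VS_ideal.
split=> [c|f f' hf hf' c|f f' hf' c]; rewrite ?rmorph0 ?rmorphD ?rmorphM //.
  exact: (VD _ _ (hf c) (hf' c)).
exact: (VM _ _ (hf' c)).
Qed.

(* Summing over a Galois coordinate system (p.1, p.2), sum_p p.1 c(p.2) = [c = 1],
   cancels the cross terms in the product of two traces. *)
Lemma trace_commutator (ps : seq (A * A)) (b c : g) (u v : A) :
  (forall d, \sum_(p <- ps) p.1 * aA d p.2 = (d == 1%g)%:R) ->
  ftr (tens (lie b c) (u * v)) =
  \sum_(p <- ps) lie (ftr (tens b (u * p.1))) (ftr (tens c (v * p.2))).
Proof.
move=> psP; apply: val_inj; rewrite (raddf_sum (val : {linear L -> gA})) /=.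
have lie_suml (J : finType) (F : J -> gA) y : lie (\sum_j F j) y = \sum_j lie (F j) y.
  apply: (big_morph (fun x => lie x y)) => [x x'|]; first exact: lieDl.
  by apply: (addrI (lie 0 y)); rewrite -lieDl !addr0.
have lie_sumr' (J : finType) (F : J -> gA) y : lie y (\sum_j F j) = \sum_j lie y (F j).
  apply: (big_morph (lie y)) => [x x'|]; first exact: lieDr.
  by apply: (addrI (lie y 0)); rewrite -lieDr !addr0.
(* In the double sum over translates d and d d', the element d acts on the whole bracket and is
   pulled out, so that only the relative translate d' matters. *)
under eq_bigr => p _.
  have -> : lie (trace aA ag (tens b (u * p.1))) (trace aA ag (tens c (v * p.2))) =
      \sum_d act d (\sum_d' lie (tens b (u * p.1) : gA) (act d' (tens c (v * p.2)))).
    rewrite /trace lie_suml; apply: eq_bigr => d _.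
    rewrite (reindex_inj (mulgI d)) lie_sumr' tens_act_sum; apply: eq_bigr => d' _ /=.
    by rewrite tens_actM tens_act_lie.
  over.
rewrite exchange_big; apply: eq_bigr => d _ /=; rewrite -tens_act_sum; congr (act d _).
rewrite exchange_big (bigD1 1%g) //= [X in _ = _ + X]big1 ?addr0 => [|d' d'1].
  transitivity (\sum_(p <- ps) tens (lie b c) (u * v * (p.1 * aA 1%g p.2)) : gA).
    have F := tens_linearr (A := A) (lie b c).
    pose G : {linear A -> gA} := HB.pack (tens (lie b c) : A -> gA)
      (GRing.isLinear.Build _ _ _ _ (tens (lie b c) : A -> gA) F).
    by rewrite -(raddf_sum G) -mulr_sumr psP eqxx mulr1.
  apply: eq_bigr => p _; rewrite tens_act1 alg_act1.
  by rewrite [RHS]tens_lieE mulrACA.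
transitivity (\sum_(p <- ps) tens (lie b (ag d' c)) (u * aA d' v * (p.1 * aA d' p.2)) : gA).
  by apply: eq_bigr => p _; rewrite tens_actE [LHS]tens_lieE rmorphM mulrACA.
have F := tens_linearr (A := A) (lie b (ag d' c)).
pose G : {linear A -> gA} := HB.pack (tens (lie b (ag d' c)) : A -> gA)
  (GRing.isLinear.Build _ _ _ _ (tens (lie b (ag d' c)) : A -> gA) F).
by rewrite -(raddf_sum G) -mulr_sumr psP (negbTE d'1) mulr0 raddf0.
Qed.

Lemma trace_kernel (b : g) u : I' u -> fixed_kernel (ftr (tens b u)).
Proof.
move=> Iu i; rewrite /= /trace sum_ffunE; apply: ideal_sum => // c _.
refine (@tens_act_coords _ _ _ _ aA ag c I' (vanishing S) _ VS_ideal (fun f If => If c) _ _).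
by move=> j; rewrite ffunE; exact: (lin_closedZ _ (ideal_lin orbit_vanishing_ideal) Iu).
Qed.

(** The induction of [tens_lower], with [trace_commutator] splitting the trace of [b, c] (x) u v.
    The factors [p.1] and [p.2] that it introduces are absorbed because [I'] and its powers are
    ideals. *)
Lemma trace_lower m h (a : g) : ideal_pow I' m.+1 h ->
  lower_central fixed_kernel m (ftr (tens a h)).
Proof.
have perfect := semisimple_perfect td char0 ss.
have [ps psP] := galois_coords free fg.
have I'I := orbit_vanishing_ideal.
have lin1 (b : g) : linear (fun f => ftr (tens b f)).
  by move=> c u v; rewrite tens_linearr ftrace_linear.
have lin2 (f : A) : linear (fun b : g => ftr (tens b f)).
  by move=> c u v; rewrite tens_linearl ftrace_linear.
elim: m h a => [|m IH] h a.
  move=> h1; apply: trace_kernel.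
  move: h h1; apply: ideal_mul_least; first exact: ideal_lin.
  by move=> f f' fS _; exact: (ideal_mulr f' I'I fS).
have PL := lower_central_lin m.+1 fixed_kernel_lin.
move: h; apply: ideal_mul_least; first exact: (lin_closed_comp (lin1 a) PL).
move=> u v uS vS.
pose P b := lower_central fixed_kernel m.+1 (ftr (tens b (u * v))).
apply: (lspan_least (P := P) _ _ (perfect a)).
  exact: (lin_closed_comp (lin2 (u * v)) PL).
move=> _ [b _ [c _ <-]]; rewrite /P (trace_commutator _ _ _ _ psP).
apply: lin_closed_sum => // p _; apply: lspan_sub.
exists (ftr (tens b (u * p.1))); first exact: (trace_kernel _ (ideal_mulr p.1 I'I uS)).
exists (ftr (tens c (v * p.2))) => //; apply: IH.
by apply: ideal_mulr => //; exact: ideal_pow_ideal.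
Qed.

(* With F = f ^+ n, where f is 1 on S and its nontrivial translates vanish there,
   r = 1 - sum_c c(F) is invariant and vanishes on the orbits of S, and
   1 = r ^+ n + (sum_c c(F)) * w, so that t is the trace of
   #|Gamma|^-1 r^n t + F w t. *)
Lemma fixed_lower m (t : L) : (forall i, ideal_pow (vanishing S) m.+1 (fixed_val t i)) ->
  lower_central fixed_kernel m t.
Proof.
move=> tS; have PL := lower_central_lin m fixed_kernel_lin.
have coords (s : gA) : (forall i, ideal_pow I' m.+1 (s i)) -> lower_central fixed_kernel m (ftr s).
  move=> h; have -> : ftr s = \sum_i ftr (tens (e i) (s i)).
    pose G : {linear gA -> L} := HB.pack (ftr : gA -> L)
      (GRing.isLinear.Build _ _ _ _ (ftr : gA -> L) (@ftrace_linear _ _ _ _ aA ag)).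
    by rewrite {1}[s]tensE -[LHS]/(G _) raddf_sum.
  by apply: lin_closed_sum => // i _; apply: trace_lower.
have [f [f1 f0]] := separating_function free XS.
set n := m.+1; pose F := f ^+ n; pose r := 1 - \sum_c aA c F.
pose w := \sum_(i < n) r ^+ i.
have rinv c : aA c r = r.
  rewrite /r rmorphB rmorph1 rmorph_sum; congr (_ - _) => /=.
  rewrite [RHS](reindex_inj (mulgI c)); apply: eq_bigr => d _.
  by rewrite alg_actM.
have winv c : aA c w = w.
  by rewrite /w rmorph_sum; apply: eq_bigr => i _ /=; rewrite rmorphXn /= rinv.
have rI : I' r.
  move=> c x Sx; rewrite rinv /r rmorphB rmorph1 rmorph_sum (bigD1 1%g) //=.
  rewrite alg_act1 big1 ?addr0 => [|d /eqP d1]; first by rewrite rmorphXn /= f1 // expr1n subrr.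
  by rewrite !rmorphXn /= f0 // expr0n.
have one : r ^+ n + (\sum_c aA c F) * w = 1.
  have -> : \sum_c aA c F = 1 - r by rewrite /r subKr.
  have := subrX1 r n; rewrite -/w => /(congr1 -%R); rewrite opprB -mulNr opprB => <-.
  by rewrite addrC subrK.
have card0 : #|gT|%:R != 0 :> k.
  by rewrite natr_eq0 // -lt0n; apply/card_gt0P; exists 1%g.
have -> : t = (#|gT|%:R : k)^-1 *: ftr (amul (r ^+ n) (fixed_val t))
    + ftr (amul (F * w) (fixed_val t)).
  apply: val_inj; rewrite /= /trace.
  under eq_bigr => c _ do rewrite tens_act_amul fixed_act rmorphXn /= rinv.
  under [X in _ + X]eq_bigr => c _ do rewrite tens_act_amul fixed_act rmorphM /= winv.
  rewrite sumr_const -scaler_nat scalerA mulVf // scale1r.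
  apply: gtensorP => i; rewrite [RHS]ffunE sum_ffunE amulE.
  under eq_bigr => c _ do rewrite amulE.
  by rewrite -!mulr_suml -mulrDl one mul1r.
apply: lin_closedD => //; first apply: lin_closedZ => //; apply: coords => i; rewrite amulE.
  by apply: ideal_mulr; [exact: ideal_pow_ideal|exact: ideal_pow_mem].
rewrite mulrAC; apply: ideal_mulr; first exact: ideal_pow_ideal.
(* F is the (m + 1)-st power of a function in [I1], and t has coordinates in the (m + 1)-st power of
   the ideal of S. A product of one function of each kind vanishes on all orbits of S, so powers
   multiply into the power of [I']. *)
pose I1 : set A := [set h | forall c, c <> 1%g -> vanishing S (aA c h)].
apply: (ideal_pow_mul (I := I1) (J := vanishing S)); last exact: tS.
  move=> u v u1 vS c; rewrite rmorphM /=; have [->|/eqP c1] := eqVneq c 1%g.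
    by rewrite !alg_act1; case: VS_ideal => _ _; apply.
  exact: (ideal_mulr _ VS_ideal (u1 c c1)).
exact: ideal_pow_mem.
Qed.

Definition supported (eta : X -> nat) := finite_set (nat_supp eta) /\ nat_supp eta `<=` S.

Lemma supported_primary eta : supported eta -> primary S (ideal_of eta).
Proof. by case; exact: ideal_of_primary. Qed.

Lemma in_F_killed (V : liemod gA) : in_F td S V -> exists2 eta, supported eta &
  forall s : gA, (forall i, ideal_of eta (s i)) -> forall v, action V s v = 0.
Proof.
move=> VF; have [m mP] : exists m, forall a, lower_central coords_kernel m a ->
    forall v, action V a v = 0.
  apply: lower_central_kill => W /VF[psi [_ [n [p [rho [pS _ _ evW]]]] sub]] a aK.
  apply: (evaluation_kill evW) => i; apply: (ev_at_vanish aK).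
  exact: sub (pS i).
have [finS _] := XS; have [f1 f2 f3] := ideal_of_const (ltn0Sn m) finS.
eexists; first by split; [exact: f1|exact: f2].
by move=> s sI; apply: mP; apply: coords_lower => i; apply/f3/sI.
Qed.

Lemma in_FGamma_killed (V : liemod L) : in_FGamma td S V -> exists2 eta, supported eta &
  forall t : L, (forall i, ideal_of eta (fixed_val t i)) -> forall v, action V t v = 0.
Proof.
move=> VF; have [m mP] : exists m, forall a, lower_central fixed_kernel m a ->
    forall v, action V a v = 0.
  apply: lower_central_kill => W /VF[psi [_ [n [p [rho [pS _ _ evW]]]] sub]] a aK.
  apply: (evaluation_kill evW) => i; have [x Sx [c _ <-]] := sub _ (pS i).
  by rewrite ev_at_fixed (ev_at_vanish aK) // linear0.
have [finS _] := XS; have [f1 f2 f3] := ideal_of_const (ltn0Sn m) finS.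
eexists; first by split; [exact: f1|exact: f2].
by move=> s sI; apply: mP; apply: fixed_lower => i; apply/f3/sI.
Qed.

End Annihilation.

(** * Untwisting *)

Section Untwisting.
Variables (gT : finGroupType) (k : closedFieldType) (g : finLieAlgType k) (A : comAlgType k).
Variables (aA : alg_action gT A) (ag : lie_action gT g).
Hypothesis free : acts_freely aA.
Variable S : set (ratpt A).
Hypothesis XS : in_Xstar aA S.
Local Notation gA := (gtensor g A).
Local Notation L := (fixed_alg aA ag).
Implicit Types (V : liemod L) (W : liemod gA) (J : set A) (eta : ratpt A -> nat).

Definition coords_in J : set gA := [set s | forall i, J (s i)].

Lemma coords_inB J s t : ideal J -> coords_in J s -> coords_in J t -> coords_in J (s - t).
Proof.
move=> JJ hs ht i; rewrite !ffunE.
exact: (idealB JJ (hs i) (ht i)).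
Qed.

(** The invariant t is chosen modulo the intersection of J with the ideal that defines r, so that
    one t both computes r s and meets the further condition imposed by J. *)
Lemma is_untwisting_approx V (r : lie_rep gA V) J s : is_untwisting S r -> primary S J ->
  exists2 t : L, coords_in J (s - fixed_val t) & r s = action V t.
Proof.
move=> [eta [fin sub ann rE]] Jp.
have Ep := ideal_of_primary fin sub.
have [T TP] := fixed_approx ag free XS (primaryI Jp Ep).
exists (T s); first by move=> i; have [] := TP s i.
by apply: rE; apply/tens_idealP => [|i]; [case: Ep|have [] := TP s i].
Qed.

Lemma is_untwisting_fixed V (r : lie_rep gA V) (t : L) :
  is_untwisting S r -> r (fixed_val t) = action V t.
Proof.
move=> [eta [fin sub ann rE]]; apply: rE; rewrite subrr; exact: (proj1 (lspan_lin _)).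
Qed.

Lemma is_untwisting_killed V (r : lie_rep gA V) : is_untwisting S r ->
  exists2 eta, supported S eta & forall s, coords_in (ideal_of eta) s -> r s = 0.
Proof.
move=> [eta [fin sub ann rE]]; exists eta => // s sI.
rewrite (rE s 0); first by apply/lfunP => v; rewrite action0 zero_lfunE.
by rewrite subr0; apply/tens_idealP => //; case: (ideal_of_primary fin sub).
Qed.

(** The action is that of V composed with the approximation T. T is not a homomorphism, but its
    failure consists of invariants in g (x) [ideal_of eta], which kill V. *)
Lemma exists_untwisting V eta : supported S eta ->
  (forall t : L, coords_in (ideal_of eta) (fixed_val t) -> forall v, action V t v = 0) ->
  exists r : lie_rep gA V, is_untwisting S r.
Proof.
move=> Seta kill; have [fin sub] := Seta; have Ep := supported_primary Seta.
have [EI _] := Ep; have [T TP] := fixed_approx ag free XS Ep.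
have eqA (t t' : L) : coords_in (ideal_of eta) (fixed_val t - fixed_val t') ->
    forall v, action V t v = action V t' v.
  move=> tt' v; apply/eqP; rewrite -subr_eq0; apply/eqP.
  by rewrite -actionB; exact: kill.
have rl : linear (fun s => action V (T s)).
  by move=> c s s'; rewrite linearP lie_rep_linear.
have rm (x y : gA) v : action V (T (lie x y)) v =
    action V (T x) (action V (T y) v) - action V (T y) (action V (T x) v).
  rewrite -lie_rep_lie; apply: eqA => i.
  (* T[x, y] - [T x, T y] is expressed through the three errors x - T x, y - T y and [x, y] -
     T[x, y], each with coordinates in the ideal. *)
  have -> : fixed_val (T (lie x y)) - fixed_val (lie (T x) (T y)) =
      (lie (x - fixed_val (T x)) y + lie (fixed_val (T x)) (y - fixed_val (T y)))
      - (lie x y - fixed_val (T (lie x y))).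
    have lieBl (a b c : gA) : lie (a - b) c = lie a c - lie b c.
      by rewrite -scaleN1r addrC lie_linearl scaleN1r addrC.
    have lieBr (a b c : gA) : lie c (a - b) = lie c a - lie c b.
      by rewrite -scaleN1r addrC lie_linearr scaleN1r addrC.
    by rewrite lieBl lieBr addrA subrK opprB [RHS]addrC addrA subrK.
  move: i; apply: coords_inB => //.
  move=> i; rewrite ffunE; have [_ ID _] := EI; apply: ID.
    by rewrite lie_anti ffunE; apply: idealN => //; apply: lie_ideal_coords => // j; exact: TP.
  by apply: lie_ideal_coords => // j; exact: TP.
exists (LieRep rl rm); exists eta; split=> //.
- move=> t tI; apply/lfunP => v; rewrite zero_lfunE; apply: kill.
  exact/tens_idealP.
- move=> s t /= /(tens_idealP _ EI) st; apply/lfunP => v; apply: eqA.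
  have -> : fixed_val (T s) - fixed_val t = (s - fixed_val t) - (s - fixed_val (T s)).
    by rewrite opprB [RHS]addrC addrA subrK.
  exact: coords_inB.
Qed.

Lemma untwist_untwisting V eta : supported S eta ->
  (forall t : L, coords_in (ideal_of eta) (fixed_val t) -> forall v, action V t v = 0) ->
  is_untwisting S (action (untwist S V)).
Proof.
move=> Seta kill; rewrite /untwist /=; case: pselect => [h|no].
  exact: projT2 (cid h).
by case: no; exact: exists_untwisting kill.
Qed.

Lemma action_twist_untwist V : is_untwisting S (action (untwist S V)) ->
  action (twist aA ag (untwist S V)) = action V :> lie_rep L V.
Proof.
move=> unt; apply: lie_rep_ext => t v.
exact: (congr1 (fun f : 'End(V) => f v) (is_untwisting_fixed t unt)).
Qed.

Lemma twist_untwist V : is_untwisting S (action (untwist S V)) ->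
  twist aA ag (untwist S V) = V.
Proof. by move=> /action_twist_untwist/(liemod_ext (V := V)). Qed.

Lemma action_untwist_twist W eta : supported S eta ->
  (forall s : gA, coords_in (ideal_of eta) s -> forall v, action W s v = 0) ->
  action (untwist S (twist aA ag W)) = action W :> lie_rep gA W.
Proof.
move=> Seta kill.
have unt : is_untwisting S (action (untwist S (twist aA ag W))).
  by apply: (untwist_untwisting Seta) => t tI v; apply: kill.
apply: lie_rep_ext => s v.
have [t st ->] := is_untwisting_approx s unt (supported_primary Seta).
apply/esym/eqP; rewrite -subr_eq0; apply/eqP.
by rewrite -[action (twist _ _ _) t v]/(action W (fixed_val t) v) -actionB; exact: kill.
Qed.

Lemma untwist_twist W eta : supported S eta ->
  (forall s : gA, coords_in (ideal_of eta) s -> forall v, action W s v = 0) ->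
  untwist S (twist aA ag W) = W.
Proof. by move=> Seta /(action_untwist_twist Seta)/(liemod_ext (V := W)). Qed.

End Untwisting.

(** * Twisting and untwisting of evaluation classes *)

Section Classes.
Variables (gT : finGroupType) (k : closedFieldType) (g : finLieAlgType k) (A : comAlgType k).
Variables (aA : alg_action gT A) (ag : lie_action gT g) (td : triangular_decomposition g).
Hypothesis char0 : [pchar k] =i pred0.
Hypothesis ss : semisimple g.
Hypothesis free : acts_freely aA.
Local Notation X := (ratpt A).
Local Notation gA := (gtensor g A).
Local Notation L := (fixed_alg aA ag).
Implicit Types (psi : X -> weight td) (c d : gT).

Lemma psi_Gamma_orbit psi c x : in_Xstar aA (wt_supp psi) -> wt_supp psi x ->
  psi_Gamma aA ag psi (pt_act aA c x) = weight_act ag c (psi x).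
Proof.
move=> XS Sx; rewrite /psi_Gamma (bigD1 c) //= pt_actK big1 ?addr0 // => d dc.
have [->|/eqP psid] := eqVneq (psi (pt_act aA d^-1%g (pt_act aA c x))) 0.
  exact: weight_act0.
have [] := @Xstar_eq _ _ _ aA _ d c _ _ free XS psid Sx (pt_actKV _ _ _).
by move/eqP; rewrite (negbTE dc).
Qed.

Lemma psi_Gamma_supp psi x : wt_supp (psi_Gamma aA ag psi) x ->
  exists2 y, wt_supp psi y & exists c, x = pt_act aA c y.
Proof.
move=> px; apply: contrapT => no; apply: px; rewrite /psi_Gamma big1 // => c _.
have [->|/eqP psic] := eqVneq (psi (pt_act aA c^-1%g x)) 0; first exact: weight_act0.
by case: no; exists (pt_act aA c^-1%g x) => //; exists c; rewrite pt_actKV.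
Qed.

Lemma psi_Gamma_in_EGamma psi : in_E psi -> in_Xstar aA (wt_supp psi) ->
  in_EGamma aA ag (psi_Gamma aA ag psi).
Proof.
move=> [dom fin] XS; split; first split.
- move=> x; have [->|/eqP px] := eqVneq (psi_Gamma aA ag psi x) 0.
    by move=> a H _ _; exists 0%N; rewrite zero_lfunE.
  have [y Sy [c ->]] := psi_Gamma_supp px; rewrite psi_Gamma_orbit //.
  exact: weight_act_dominant.
- apply: (sub_finite_set (B := \bigcup_(c in [set: gT]) (pt_act aA c @` wt_supp psi))).
    by move=> x /psi_Gamma_supp[y Sy [c ->]]; exists c => //; exists y.
  apply: bigcup_finite => [|c _]; first exact: finite_finset.
  exact: finite_image.
move=> c x; have [x0|/eqP px] := eqVneq (psi_Gamma aA ag psi x) 0.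
  rewrite x0 weight_act0 //; have [//|/eqP cx0] := eqVneq (psi_Gamma aA ag psi (pt_act aA c x)) 0.
  have [y Sy [d e]] := psi_Gamma_supp cx0.
  have xE : x = pt_act aA (c^-1 * d)%g y by rewrite pt_actM -e pt_actK.
  move: x0; rewrite xE psi_Gamma_orbit // weight_actM // => x0.
  rewrite -xE e psi_Gamma_orbit //.
  transitivity (weight_act ag c (weight_act ag c^-1%g (weight_act ag d (psi y)))).
    by rewrite weight_actK.
  by rewrite x0 weight_act0.
have [y Sy [d ->]] := psi_Gamma_supp px.
by rewrite -pt_actM !psi_Gamma_orbit // weight_actM.
Qed.

Lemma psi_Gamma_eq psi x : in_Xstar aA (wt_supp psi) -> wt_supp psi x ->
  psi_Gamma aA ag psi x = psi x.
Proof.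
by move=> XS Sx; rewrite -{1}[x](pt_act1 aA) psi_Gamma_orbit // weight_act1.
Qed.

(** The points, modules and tensor map of V are reused: psi^Gamma agrees with psi on the support of
    psi, and each orbit in its own support meets that of psi in exactly one point. *)
Lemma twist_ev psi (V : liemod gA) : in_Xstar aA (wt_supp psi) -> ev psi V ->
  evGamma (psi_Gamma aA ag psi) (twist aA ag V).
Proof.
move=> XS [n [p [rho [pS puniq rhow [mu [tens muE]]]]]].
exists n, p, rho; split.
- by move=> i; rewrite /wt_supp /= psi_Gamma_eq //; exact: pS.
- move=> y /psi_Gamma_supp[z Sz [c ->]]; have [i [pz iuniq]] := puniq z Sz.
  exists i; split; first by rewrite -pz; exists c.
  move=> j [d _ e]; apply: iuniq.
  by have [_] := Xstar_eq free XS (pS j) Sz e.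
- by move=> i; rewrite psi_Gamma_eq //; exact: pS.
- by exists mu; split=> // a v; exact: muE.
Qed.

Variable S : set X.
Hypothesis XS : in_Xstar aA S.

Lemma psi_restr_in_E psi : in_E psi -> in_E (psi_restr S psi).
Proof.
move=> [dom fin]; split=> [x|]; rewrite /psi_restr.
  by case: ifP => _ //; move=> a H _ _; exists 0%N; rewrite zero_lfunE.
apply: sub_finite_set fin => x; rewrite /wt_supp /=; case: ifP => //.
Qed.

Lemma psi_restr_supp psi x : wt_supp (psi_restr S psi) x <-> S x /\ wt_supp psi x.
Proof. by rewrite /wt_supp /psi_restr /=; case: asboolP => Sx; split=> [|[]]. Qed.

(** Each representative [p i] is [c i] applied to a point [q i] of S. Evaluation of an invariant at
    c.q is c applied to its evaluation at q, so [rho i] is replaced by its pullback along [c i],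
    whose highest weight is psi (q i) by equivariance. *)
Lemma untwist_ev psi (V : liemod L) : in_EGamma aA ag psi ->
  wt_supp psi `<=` orbits aA S -> evGamma psi V -> ev (psi_restr S psi) (untwist S V).
Proof.
move=> [[dom fin] equiv] sub [n [p [rho [pS puniq rhow ev]]]].
have /choice[z zP] : forall i, exists z : X * gT, S z.1 /\ p i = pt_act aA z.2 z.1.
  by move=> i; have [x Sx [c _ e]] := sub _ (pS i); exists (x, c).
pose q i := (z i).1; pose c i := (z i).2.
have qS i : S (q i) by have [] := zP i.
have pq i : p i = pt_act aA (c i) (q i) by have [] := zP i.
have psiq i : psi (q i) = weight_act ag (c i)^-1%g (psi (p i)).
  by rewrite pq equiv -weight_actM // mulVg weight_act1.
have qpsi i : wt_supp psi (q i).
  move=> q0; apply: (pS i); rewrite pq equiv.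
  by rewrite -[psi (q i)]/(psi (q i)) q0 weight_act0.
(* For an evaluation module the exponent 1 on S suffices: invariants vanishing on S vanish on all
   its orbits. *)
have [finS _] := XS; have [f1 f2 f3] := ideal_of_const (ltn0Sn 0) finS.
have Seta : supported S (fun x => if `[< S x >] then 1%N else 0%N) by split.
have kill (t : L) : coords_in (ideal_of (fun x => if `[< S x >] then 1%N else 0%N))
    (fixed_val t) -> forall v, action V t v = 0.
  move=> tI; apply: (evaluation_kill ev) => i.
  rewrite pq ev_at_fixed (@ev_at_vanish _ _ _ S) ?linear0 // => j.
  have := f3 _ (tI j); apply: ideal_mul_least; first exact/ideal_lin/vanishing_ideal.
  by move=> f f' fS _; exact: (ideal_mulr f' (vanishing_ideal S) fS).
have unt := untwist_untwisting free XS Seta kill.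
exists n, q, (fun i => pull (ag (c i)) (rho i)); split.
- by move=> i; apply/psi_restr_supp; split.
- move=> y /psi_restr_supp[Sy psiy]; have [i [[d _ piy] iuniq]] := puniq y psiy.
  have qy : q i = y.
    move: piy; rewrite pq -pt_actM => e.
    have [|_ //] := @Xstar_eq _ _ _ aA S (d * c i)%g 1%g (q i) y free XS (qS i) Sy.
    by rewrite pt_act1.
  exists i; split=> // j e; apply: iuniq; exists (c j)^-1%g => //.
  by rewrite pq pt_actK.
- move=> i; rewrite /psi_restr asboolT // psiq.
  by have := weight_act_pull ag char0 (c i)^-1%g (rhow i); rewrite invgK.
have [mu [tens muE]] := ev; exists mu; split=> // s v.
have [t st ->] := is_untwisting_approx free XS s unt (primary_vanishing S).
rewrite muE; apply: eq_bigr => i _; congr (mu (dfwith v _)).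
rewrite pq ev_at_fixed /=; congr (action _ (ag _ _) _).
apply/esym/eqP; rewrite -subr_eq0; apply/eqP.
have := ev_at_vanish st (qS i).
have := ev_at_linear (g := g) (q i) (-1) (fixed_val t) s.
by rewrite !scaleN1r [- _ + s]addrC [- _ + _]addrC => <-.
Qed.

End Classes.

(** * The isomorphism of categories *)

Section Preservation.
Variables (gT : finGroupType) (k : closedFieldType) (g : finLieAlgType k) (A : comAlgType k).
Variables (aA : alg_action gT A) (ag : lie_action gT g) (td : triangular_decomposition g).
Hypothesis char0 : [pchar k] =i pred0.
Hypothesis fg : finitely_generated A.
Hypothesis ss : semisimple g.
Hypothesis free : acts_freely aA.
Variable S : set (ratpt A).
Hypothesis XS : in_Xstar aA S.
Local Notation gA := (gtensor g A).
Local Notation L := (fixed_alg aA ag).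

Lemma in_Xstar_sub (S' : set (ratpt A)) : S' `<=` S -> in_Xstar aA S'.
Proof.
move=> sub; have [fin disj] := XS; split; first exact: sub_finite_set sub fin.
by move=> x y /sub Sx /sub Sy; apply: disj.
Qed.

(** A constituent W of the restriction is killed by invariants in the ideal that kills V, so it can
    be untwisted. As s and its approximation t act alike on V, the untwisted W is a constituent of
    V, and [twist_ev] carries its class back. *)
Lemma twist_in_FGamma (V : liemod gA) : in_F td S V -> in_FGamma td S (twist aA ag V).
Proof.
move=> VF W [irrW [U [f [Usub fU fE]]]].
have [eta Seta kill] := in_F_killed char0 ss XS VF.
have Wf w : exists2 u, u \in U & w = f u.
  have /memv_imgP[u uU ->] : w \in (f @: U)%VS by rewrite fU memvf.
  by exists u.
have killW (t : L) : coords_in (ideal_of eta) (fixed_val t) ->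
    forall w, action W t w = 0.
  move=> tI w; have [u uU ->] := Wf w; rewrite -fE //=.
  by rewrite (kill _ tI) linear0.
have unt := untwist_untwisting free XS Seta killW.
pose W' := untwist S W; have W'E : twist aA ag W' = W := twist_untwist unt.
have actW (t : L) w : action W' (fixed_val t) w = action W t w.
  exact: (congr1 (fun f : 'End(W) => f w) (is_untwisting_fixed t unt)).
have actV (s s' : gA) v : coords_in (ideal_of eta) (s - s') -> action V s v = action V s' v.
  by move=> ss'; apply/eqP; rewrite -subr_eq0 -actionB kill.
have cW' : constituent V W'.
  split.
    have [W0 Wirr] := irrW; split=> // T Tsub; apply: Wirr => t w wT.
    by rewrite -actW; apply: Tsub.
  exists U, f; split=> // [s u uU|s u uU].
    have [t st _] := is_untwisting_approx free XS s unt (supported_primary Seta).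
    by rewrite (actV _ _ _ st); exact: (Usub t).
  have [t st e] := is_untwisting_approx free XS s unt (supported_primary Seta).
  rewrite (actV _ _ _ st) (fE t) //.
  by rewrite -[RHS]/((action W' s : 'End(W)) (f u)) e.
have [psi [Epsi evW' sub]] := VF _ cW'.
have Xpsi := in_Xstar_sub sub.
exists (psi_Gamma aA ag psi); split.
- exact: psi_Gamma_in_EGamma.
- by rewrite -W'E; exact: twist_ev.
- by move=> x /(psi_Gamma_supp char0)[y /sub Sy [c ->]]; exists y => //; exists c.
Qed.

Lemma in_FGamma_untwisting (V : liemod L) : in_FGamma td S V ->
  is_untwisting S (action (untwist S V)).
Proof.
move=> VF; have [eta Seta kill] := in_FGamma_killed char0 fg ss free XS VF.
exact: (untwist_untwisting free XS Seta kill).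
Qed.

(** The restriction of a constituent of [untwist S V] is a constituent of V; it stays irreducible
    because every s is an invariant modulo the annihilating ideal. *)
Lemma untwist_in_F (V : liemod L) : in_FGamma td S V -> in_F td S (untwist S V).
Proof.
move=> VF W [irrW [U [f [Usub fU fE]]]].
have unt := in_FGamma_untwisting VF; have [eta Seta kill] := is_untwisting_killed unt.
have Wf w : exists2 u, u \in U & w = f u.
  have /memv_imgP[u uU ->] : w \in (f @: U)%VS by rewrite fU memvf.
  by exists u.
have killW (s : gA) : coords_in (ideal_of eta) s -> forall w, action W s w = 0.
  move=> sI w; have [u uU ->] := Wf w; rewrite -fE //.
  by rewrite (kill _ sI) zero_lfunE linear0.
have actV (t : L) v : action (untwist S V) (fixed_val t) v = action V t v.
  exact: (congr1 (fun f : 'End(V) => f v) (is_untwisting_fixed t unt)).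
have cW : constituent V (twist aA ag W).
  split.
    have [W0 Wirr] := irrW; split=> // T Tsub; apply: Wirr => s w wT.
    have [T' T'P] := fixed_approx ag free XS (supported_primary Seta).
    have -> : action W s w = action W (fixed_val (T' s)) w.
      apply/eqP; rewrite -subr_eq0 -actionB killW //; exact: T'P.
    exact: (Tsub (T' s)).
  exists U, f; split=> // t u uU; rewrite -actV; first exact: Usub.
  exact: fE.
have [psi [Epsi evW sub]] := VF _ cW.
exists (psi_restr S psi); split.
- by apply: psi_restr_in_E; case: Epsi.
- have := untwist_ev char0 free XS Epsi sub evW.
  by rewrite (untwist_twist ag free XS Seta killW).
- by move=> x /psi_restr_supp[].
Qed.

End Preservation.

(** * Equality of functors and transport of morphisms *)

Section FunctorEquality.

Definition cast_hom (C : category) (X X' Y Y' : C) (eX : X = X') (eY : Y = Y')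
    (f : hom X Y) : hom X' Y' :=
  match eX in _ = X', eY in _ = Y' return hom X' Y' with erefl, erefl => f end.

Lemma functor_ext (C D : category) (F G : functor C D) (e : forall X, F X = G X) :
  (forall X Y (f : hom X Y), cast_hom (e X) (e Y) (fmor F f) = fmor G f) -> F = G.
Proof.
case: F e => Fo Fm F1 FM; case: G => Go Gm G1 GM /= e.
have eo : Fo = Go by apply: funext.
case: Go / eo Gm G1 GM e => Gm G1 GM e.
have -> : e = fun X => erefl by apply: Prop_irrelevance.
move=> /= h; have em : Fm = Gm.
  by apply: functional_extensionality_dep => X; apply: functional_extensionality_dep => Y;
    apply: funext => f; exact: h.
case: Gm / em G1 GM h => G1 GM _.
by congr Functor; exact: Prop_irrelevance.
Qed.

(** The modules on both sides share their spaces and differ at most by the action, so the cast does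
    not change the linear map. Once the actions are identified, all equality proofs become
    reflexivity by proof irrelevance. *)
Lemma cast_modhom (k : fieldType) (L : lieAlgType k) (P : liemod L -> Prop)
    (V W : liemod L) (r : lie_rep L V) (s : lie_rep L W)
    (pr : P (LieMod r)) (ps : P (LieMod s)) (pV : P V) (pW : P W)
    (eV : exist P (LieMod r) pr = exist P V pV) (eW : exist P (LieMod s) ps = exist P W pW)
    (f : modhom (LieMod r) (LieMod s)) (f' : modhom V W) :
  r = action V -> s = action W -> sval f = sval f' ->
  @cast_hom (@full_sub (mod_category L) P) (exist P (LieMod r) pr) (exist P V pV)
    (exist P (LieMod s) ps) (exist P W pW) eV eW f = f'.
Proof.
case: V r pr pV eV f f' => V aV r pr pV eV; case: W s ps pW eW => W aW s ps pW eW f f' /= er es.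
move: pr ps eV eW f; rewrite er es => pr ps.
rewrite (Prop_irrelevance pr pV) (Prop_irrelevance ps pW) => eV eW.
rewrite (Prop_irrelevance eV erefl) (Prop_irrelevance eW erefl) => f ff' /=.
by apply: eq_sig_hprop => // ?; exact: Prop_irrelevance.
Qed.

End FunctorEquality.

(** An invariant t that computes s on V and is congruent to s modulo an ideal killing the untwisted
    W acts as s on both sides, and f commutes with t. *)
Lemma untwist_equivariant (gT : finGroupType) (k : closedFieldType) (g : finLieAlgType k)
    (A : comAlgType k) (aA : alg_action gT A) (ag : lie_action gT g)
    (S : set (ratpt A)) (V W : liemod (fixed_alg aA ag)) (f : 'Hom(V, W)) :
  acts_freely aA -> in_Xstar aA S ->
  is_untwisting S (action (untwist S V)) -> is_untwisting S (action (untwist S W)) ->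
  equivariant f -> @equivariant k _ (untwist S V) (untwist S W) f.
Proof.
move=> free XS untV untW fE s v; have [eta Seta kill] := is_untwisting_killed untW.
have [t st e] := is_untwisting_approx free XS s untV (supported_primary Seta).
transitivity (action W t (f v)); first by rewrite -fE -e.
have e' : action (untwist S W) (fixed_val t) (f v) = action W t (f v).
  exact: (congr1 (fun h : 'End(W) => h (f v)) (is_untwisting_fixed t untW)).
rewrite -e'; apply/esym/eqP; rewrite -subr_eq0 -actionB (kill _ st).
by rewrite zero_lfunE.
Qed.

Lemma twist_untwist_inverse (gT : finGroupType) (k : closedFieldType)
    (g : finLieAlgType k) (A : comAlgType k)
    (aA : alg_action gT A) (ag : lie_action gT g)
    (td : triangular_decomposition g) (x : set (ratpt A)) :
  [pchar k] =i pred0 -> finitely_generated A -> semisimple g ->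
  acts_freely aA -> in_Xstar aA x ->
  exists (Tx : functor (F_cat td x) (FGamma_cat aA ag td x))
         (Ux : functor (FGamma_cat aA ag td x) (F_cat td x)),
    [/\ fcomp (full_incl _) Tx = fcomp (twist aA ag) (full_incl _),
        forall V, full_incl _ (Ux V) = untwist x (full_incl _ V),
        fcomp (forget _) (fcomp (full_incl _) Ux) =
          fcomp (forget _) (full_incl _)
      & mutually_inverse Tx Ux].
Proof.
move=> char0 fg ss free XS.
pose Tx : functor (F_cat td x) (FGamma_cat aA ag td x) :=
  @Functor (F_cat td x) (FGamma_cat aA ag td x)
    (fun V => exist (in_FGamma td x) (twist aA ag (sval V))
       (twist_in_FGamma char0 ss free XS (svalP V)))
    (fun V W f => fmor (twist aA ag) f)
    (fun V => fmor1 (twist aA ag) (sval V))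
    (fun V W Z h f => fmorM (twist aA ag) h f).
have unt (V : FGamma_cat aA ag td x) := in_FGamma_untwisting char0 fg ss free XS (svalP V).
pose Um (V W : FGamma_cat aA ag td x) (f : hom V W) :
    @hom (mod_category _) (untwist x (sval V)) (untwist x (sval W)) :=
  exist _ (sval f) (untwist_equivariant free XS (unt V) (unt W) (svalP f)).
have Um1 V : Um V V (Defs.idm V) = @Defs.idm (mod_category _) (untwist x (sval V)).
  by apply: eq_sig_hprop => // ?; exact: Prop_irrelevance.
have UmM V W Z (h : hom W Z) (f : hom V W) : Um V Z (compm h f) = compm (Um W Z h) (Um V W f).
  by apply: eq_sig_hprop => // ?; exact: Prop_irrelevance.
pose Ux : functor (FGamma_cat aA ag td x) (F_cat td x) :=
  @Functor (FGamma_cat aA ag td x) (F_cat td x)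
    (fun V => exist (in_F td x) (untwist x (sval V))
       (untwist_in_F char0 fg ss free XS (svalP V))) Um Um1 UmM.
have UTact (V : liemod (gtensor g A)) : in_F td x V ->
    action (untwist x (twist aA ag V)) = action V :> lie_rep _ V.
  move=> VF; have [eta Seta kill] := in_F_killed char0 ss XS VF.
  exact: (action_untwist_twist ag free XS Seta kill).
have TUact (V : liemod (fixed_alg aA ag)) : in_FGamma td x V ->
    action (twist aA ag (untwist x V)) = action V :> lie_rep _ V.
  by move=> VF; apply: action_twist_untwist; exact: (in_FGamma_untwisting char0 fg ss free XS VF).
have UT V : Ux (Tx V) = V.
  case: V => V pV; apply: eq_exist => /=.
  have [eta Seta kill] := in_F_killed char0 ss XS pV.
  exact: (untwist_twist ag free XS Seta kill).
have TU V : Tx (Ux V) = V.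
  case: V => V pV; apply: eq_exist => /=.
  exact: (twist_untwist (in_FGamma_untwisting char0 fg ss free XS pV)).
exists Tx, Ux; split.
- by congr Functor; exact: Prop_irrelevance.
- by [].
- by congr Functor; exact: Prop_irrelevance.
split.
  apply: (@functor_ext _ _ (fcomp Ux Tx) (fid _) UT) => -[V pV] [W pW] f.
  exact: (cast_modhom (UT (exist _ V pV)) (UT (exist _ W pW)) (UTact V pV) (UTact W pW)).
apply: (@functor_ext _ _ (fcomp Tx Ux) (fid _) TU) => -[V pV] [W pW] f.
exact: (cast_modhom (TU (exist _ V pV)) (TU (exist _ W pW)) (TUact V pV) (TUact W pW)).
Qed.

Theorem theorem2p10 (k : closedFieldType) (A : comAlgType k)
    (g : finLieAlgType k) (gT : finGroupType)
    (aA : alg_action gT A) (ag : lie_action gT g)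
    (td : triangular_decomposition g) (x : set (ratpt A)) :
  [pchar k] =i pred0 -> finitely_generated A -> semisimple g ->
  abelian [set: gT]%SET -> acts_freely aA -> in_Xstar aA x ->
  [/\ forall psi : ratpt A -> weight td,
        in_E psi -> in_Xstar aA (wt_supp psi) ->
        in_EGamma aA ag (psi_Gamma aA ag psi) /\
        forall V, ev psi V ->
          evGamma (psi_Gamma aA ag psi) (twist aA ag V),
      forall psi : ratpt A -> weight td,
        in_EGamma aA ag psi -> wt_supp psi `<=` orbits aA x ->
        in_E (psi_restr x psi) /\
        forall V : liemod (fixed_alg aA ag), evGamma psi V ->
          ev (psi_restr x psi) (untwist x V)
    & exists (Tx : functor (F_cat td x) (FGamma_cat aA ag td x))
             (Ux : functor (FGamma_cat aA ag td x) (F_cat td x)),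
        [/\ fcomp (full_incl _) Tx = fcomp (twist aA ag) (full_incl _),
            forall V, full_incl _ (Ux V) = untwist x (full_incl _ V),
            fcomp (forget _) (fcomp (full_incl _) Ux) =
              fcomp (forget _) (full_incl _)
          & mutually_inverse Tx Ux]].
Proof.
move=> char0 fg ss _ free XS; split=> [psi Epsi Xpsi|psi Epsi sub|].
- split; first exact: psi_Gamma_in_EGamma.
  by move=> V; exact: twist_ev.
- split; first by apply: psi_restr_in_E; case: Epsi.
  by move=> V; exact: untwist_ev.
- exact: twist_untwist_inverse.
Qed.
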